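(* In the Wyner-Ziv problem with a helper described in the context, where $Y-Z-X$ is a Markov chain, the operational achievable region equals the single-letter region: $\mathcal R^O_{Y-Z-X}(D)=\mathcal R_{Y-Z-X}(D)$.
   Context: Let $\mathcal X,\mathcal Y,\mathcal Z,\hat{\mathcal X}$ be finite alphabets, $d:\mathcal X\times\hat{\mathcal X}\to[0,\infty)$ a distortion measure, and $(X_i,Y_i,Z_i)$ i.i.d. with distribution $p(x,y,z)=p(z,y)p(x|z)$ (Markov chain $Y-Z-X$). A helper observing $Y^n$ sends a message $T_1=f_1(Y^n)\in\{1,\dots,2^{nR_1}\}$ to both the encoder and the decoder; the encoder observing $X^n$ sends $T=f(X^n,T_1)\in\{1,\dots,2^{nR}\}$ to the decoder; the decoder observes side information $Z^n$ and outputs $\hat X^n=g(T,T_1,Z^n)\in\hat{\mathcal X}^n$. A pair $(R,R_1)$ is achievable at distortion $D$ if for every $\epsilon>0$ and all sufficiently large $n$ there exist such $f_1,f,g$ with $\mathbb E\big[\frac1n\sum_{i=1}^n d(X_i,\hat X_i)\big]\le D+\epsilon$; $\mathcal R^O_{Y-Z-X}(D)$ is the closure of the set of achievable pairs. $\mathcal R_{Y-Z-X}(D)$ is the set of all pairs $(R,R_1)$ with $R_1\ge I(U;Y|X)$ and $R\ge I(X;V|U,Z)$ for some finite-alphabet auxiliary random variables $U,V$ with joint distribution $p(x,y,z,u,v)=p(z,y)p(x|z)p(u|y)p(v|x,u)$ and a deterministic function $\hat X(U,V,Z)$ with $\mathbb E\, d(X,\hat X(U,V,Z))\le D$. *)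

(* Defs.v *)
From mathcomp Require Import all_boot all_order all_algebra.
From mathcomp Require Import reals exp.
Set Implicit Arguments. Unset Strict Implicit. Unset Printing Implicit Defensive.
Import Order.TTheory GRing.Theory Num.Theory.
Local Open Scope ring_scope.

Section WZHelper.
Variable R : realType.

(** logarithm in base 2 (rates are in bits, message sets have size 2^{nR}) *)
Definition log2 (x : R) : R := ln x / ln 2.

Definition is_pmf (T : finType) (p : T -> R) : Prop :=
  (forall t, 0 <= p t) /\ \sum_(t : T) p t = 1.

Definition is_channel (A B : finType) (W : A -> B -> R) : Prop :=
  forall a, is_pmf (W a).

Definition cond_mutual_info (T TA TB TC : finType) (P : T -> R)
    (A : T -> TA) (B : T -> TB) (C : T -> TC) : R :=
  \sum_(a : TA) \sum_(b : TB) \sum_(c : TC)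
    let pabc := \sum_(t | (A t == a) && (B t == b) && (C t == c)) P t in
    let pac  := \sum_(t | (A t == a) && (C t == c)) P t in
    let pbc  := \sum_(t | (B t == b) && (C t == c)) P t in
    let pc   := \sum_(t | C t == c) P t in
    if 0 < pabc then pabc * log2 (pabc * pc / (pac * pbc)) else 0.

Variables (X Y Z Xh : finType).
Variable pZY : Z * Y -> R.
Variable W : Z -> X -> R.           (* p(x|z) *)
Variable d : X -> Xh -> R.

Definition pXYZ (x : X) (y : Y) (z : Z) : R := pZY (z, y) * W z x.

(** expected average distortion of a block code of length n with message
    sets 'I_M1 (helper) and 'I_M (encoder) *)
Definition code_distortion (n M1 M : nat)
    (f1 : {ffun 'I_n -> Y} -> 'I_M1)
    (f : {ffun 'I_n -> X} -> 'I_M1 -> 'I_M)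
    (g : 'I_M -> 'I_M1 -> {ffun 'I_n -> Z} -> {ffun 'I_n -> Xh}) : R :=
  \sum_(xs : {ffun 'I_n -> X}) \sum_(ys : {ffun 'I_n -> Y})
   \sum_(zs : {ffun 'I_n -> Z})
    (\prod_(i < n) pXYZ (xs i) (ys i) (zs i)) *
    ((n%:R)^-1 * \sum_(i < n)
        d (xs i) (g (f xs (f1 ys)) (f1 ys) zs i)).

Definition achievable (D Rt R1 : R) : Prop :=
  forall eps : R, 0 < eps ->
  exists N : nat, forall n : nat, (N <= n)%N ->
  exists (M1 M : nat),
    (M1%:R <= powR 2 (n%:R * R1)) /\ (M%:R <= powR 2 (n%:R * Rt)) /\
    exists (f1 : {ffun 'I_n -> Y} -> 'I_M1)
           (f : {ffun 'I_n -> X} -> 'I_M1 -> 'I_M)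
           (g : 'I_M -> 'I_M1 -> {ffun 'I_n -> Z} -> {ffun 'I_n -> Xh}),
      code_distortion f1 f g <= D + eps.

Definition op_region (D Rt R1 : R) : Prop :=
  forall e : R, 0 < e ->
  exists Rt' R1', achievable D Rt' R1' /\ `|Rt - Rt'| < e /\ `|R1 - R1'| < e.

Definition sl_region (D Rt R1 : R) : Prop :=
  exists (U V : finType) (q : Y -> U -> R) (r : X * U -> V -> R)
         (xhat : U -> V -> Z -> Xh),
    is_channel q /\ is_channel r /\
    let P := fun t : X * Y * Z * U * V =>
      let: (x, y, z, u, v) := t in pXYZ x y z * q y u * r (x, u) v in
    \sum_(t : X * Y * Z * U * V)
       P t * (let: (x, y, z, u, v) := t in d x (xhat u v z)) <= D /\
    R1 >= cond_mutual_info P (fun t => t.1.2) (fun t => t.1.1.1.2)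
                             (fun t => t.1.1.1.1) /\
    Rt >= cond_mutual_info P (fun t => t.1.1.1.1) (fun t => t.2)
                             (fun t => (t.1.2, t.1.1.2)).

End WZHelper.

(* Main.v *)
(* Converse.  For a block code put U_i = (T_1, Z^(i-1), X_(i+1)^n).  Since X^i depends
   on everything else only through Z^i, the decoder loses nothing if it replaces its
   future side information Z_(i+1)^n by X_(i+1)^n, so the best reconstruction of X_i
   from (U_i, T, Z_i) is at least as good as the one of the code; V_i is this
   reconstruction, as a function of the value of Z_i.  Chain rules bound the two sums
   of conditional informations by log M_1 and log M.  Caratheodory's theorem bounds the
   alphabet of U, and compactness of the set of channels absorbs the epsilons.

   Achievability.  Two applications of the same random binning argument: the helper
   describes U^n at rate I(U;Y) - I(U;X) = I(U;Y|X), which suffices for the encoder and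
   a fortiori for the decoder as I(U;X) <= I(U;Z); then, for each u^n, the encoder
   describes V^n at rate I(X;V|U) - I(Z;V|U) = I(X;V|U,Z).  The analysis is one-shot
   (soft covering for the encoder, maximum likelihood for the decoders), and Chernoff
   bounds on the information densities give the rates. *)

Require Import Defs.
From mathcomp Require Import all_boot all_order all_algebra.
From mathcomp Require Import boolp classical_sets filter reals topology normedtype exp sequences.
From mathcomp Require Import ring lra.
Set Implicit Arguments. Unset Strict Implicit. Unset Printing Implicit Defensive.
Import Order.TTheory GRing.Theory Num.Theory.
Import numFieldNormedType.Exports.
Local Open Scope ring_scope.

(** * Entropy on finite probability spaces *)

Section Entropy.
Variable R : realType.

(** The operational region is a closure while the single-letter region asks for exact inequalities,
    so the converse needs a limit of auxiliary channels; but a code of length n yields a U whose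
    alphabet grows with n. Hence U is brought to an alphabet of fixed size before the limit is
    taken. Letting V range over functions from Z to Xh fixes the alphabet of V from the start.

    In the direct part no typical sets occur and no Markov lemma is needed: a sender picks the bin
    of least expected final cost, and the average over codewords that bounds this minimum is the
    ideal cost up to covering and decoding errors. The helper's cost is the distortion of the whole
    second stage, whose codes, one for each u^n, are therefore fixed first. Since the encoder and
    the decoder recover u^n separately and may disagree, this cost takes two codewords as arguments.

    Entropies are in nats; ln 2 appears only in the comparison with rates in bits. *)

Lemma ln_lexp (x : R) : 0 < x -> ln x <= x - 1.
Proof. by move=> x0; have := @le_ln1Dx R (x - 1); rewrite (addrC 1) subrK; apply; lra. Qed.

Lemma ln_lexp_eq (x : R) : 0 < x -> ln x = x - 1 -> x = 1.
Proof.
move=> x0 e; apply/eqP; rewrite -(ln_eq0 x0); apply/negPn/negP => ne.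
by have := expR_gt1Dx ne; rewrite lnK ?posrE// e; lra.
Qed.

Lemma relent_term_ge (p q : R) : 0 <= p -> 0 <= q -> (0 < p -> 0 < q) ->
  p - q <= p * (ln p - ln q).
Proof.
rewrite le_eqVlt => /predU1P[<- q0 _|p0 q0 /(_ p0) q1]; first by lra.
have := ln_lexp (divr_gt0 q1 p0); rewrite ln_div ?posrE// => h.
have := ler_wpM2l (ltW p0) h; rewrite [p * (q / p - 1)]mulrBr mulrCA divff ?gt_eqF// => {}h.
by lra.
Qed.

Lemma relent_term_eq (p q : R) : 0 <= p -> 0 <= q -> (0 < p -> 0 < q) ->
  p - q = p * (ln p - ln q) -> p = q.
Proof.
rewrite le_eqVlt => /predU1P[<- q0 _|p0 q0 /(_ p0) q1 e]; first by lra.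
have : q / p = 1.
  apply: ln_lexp_eq; first exact: divr_gt0.
  rewrite ln_div ?posrE//; apply: (mulfI (negbT (gt_eqF p0))).
  by rewrite [p * (q / p - 1)]mulrBr mulrCA divff ?gt_eqF//; lra.
by move/(canRL (divfK (negbT (gt_eqF p0)))); rewrite mul1r => ->.
Qed.

Lemma gibbs (I : finType) (p q : I -> R) :
  (forall i, 0 <= p i) -> (forall i, 0 <= q i) -> (forall i, 0 < p i -> 0 < q i) ->
  \sum_i q i <= \sum_i p i ->
  0 <= \sum_i p i * (ln (p i) - ln (q i)).
Proof.
move=> p0 q0 pq s; apply: (@le_trans _ _ (\sum_i (p i - q i))).
  by rewrite sumrB subr_ge0.
by apply: ler_sum => i _; apply: relent_term_ge (p0 i) (q0 i) (pq i).
Qed.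

(** Each p ln(p/q) - (p - q) is nonnegative and the hypotheses make their sum nonpositive, so all of
    them vanish and [relent_term_eq] applies termwise. This turns an equality of entropies back into
    a factorisation of a law. *)
Lemma gibbs_eq (I : finType) (p q : I -> R) :
  (forall i, 0 <= p i) -> (forall i, 0 <= q i) -> (forall i, 0 < p i -> 0 < q i) ->
  \sum_i q i <= \sum_i p i ->
  \sum_i p i * (ln (p i) - ln (q i)) = 0 -> forall i, p i = q i.
Proof.
move=> p0 q0 pq s e i.
have t i' : 0 <= p i' * (ln (p i') - ln (q i')) - (p i' - q i').
  by rewrite subr_ge0; apply: relent_term_ge (p0 i') (q0 i') (pq i').
have : \sum_i (p i * (ln (p i) - ln (q i)) - (p i - q i)) = 0.
  apply: le_anti; rewrite sumr_ge0 ?andbT; last by move=> *; apply: t.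
  by rewrite sumrB e sub0r sumrB opprB subr_le0.
move/eqP; rewrite psumr_eq0; last by move=> *; apply: t.
move=> /allP/(_ i); rewrite mem_index_enum subr_eq0 => /(_ isT)/eqP h.
by apply: relent_term_eq (p0 i) (q0 i) (pq i) _.
Qed.

Definition pr (T TA : finType) (P : T -> R) (A : T -> TA) (a : TA) : R :=
  \sum_(t | A t == a) P t.

(* In nats; [ln 0 = 0] is harmless since [pr P A (A t) = 0] only where [P t = 0]. *)
Definition ent (T TA : finType) (P : T -> R) (A : T -> TA) : R :=
  \sum_t P t * - ln (pr P A (A t)).

Definition jn (T TA TB : Type) (A : T -> TA) (B : T -> TB) := fun t => (A t, B t).

Definition determined (T TA TB : Type) (A : T -> TA) (B : T -> TB) :=
  forall t t', B t = B t' -> A t = A t'.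

Section Space.
Variables (T : finType) (P : T -> R).
Hypothesis P_ge0 : forall t, 0 <= P t.

Lemma pr_ge0 (TA : finType) (A : T -> TA) a : 0 <= pr P A a.
Proof. by apply: sumr_ge0. Qed.

Lemma pr_gt0 (TA : finType) (A : T -> TA) t : 0 < P t -> 0 < pr P A (A t).
Proof.
move=> t0; rewrite /pr (bigD1 t)//=; apply: ltr_wpDr => //.
by apply: sumr_ge0.
Qed.

Lemma sum_pr (TA : finType) (A : T -> TA) (F : TA -> R) :
  \sum_t P t * F (A t) = \sum_a pr P A a * F a.
Proof.
rewrite (partition_big A xpredT)//=; apply: eq_bigr => a _.
by rewrite /pr mulr_suml; apply: eq_bigr => t /eqP ->.
Qed.

Lemma sum_pr1 (TA : finType) (A : T -> TA) : \sum_a pr P A a = \sum_t P t.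
Proof.
have := sum_pr A (fun=> 1); under eq_bigr do rewrite mulr1.
by move=> ->; apply: eq_bigr => a _; rewrite mulr1.
Qed.

Lemma entE (TA : finType) (A : T -> TA) :
  ent P A = \sum_a pr P A a * - ln (pr P A a).
Proof. exact: (sum_pr A (fun a => - ln (pr P A a))). Qed.

Lemma pr_jnl (TA TB : finType) (A : T -> TA) (B : T -> TB) b :
  \sum_a pr P (jn A B) (a, b) = pr P B b.
Proof.
rewrite /pr (partition_big A xpredT)//=; apply: eq_bigr => a _.
by apply: eq_bigl => t; rewrite xpair_eqE andbC.
Qed.

Lemma pr_jnr (TA TB : finType) (A : T -> TA) (B : T -> TB) a :
  \sum_b pr P (jn A B) (a, b) = pr P A a.
Proof.
rewrite /pr (partition_big B xpredT)//=; exact: eq_bigr.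
Qed.

Lemma pr3_sum2 (TA TB TC : finType) (A : T -> TA) (B : T -> TB) (C : T -> TC) a c :
  \sum_b pr P (jn (jn A B) C) (a, b, c) = pr P (jn A C) (a, c).
Proof.
rewrite -(pr_jnr (jn A C) B); apply: eq_bigr => b _; apply: eq_bigl => t.
by rewrite !xpair_eqE -!andbA; congr (_ && _); rewrite andbC.
Qed.

Lemma pr3_sum1 (TA TB TC : finType) (A : T -> TA) (B : T -> TB) (C : T -> TC) b c :
  \sum_a pr P (jn (jn A B) C) (a, b, c) = pr P (jn B C) (b, c).
Proof.
rewrite -(pr_jnl A (jn B C)); apply: eq_bigr => a _; apply: eq_bigl => t.
by rewrite !xpair_eqE -!andbA.
Qed.

Lemma pr_bij (TA TB : finType) (A : T -> TA) (h : T -> TB) (e : TA -> TB -> T) a :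
  (forall a b, A (e a b) = a) -> (forall a b, h (e a b) = b) ->
  (forall t, e (A t) (h t) = t) -> pr P A a = \sum_b P (e a b).
Proof.
move=> eA eh et; rewrite /pr (reindex (e a))/=.
  by apply: eq_bigl => b; rewrite eA eqxx.
exists h => [b _|t]; first exact: eh.
by rewrite inE => /eqP <-.
Qed.

Lemma pr_det_le (TA TB : finType) (A : T -> TA) (B : T -> TB) a b :
  (forall t, B t = b -> A t = a) -> pr P B b <= pr P A a.
Proof.
move=> h; rewrite /pr big_mkcond [X in _ <= X]big_mkcond; apply: ler_sum => t _.
by case: eqP => [/h ->|_]; rewrite ?eqxx //; case: ifP.
Qed.

Lemma ent_det (TA TB : finType) (A : T -> TA) (B : T -> TB) :
  determined A B -> ent P A <= ent P B.
Proof.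
move=> AB; apply: ler_sum => t _.
have := P_ge0 t; rewrite le_eqVlt => /predU1P[<-|t0]; first by rewrite !mul0r.
apply: ler_wpM2l; first exact: ltW.
rewrite lerN2 ler_ln ?posrE ?pr_gt0//.
by apply: pr_det_le => t' /AB.
Qed.

Lemma ent_eq (TA TB : finType) (A : T -> TA) (B : T -> TB) :
  determined A B -> determined B A -> ent P A = ent P B.
Proof. by move=> h1 h2; apply: le_anti; rewrite !ent_det. Qed.

Section Cond.
Variables (TA TB TC : finType) (A : T -> TA) (B : T -> TB) (C : T -> TC).

Let p3 (w : TA * TB * TC) := pr P (jn (jn A B) C) w.
(** The law with the (A,C) and (B,C) marginals of [p3] that makes A and B independent given C. The
    conditional mutual information is the relative entropy of [p3] with respect to [q3]. *)
Let q3 (w : TA * TB * TC) :=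
  pr P (jn A C) (w.1.1, w.2) * pr P (jn B C) (w.1.2, w.2) / pr P C w.2.

Let p3_ge0 w : 0 <= p3 w. Proof. exact: pr_ge0. Qed.
Let q3_ge0 w : 0 <= q3 w.
Proof. by rewrite /q3 divr_ge0 ?mulr_ge0// pr_ge0. Qed.

Let p3_leAC w : p3 w <= pr P (jn A C) (w.1.1, w.2).
Proof. by apply: pr_det_le => t <-. Qed.
Let p3_leBC w : p3 w <= pr P (jn B C) (w.1.2, w.2).
Proof. by apply: pr_det_le => t <-. Qed.
Let p3_leC w : p3 w <= pr P C w.2.
Proof. by apply: pr_det_le => t <-. Qed.

Let p3q3 w : 0 < p3 w -> 0 < q3 w.
Proof.
move=> h; rewrite /q3 divr_gt0 ?mulr_gt0//; apply: (lt_le_trans h).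
- exact: p3_leAC.
- exact: p3_leBC.
- exact: p3_leC.
Qed.

Let sumq3 : \sum_w q3 w = \sum_w p3 w.
Proof.
rewrite sum_pr1 -(sum_pr1 C) -(pair_bigA _ (fun w c => q3 (w, c)))/= exchange_big/=.
apply: eq_bigr => c _; rewrite -(pair_bigA _ (fun a b => q3 ((a, b), c)))/= /q3/=.
under eq_bigr => a _ do rewrite -mulr_suml -mulr_sumr pr_jnl.
rewrite -!mulr_suml pr_jnl.
have [->|c0] := eqVneq (pr P C c) 0; first by rewrite !mul0r.
by rewrite mulfK.
Qed.

Let ent3 : ent P (jn A C) + ent P (jn B C) - ent P (jn (jn A B) C) - ent P C =
  \sum_w p3 w * (ln (p3 w) - ln (q3 w)).
Proof.
rewrite -(sum_pr (jn (jn A B) C) (fun w => ln (p3 w) - ln (q3 w))).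
rewrite /ent -big_split -!sumrB/=; apply: eq_bigr => t _.
have := P_ge0 t; rewrite le_eqVlt => /predU1P[<-|t0]; first by rewrite !mul0r; ring.
rewrite /p3 /q3/= ln_div ?lnM ?posrE ?mulr_gt0 ?(pr_gt0 (jn A C)) ?(pr_gt0 (jn B C)) ?(pr_gt0 C)//.
by rewrite /jn/=; ring.
Qed.

Lemma ent_submod0 :
  ent P (jn (jn A B) C) + ent P C <= ent P (jn A C) + ent P (jn B C).
Proof.
rewrite -subr_ge0 opprD addrA ent3; apply: gibbs => //.
by rewrite sumq3.
Qed.

Lemma ent_condindep :
  ent P (jn A C) + ent P (jn B C) = ent P (jn (jn A B) C) + ent P C ->
  forall a b c, pr P (jn (jn A B) C) (a, b, c) =
     pr P (jn A C) (a, c) * pr P (jn B C) (b, c) / pr P C c.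
Proof.
move=> e a b c; apply: (@gibbs_eq _ p3 q3 _ _ _ _ _ (a, b, c)) => //.
  by rewrite sumq3.
by rewrite -ent3 e; ring.
Qed.

(** Any factorisation will do, without normalisation: summing it out gives the marginals, and these
    recombine to [q3] = [p3] wherever [p3] is positive. *)
Lemma condindep_ent (F : TA -> TC -> R) (G : TB -> TC -> R) :
  (forall a b c, pr P (jn (jn A B) C) (a, b, c) = F a c * G b c) ->
  ent P (jn A C) + ent P (jn B C) = ent P (jn (jn A B) C) + ent P C.
Proof.
move=> h.
have hAC a c : pr P (jn A C) (a, c) = F a c * \sum_b G b c.
  by rewrite mulr_sumr -(pr3_sum2 A B C); apply: eq_bigr => b _; rewrite h.
have hBC b c : pr P (jn B C) (b, c) = (\sum_a F a c) * G b c.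
  by rewrite mulr_suml -(pr3_sum1 A B C); apply: eq_bigr => a _; rewrite h.
have hC c : pr P C c = (\sum_a F a c) * \sum_b G b c.
  by rewrite -(pr_jnl A C) mulr_suml; apply: eq_bigr => a _; rewrite hAC.
apply/eqP; rewrite -subr_eq0 opprD addrA ent3; apply/eqP.
apply: big1 => -[[a b] c] _; have := p3_ge0 (a, b, c).
rewrite le_eqVlt => /predU1P[<-|]; first by rewrite mul0r.
move=> h0; suff -> : q3 (a, b, c) = p3 (a, b, c) by rewrite subrr mulr0.
have := lt_le_trans h0 (p3_leC _); rewrite /q3 /p3/= hAC hBC h hC => c0.
have /andP[F0 G0] : (\sum_a F a c != 0) && (\sum_b G b c != 0).
  by rewrite -negb_or -mulf_eq0 gt_eqF.
by field; rewrite F0 G0.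
Qed.

Lemma cond_mutual_infoE : cond_mutual_info P A B C * ln 2 =
  ent P (jn A C) + ent P (jn B C) - ent P (jn (jn A B) C) - ent P C.
Proof.
have l2 : ln 2 != 0 :> R by rewrite gt_eqF// ln_gt0// ltr1n.
rewrite ent3 /cond_mutual_info mulr_suml.
rewrite -(pair_bigA _ (fun w c => p3 (w, c) * (ln (p3 (w, c)) - ln (q3 (w, c)))))/=.
rewrite -(pair_bigA _ (fun a b => \sum_c p3 (a, b, c) * (ln (p3 (a, b, c)) - ln (q3 (a, b, c)))))/=.
apply: eq_bigr => a _; rewrite mulr_suml; apply: eq_bigr => b _.
rewrite mulr_suml; apply: eq_bigr => c _.
have -> : \sum_(t | (A t == a) && (B t == b) && (C t == c)) P t = p3 (a, b, c).
  by apply: eq_bigl => t; rewrite !xpair_eqE.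
have -> : \sum_(t | (A t == a) && (C t == c)) P t = pr P (jn A C) (a, c).
  by apply: eq_bigl => t; rewrite !xpair_eqE.
have -> : \sum_(t | (B t == b) && (C t == c)) P t = pr P (jn B C) (b, c).
  by apply: eq_bigl => t; rewrite !xpair_eqE.
rewrite -/(pr P C c); case: ifPn => [h0|].
  rewrite /log2 -mulrA divfK//; congr (_ * _).
  have hAC := lt_le_trans h0 (p3_leAC _); have hBC := lt_le_trans h0 (p3_leBC _).
  have hC := lt_le_trans h0 (p3_leC _); move: hAC hBC hC => /= hAC hBC hC.
  by rewrite /q3/= !(ln_div, lnM) ?posrE ?mulr_gt0//; ring.
rewrite -leNgt => h0; suff -> : p3 (a, b, c) = 0 by rewrite !mul0r.
by apply: le_anti; rewrite h0 p3_ge0.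
Qed.

End Cond.

(* Every Shannon inequality of the converse is an instance of this form of
   [I(A;B|M) >= 0], up to side conditions "is a function of". *)
Lemma ent_submod (TP TQ TJ TM : finType) (A : T -> TP) (B : T -> TQ) (J : T -> TJ)
    (M : T -> TM) : determined J (jn A B) -> determined M A -> determined M B ->
  ent P J + ent P M <= ent P A + ent P B.
Proof.
move=> hJ hA hB; have := ent_submod0 A B M.
have -> : ent P (jn A M) = ent P A by apply: ent_eq => t t'; [move=> h; rewrite /jn h (hA _ _ h) | case].
have -> : ent P (jn B M) = ent P B by apply: ent_eq => t t'; [move=> h; rewrite /jn h (hB _ _ h) | case].
apply: le_trans; rewrite lerD2r; apply: ent_det => t t' [h1 h2 _].
by apply: hJ; rewrite /jn h1 h2.
Qed.

Hypothesis P_sum1 : \sum_t P t = 1.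

(** Gibbs' inequality against the uniform law on [TA]. *)
Lemma ent_le_card (TA : finType) (A : T -> TA) : ent P A <= ln #|TA|%:R.
Proof.
have c0 : 0 < #|TA|%:R :> R.
  case: (pickP T) => [t _|T0]; last by move: P_sum1; rewrite big_pred0// => /eqP; rewrite eq_sym oner_eq0.
  by rewrite ltr0n; apply/card_gt0P; exists (A t).
have := @gibbs TA (pr P A) (fun=> #|TA|%:R^-1).
rewrite sum_pr1 P_sum1 sumr_const -[_ *+ #|_|]mulr_natr mulVf ?gt_eqF// lexx.
have -> : \sum_a pr P A a * (ln (pr P A a) - ln (#|TA|%:R^-1)) =
   \sum_a pr P A a * ln #|TA|%:R - ent P A.
  rewrite entE -sumrB; apply: eq_bigr => a _.
  by rewrite lnV ?posrE//; ring.
rewrite -mulr_suml sum_pr1 P_sum1 mul1r subr_ge0; apply => //.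
- exact: pr_ge0.
- by move=> _; rewrite invr_ge0 ltW.
- by move=> _ _; rewrite invr_gt0.
Qed.

Lemma ent_unit (TA : finType) (A : T -> TA) : (forall t t', A t = A t') -> ent P A = 0.
Proof.
move=> h; rewrite /ent big1// => t _.
suff -> : pr P A (A t) = 1 by rewrite ln1 oppr0 mulr0.
by rewrite -P_sum1; apply: eq_bigl => t'; rewrite (h t' t) eqxx.
Qed.

Lemma ent_subadd (TA TB : finType) (A : T -> TA) (B : T -> TB) :
  ent P (jn A B) <= ent P A + ent P B.
Proof.
have := @ent_submod _ _ _ _ A B (jn A B) (fun=> tt).
by rewrite (ent_unit (A:=fun=> tt))// addr0; apply.
Qed.

End Space.
End Entropy.

(** * Product spaces *)

Section ProductSpace.
Variable R : realType.

Lemma sum_ffun_pair (I A B : finType) (F : {ffun I -> A} -> {ffun I -> B} -> R) :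
  \sum_a \sum_b F a b =
  \sum_(w : {ffun I -> A * B}) F [ffun i => (w i).1] [ffun i => (w i).2].
Proof.
rewrite pair_bigA/=.
rewrite (reindex (fun w : {ffun I -> A * B} => ([ffun i => (w i).1], [ffun i => (w i).2])))//=.
exists (fun ab : {ffun I -> A} * {ffun I -> B} => [ffun i => (ab.1 i, ab.2 i)]) => [w _|[a b] _].
  by apply/ffunP => i; rewrite !ffunE -surjective_pairing.
by congr (_, _); apply/ffunP => i; rewrite !ffunE.
Qed.

Definition prodp (I : finType) (T : Type) (p : T -> R) (w : I -> T) : R := \prod_i p (w i).

Lemma prodp_ge0 (I : finType) (T : Type) (p : T -> R) (w : I -> T) :
  (forall t, 0 <= p t) -> 0 <= prodp p w.
Proof. by move=> p0; apply: prodr_ge0. Qed.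

Lemma prodp_gt0 (I : finType) (T : Type) (p : T -> R) (w : I -> T) :
  (forall t, 0 <= p t) -> 0 < prodp p w -> forall i, 0 < p (w i).
Proof.
move=> p0 h i; rewrite lt_neqAle p0 andbT eq_sym; apply/eqP => e.
by move: h; rewrite /prodp (bigD1 i)//= e mul0r ltxx.
Qed.

Lemma sum_prodp (I T : finType) (p : T -> R) :
  \sum_(w : {ffun I -> T}) prodp p w = (\sum_t p t) ^+ #|I|.
Proof. by rewrite /prodp -(bigA_distr_bigA (fun (i : I) t => p t)) prodr_const. Qed.

Lemma prodp_marginal (I T : finType) (p : T -> R) (g : T -> R) (j : I) :
  \sum_t p t = 1 ->
  \sum_(w : {ffun I -> T}) prodp p w * g (w j) = \sum_t p t * g t.
Proof.
move=> p1; transitivity (\sum_(w : {ffun I -> T})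
    \prod_i (p (w i) * (if i == j then g (w i) else 1))).
  apply: eq_bigr => w _; rewrite big_split/=; congr (_ * _).
  by rewrite -big_mkcond/= big_pred1_eq.
rewrite -(bigA_distr_bigA (fun (i : I) t => p t * (if i == j then g t else 1))).
rewrite (bigD1 j)//= eqxx [X in _ * X]big1 ?mulr1// => i /negbTE ->.
by under eq_bigr do rewrite mulr1.
Qed.

Lemma prodp_marginal2 (I T : finType) (p : T -> R) (g : T -> T -> R) (j k : I) :
  \sum_t p t = 1 -> j != k ->
  \sum_(w : {ffun I -> T}) prodp p w * g (w j) (w k) = \sum_t \sum_t' p t * p t' * g t t'.
Proof.
move=> p1 jk; have kj : k != j by rewrite eq_sym.
(* Indicators of the values at [j] and [k] are inserted so that the sum over [w] factors over the
   coordinates. *)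
transitivity (\sum_t \sum_t' g t t' * \sum_(w : {ffun I -> T})
    \prod_i (p (w i) * (if i == j then (w i == t)%:R else if i == k then (w i == t')%:R else 1))).
  under [RHS]eq_bigr do under eq_bigr do rewrite mulr_sumr.
  under [RHS]eq_bigr do rewrite exchange_big/=.
  rewrite exchange_big/=; apply: eq_bigr => w _.
  rewrite (bigD1 (w j))//= [X in _ + X]big1 ?addr0 => [|t tj]; last first.
    apply: big1 => t' _; rewrite (bigD1 j)//= eqxx eq_sym (negbTE tj).
    by rewrite mulr0 mul0r mulr0.
  rewrite (bigD1 (w k))//= [X in _ + X]big1 ?addr0 => [|t tk]; last first.
    rewrite (bigD1 k)//= (negbTE kj) eqxx eq_sym (negbTE tk).
    by rewrite mulr0 mul0r mulr0.
  rewrite mulrC big_split/= [X in _ * (_ * X)]big1 ?mulr1// => i _.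
  by case: eqP => [->|_]; [rewrite eqxx|case: eqP => [->|//]; rewrite eqxx].
apply: eq_bigr => t _; apply: eq_bigr => t' _; rewrite mulrC; congr (_ * _).
rewrite -(bigA_distr_bigA (fun (i : I) s => p s * (if i == j then (s == t)%:R else if i == k then (s == t')%:R else 1))).
have ind u : \sum_s p s * (s == u)%:R = p u.
  by rewrite (bigD1 u)//= eqxx mulr1 big1 ?addr0// => s /negbTE ->; rewrite mulr0.
rewrite (bigD1 j)//= eqxx ind (bigD1 k)//= (negbTE kj) eqxx ind mulrA.
rewrite [X in _ * X]big1 ?mulr1// => i /andP[/negbTE -> /negbTE ->].
by under eq_bigr do rewrite mulr1.
Qed.

Lemma pr_prodp n (T TB : finType) (p : T -> R) (h : 'I_n -> T -> TB) (b : {ffun 'I_n -> TB}) :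
  pr (fun w : {ffun 'I_n -> T} => prodp p w) (fun w => [ffun j => h j (w j)]) b =
  \prod_j pr p (h j) (b j).
Proof.
rewrite /pr (bigA_distr_big_dep (fun j t => h j t == b j)); apply: eq_bigl => w.
apply/eqP/familyP => [<- j|H]; first by rewrite unfold_in ffunE.
by apply/ffunP => j; rewrite ffunE; have := H j; rewrite unfold_in => /eqP.
Qed.

Lemma ln_prod (I : finType) (F : I -> R) : (forall i, 0 < F i) ->
  ln (\prod_i F i) = \sum_i ln (F i).
Proof.
move=> F0; suff [] : 0 < \prod_i F i /\ ln (\prod_i F i) = \sum_i ln (F i) by [].
elim/big_rec2: _ => [|i x y _ [y0 <-]]; first by rewrite ltr01 ln1.
by rewrite mulr_gt0 ?F0// lnM ?posrE.
Qed.

Lemma ent_prodp n (T TB : finType) (p : T -> R) (h : 'I_n -> T -> TB) :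
  (forall t, 0 <= p t) -> \sum_t p t = 1 ->
  ent (fun w : {ffun 'I_n -> T} => prodp p w) (fun w => [ffun j => h j (w j)]) =
  \sum_j ent p (h j).
Proof.
move=> p0 p1; rewrite /ent.
under [RHS]eq_bigr => j _ do rewrite -(prodp_marginal (fun t => - ln (pr p (h j) (h j t))) j p1).
rewrite exchange_big/=; apply: eq_bigr => w _; rewrite -mulr_sumr.
have := prodp_ge0 w p0; rewrite le_eqVlt => /predU1P[<-|w0]; first by rewrite !mul0r.
rewrite pr_prodp sumrN ln_prod; first by under eq_bigr do rewrite ffunE.
by move=> j; rewrite ffunE; apply: pr_gt0 => //; apply: prodp_gt0.
Qed.

End ProductSpace.

(** * Single-letterisation *)

Section CondCost.
Variables (R : realType) (T TA TB TC S : finType) (P : T -> R).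
Variables (A : T -> TA) (B : T -> TB) (C : T -> TC) (cost : TA -> S -> R).
Hypothesis P_ge0 : forall t, 0 <= P t.

(** [K c s] is the unnormalised expected cost of the estimate [s] given C = c. As A and B are
    independent given C, the cost of [g] there is an average over b of [K c (g b c)], hence at least
    the minimum [K c (h c)]. *)
Lemma condindep_best_estimate (s0 : S) (g : TB -> TC -> S) :
  (forall a b c, pr P (jn (jn A B) C) (a, b, c) =
     pr P (jn A C) (a, c) * pr P (jn B C) (b, c) / pr P C c) ->
  exists h : TC -> S,
    \sum_t P t * cost (A t) (h (C t)) <= \sum_t P t * cost (A t) (g (B t) (C t)).
Proof.
move=> hi; pose K c s := \sum_a pr P (jn A C) (a, c) * cost a s.
pose h c := [arg min_(s < s0) K c s]%O.
have hK c s : K c (h c) <= K c s.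
  by rewrite /h; case: arg_minP => // s' _ /(_ s isT).
exists h.
rewrite (sum_pr P (jn A C) (fun ac => cost ac.1 (h ac.2))).
rewrite (sum_pr P (jn (jn A B) C) (fun w => cost w.1.1 (g w.1.2 w.2))).
rewrite -(pair_bigA _ (fun a c => pr P (jn A C) (a, c) * cost a (h c)))/=.
rewrite -(pair_bigA _ (fun ab c => pr P (jn (jn A B) C) (ab, c) * cost ab.1 (g ab.2 c)))/=.
rewrite exchange_big [X in _ <= X]exchange_big/=; apply: ler_sum => c _.
rewrite -(pair_bigA _ (fun a b => pr P (jn (jn A B) C) (a, b, c) * cost a (g b c)))/=.
rewrite exchange_big/= -/(K c (h c)).
have -> : \sum_b \sum_a pr P (jn (jn A B) C) (a, b, c) * cost a (g b c) =
   \sum_b pr P (jn B C) (b, c) / pr P C c * K c (g b c).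
  apply: eq_bigr => b _; rewrite mulr_sumr; apply: eq_bigr => a _.
  by rewrite hi; ring.
have [c0|c0] := eqVneq (pr P C c) 0.
  have K0 s : K c s = 0.
    apply: big1 => a _; suff -> : pr P (jn A C) (a, c) = 0 by rewrite mul0r.
    apply: le_anti; rewrite pr_ge0// andbT -c0; apply: pr_det_le => // t.
    by case.
  by rewrite K0 big1// => b _; rewrite K0 mulr0.
rewrite -[leLHS]mul1r -(divff c0) -{1}(pr_jnl P B C) !mulr_suml.
apply: ler_sum => b _; apply: ler_wpM2l; last exact: hK.
by rewrite divr_ge0 ?pr_ge0.
Qed.
End CondCost.

(** * The source block and the entropy inequalities for one of its letters *)

Section Source.
Variables (R : realType) (X Y Z : finType).
Variable pZY : Z * Y -> R.
Variable W : Z -> X -> R.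
Hypotheses (HpZY : is_pmf pZY) (HW : is_channel W).

Definition src (t : X * Y * Z) : R := pXYZ pZY W t.1.1 t.1.2 t.2.

Lemma src_ge0 t : 0 <= src t.
Proof. by rewrite /src /pXYZ mulr_ge0 ?HpZY.1 ?(HW _).1. Qed.

Lemma src_sum1 : \sum_t src t = 1.
Proof.
rewrite -(pair_bigA _ (fun xy z => src (xy, z)))/=.
rewrite -(pair_bigA _ (fun x y => \sum_z src (x, y, z)))/= exchange_big/=.
under eq_bigr => y _ do rewrite exchange_big/=.
under eq_bigr => y _ do under eq_bigr => z _ do rewrite /src/pXYZ/= -mulr_sumr (HW z).2 mulr1.
by rewrite exchange_big pair_bigA/= -HpZY.2; apply: eq_bigr => -[].
Qed.

(* A mask says which of the three source components of a letter are visible; the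
   entropy of a masked block is then a sum over letters ([ent_masked]), so identities
   between such entropies are checked letter by letter. *)
Definition msk (b : bool * bool * bool) (t : X * Y * Z) : option X * option Y * option Z :=
  (if b.1.1 then Some t.1.1 else None, if b.1.2 then Some t.1.2 else None,
   if b.2 then Some t.2 else None).

Definition agree (b : bool * bool * bool) (t t' : X * Y * Z) : Prop :=
  [/\ b.1.1 = true -> t.1.1 = t'.1.1, b.1.2 = true -> t.1.2 = t'.1.2 & b.2 = true -> t.2 = t'.2].

Lemma mskP b t t' : msk b t = msk b t' <-> agree b t t'.
Proof.
rewrite /msk /agree; case: b => [[b1 b2] b3]/=; split=> [|[]].
  by case: b1; case: b2; case: b3 => h; split=> // _; move: h; congruence.
by case: b1 => [/(_ erefl) ->|_]; case: b2 => [/(_ erefl) ->|_]; case: b3 => [/(_ erefl) ->|_].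
Qed.

Definition mask_ent (b : bool * bool * bool) := ent src (msk b).

(** H(X|Y,Z) = H(X|Z): the form in which the Markov chain Y - Z - X enters the converse. *)
Lemma mask_ent_markov : mask_ent (true, true, true) - mask_ent (false, true, true) =
  mask_ent (true, false, true) - mask_ent (false, false, true).
Proof.
pose A (t : X * Y * Z) := t.1.1; pose B (t : X * Y * Z) := t.1.2; pose C (t : X * Y * Z) := t.2.
have -> : mask_ent (true, true, true) = ent src (jn (jn A B) C).
  by apply: ent_eq; [exact: src_ge0| |] => -[[x y] z] [[x' y'] z']; rewrite /jn /msk /A /B /C/= => -[-> -> ->].
have -> : mask_ent (false, true, true) = ent src (jn B C).
  by apply: ent_eq; [exact: src_ge0| |] => -[[x y] z] [[x' y'] z']; rewrite /jn /msk /A /B /C/= => -[-> ->].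
have -> : mask_ent (true, false, true) = ent src (jn A C).
  by apply: ent_eq; [exact: src_ge0| |] => -[[x y] z] [[x' y'] z']; rewrite /jn /msk /A /B /C/= => -[-> ->].
have -> : mask_ent (false, false, true) = ent src C.
  by apply: ent_eq; [exact: src_ge0| |] => -[[x y] z] [[x' y'] z']; rewrite /msk /C/=; [move=> ->|move=> [->]].
suff : ent src (jn A C) + ent src (jn B C) = ent src (jn (jn A B) C) + ent src C by lra.
apply: (@condindep_ent _ _ _ src_ge0 _ _ _ _ _ _ (fun x z => W z x) (fun y z => pZY (z, y))).
move=> x y z; rewrite /pr (big_pred1 (x, y, z)); first by rewrite /src/pXYZ/= mulrC.
by move=> [[x' y'] z'].
Qed.

Section Block.
Variable n : nat.
Notation Om := {ffun 'I_n -> X * Y * Z}.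
Definition bsrc (w : Om) : R := prodp src w.

Lemma bsrc_ge0 w : 0 <= bsrc w.
Proof. exact: prodp_ge0 src_ge0. Qed.

Lemma bsrc_sum1 : \sum_w bsrc w = 1.
Proof. by rewrite sum_prodp src_sum1 expr1n. Qed.

Definition masked (m : 'I_n -> bool * bool * bool) (w : Om) :
  {ffun 'I_n -> option X * option Y * option Z} := [ffun j => msk (m j) (w j)].

Lemma maskedP m w w' : masked m w = masked m w' <-> forall j, agree (m j) (w j) (w' j).
Proof.
split=> [/ffunP h j|h]; first by apply/mskP; have := h j; rewrite !ffunE.
by apply/ffunP => j; rewrite !ffunE; apply/mskP.
Qed.

Lemma ent_masked m : ent bsrc (masked m) = \sum_j mask_ent (m j).
Proof. exact: (ent_prodp (fun j => msk (m j)) src_ge0 src_sum1). Qed.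

Lemma pr_coord (TF : finType) (F : X * Y * Z -> TF) i a :
  pr bsrc (fun w => F (w i)) a = pr src F a.
Proof.
rewrite /pr big_mkcond/=; have := prodp_marginal (fun t => (F t == a)%:R) i src_sum1.
have e (b : bool) (x : R) : (if b then x else 0) = x * b%:R by case: b; rewrite ?mulr1 ?mulr0.
rewrite [X in _ -> _ = X]big_mkcond/=; under [X in _ -> _ = X]eq_bigr do rewrite e.
by move=> <-; apply: eq_bigr => w _; rewrite e.
Qed.

Lemma ent_coord (TF : finType) (F : X * Y * Z -> TF) i :
  ent bsrc (fun w => F (w i)) = ent src F.
Proof.
rewrite /ent -(prodp_marginal (fun t => - ln (pr src F (F t))) i src_sum1).
by apply: eq_bigr => w _; rewrite pr_coord.
Qed.

Definition Xc (i : 'I_n) (w : Om) := (w i).1.1.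
Definition Yc (i : 'I_n) (w : Om) := (w i).1.2.
Definition Zc (i : 'I_n) (w : Om) := (w i).2.

Lemma ent_coord_msk b i (TF : finType) (F : Om -> TF) :
  (forall w w', F w = F w' <-> agree b (w i) (w' i)) -> ent bsrc F = mask_ent b.
Proof.
move=> h; rewrite /mask_ent -(ent_coord _ i); apply: ent_eq; [exact: bsrc_ge0| |] => w w'.
  by move/mskP/h.
by move/h/mskP.
Qed.

Variables (M1 M : nat) (f1 : {ffun 'I_n -> Y} -> 'I_M1) (f : {ffun 'I_n -> X} -> 'I_M1 -> 'I_M).

Definition helper_msg (w : Om) := f1 [ffun i => Yc i w].
Definition encoder_msg (w : Om) := f [ffun i => Xc i w] (helper_msg w).

Lemma helper_msg_det (w w' : Om) : (forall j, (w j).1.2 = (w' j).1.2) -> helper_msg w = helper_msg w'.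
Proof. by move=> h; congr f1; apply/ffunP => j; rewrite !ffunE /Yc h. Qed.

Lemma encoder_msg_det (w w' : Om) : helper_msg w = helper_msg w' -> (forall j, (w j).1.1 = (w' j).1.1) -> encoder_msg w = encoder_msg w'.
Proof. by move=> e h; rewrite /encoder_msg e; congr (f _ _); apply/ffunP => j; rewrite !ffunE /Xc h. Qed.

Definition mask_aux (i j : 'I_n) := ((i < j)%N, false, (j < i)%N).
(* [U_i = (T_1, Z^(i-1), X_(i+1)^n)]. *)
Definition auxU i (w : Om) := (helper_msg w, masked (mask_aux i) w).

(** What is visible in the two telescoping sums: X^n with the first k letters of Y and Z for the
    helper's rate, Z^n with the letters of X from k on for the encoder's rate. [mask_past'] is
    halfway from k to k + 1: Y_k is revealed, Z_k is not yet. *)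
Definition mask_past (k : nat) (j : 'I_n) := (true, (j < k)%N, (j < k)%N).
Definition mask_past' (k : nat) (j : 'I_n) := (true, (j <= k)%N, (j < k)%N).
Definition mask_future (k : nat) (j : 'I_n) := ((k <= j)%N, false, true).


(** The side conditions of [ent_submod] say that one tuple of messages and masked blocks is a
    function of another. [dsolve i] reduces them to single letters and splits on whether the
    position j lies before, at or after i. *)
Ltac spec_all j :=
  repeat match goal with
  | H : forall j0 : ordinal _, agree _ _ _ |- _ => have := H j; move: H
  end; intros;
  repeat match goal with H : agree _ _ _ |- _ => move: H end;
  rewrite /mask_aux /mask_past /mask_past' /mask_future /agree /= ?ltnS.

Ltac leaf :=
  intros; repeat match goal with H : and3 _ _ _ |- _ => destruct H end;
  repeat split; intros; try discriminate; auto.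

Ltac coords i j := spec_all j; case: (ltngtP j i) => [?|?|/val_inj ?]; subst; leaf.
Ltac coordi i := spec_all i; rewrite ?ltnn ?leqnn; leaf.

Ltac dstep i :=
  match goal with
  | |- (_, _) = (_, _) => congr (_, _)
  | |- masked _ _ = masked _ _ => apply (proj2 (maskedP _ _ _)); let j := fresh "j" in intro j; coords i j
  | H : helper_msg ?w = helper_msg ?w' |- helper_msg ?w = helper_msg ?w' => exact H
  | H : encoder_msg ?w = encoder_msg ?w' |- encoder_msg ?w = encoder_msg ?w' => exact H
  | |- helper_msg _ = helper_msg _ => apply: helper_msg_det; let j := fresh "j" in intro j; coords i j
  | |- encoder_msg _ = encoder_msg _ => apply: encoder_msg_det; [| let j := fresh "j" in intro j; coords i j]
  | |- (_ i).1.1 = _ => coordi i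
  | |- (_ i).1.2 = _ => coordi i
  | |- (_ i).2 = _ => coordi i
  end.

Ltac dsolve i :=
  let w := fresh "w" in let w' := fresh "w'" in let H := fresh "H" in
  intros w w' H; unfold jn, auxU, Xc, Yc, Zc in *;
  repeat match goal with H : (_, _) = (_, _) |- _ => injection H; clear H; intros end;
  repeat match goal with H : masked _ _ = masked _ _ |- _ => have := proj1 (maskedP _ _ _) H; clear H; intro end;
  repeat dstep i.

Definition mask_const (b : bool * bool * bool) (j : 'I_n) := b.

Section Step.
Variable i : 'I_n.
Local Notation H F := (ent bsrc F).
Local Notation U := (auxU i).
Local Notation X_ := (Xc i).
Local Notation Y_ := (Yc i).
Local Notation Z_ := (Zc i).

(** I(U_i;Y_i|X_i) <= I(T_1;Y_i,Z_i|X^n,Y^(i-1),Z^(i-1)). Fact [a] discards Z_i on the right; by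
    [b], given X_i the letter Y_i is independent of the rest of this condition; [c] holds because
    the condition together with T_1 determines (U_i, X_i). *)
Lemma helper_step :
  H (jn U X_) + H (jn Y_ X_) - H (jn (jn U Y_) X_) - H X_ <=
  H (jn helper_msg (masked (mask_past i))) + H (masked (mask_past i.+1)) - H (jn helper_msg (masked (mask_past i.+1))) - H (masked (mask_past i)).
Proof.
have a : H (jn helper_msg (masked (mask_past i.+1))) + H (masked (mask_past' i)) <= H (jn helper_msg (masked (mask_past' i))) + H (masked (mask_past i.+1)).
  by apply: (ent_submod bsrc_ge0); dsolve i.
have c : H (jn helper_msg (masked (mask_past' i))) + H (jn U X_) <= H (jn (jn U Y_) X_) + H (jn helper_msg (masked (mask_past i))).
  by apply: (ent_submod bsrc_ge0); dsolve i.
have b : H (masked (mask_past' i)) - H (masked (mask_past i)) = H (jn Y_ X_) - H X_.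
  rewrite !ent_masked -sumrB (bigD1 i)//= big1 ?addr0; last first.
    by move=> j ji; rewrite /mask_past /mask_past' leq_eqVlt val_eqE (negbTE ji) subrr.
  congr (_ - _); last by rewrite /mask_past ltnn; apply/esym/(ent_coord_msk (i := i)) => w w'; split => [|[/(_ erefl)]].
  rewrite /mask_past' leqnn ltnn; apply/esym/(ent_coord_msk (i := i)) => w w'; split => [[]|[]].
    by move=> h1 h2; split.
  by move=> /(_ erefl) h1 /(_ erefl) h2 _; congr (_, _).
by lra.
Qed.

Section Enc.
Variables (TV : finType) (V : {ffun 'I_n -> X * Y * Z} -> TV).
Hypothesis V_det : determined V (jn encoder_msg U).
Local Notation C := (jn U Z_).

(** I(X_i;V_i|U_i,Z_i) <= I(T;X_i|T_1,Z^n,X_(i+1)^n). Facts [a] and [a'] compare the entropies of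
    X_i with T known, V_i being a function of (T, U_i). Without T, facts [b1], [e] and [b2] give
    H(X_i|T_1,Z^n,X_(i+1)^n) >= H(X_i|X_(i+1)^n,Y^n,Z^n) = H(X_i|Z_i) >= H(X_i|U_i,Z_i). *)
Lemma encoder_step :
  H (jn X_ C) + H (jn V C) - H (jn (jn X_ V) C) - H C <=
  H (jn encoder_msg (jn helper_msg (masked (mask_future i.+1)))) + H (jn helper_msg (masked (mask_future i))) - H (jn encoder_msg (jn helper_msg (masked (mask_future i)))) - H (jn helper_msg (masked (mask_future i.+1))).
Proof.
have a : H (jn encoder_msg (jn helper_msg (masked (mask_future i)))) + H (jn encoder_msg C) <=
    H (jn encoder_msg (jn C X_)) + H (jn encoder_msg (jn helper_msg (masked (mask_future i.+1)))).
  by apply: (ent_submod bsrc_ge0); dsolve i.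
have a' : H (jn encoder_msg (jn C X_)) + H (jn V C) <= H (jn (jn X_ V) C) + H (jn encoder_msg C).
  apply: (ent_submod bsrc_ge0).
  - by dsolve i.
  - by dsolve i.
  - by move=> w w' [h1 h2 h3 h4]; congr (_, _); [apply: V_det; rewrite /jn h1 /auxU h2 h3|rewrite /jn /auxU h2 h3 h4].
pose mB (j : 'I_n) := ((i < j)%N, true, true).
pose mJ (j : 'I_n) := ((i <= j)%N, true, true).
have b1 : H (masked mJ) + H (jn helper_msg (masked (mask_future i.+1))) <= H (jn helper_msg (masked (mask_future i))) + H (masked mB).
  by apply: (ent_submod bsrc_ge0); rewrite /mJ /mB; dsolve i.
have b2 : H (jn X_ C) + H Z_ <= H (jn X_ Z_) + H C.
  by apply: (ent_submod bsrc_ge0); dsolve i.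
have e : H (masked mJ) - H (masked mB) = H (jn X_ Z_) - H Z_.
  rewrite !ent_masked -sumrB (bigD1 i)//= big1 ?addr0; last first.
    by move=> j ji; rewrite /mB /mJ leq_eqVlt val_eqE eq_sym (negbTE ji) subrr.
  rewrite /mB /mJ leqnn ltnn mask_ent_markov; congr (_ - _); apply/esym/(ent_coord_msk (i := i)) => w w'; split => [[]|[]].
  - by move=> h1 h2; split.
  - by move=> /(_ erefl) h1 _ /(_ erefl) h2; congr (_, _).
  - by split.
  - by move=> _ _ /(_ erefl).
by lra.
Qed.

(** U_i is a function of Y^n and of letters of X and Z at positions other than i, and given Y_i all
    of these are independent of (X_i, Z_i). *)
Lemma condindep_U_Y_XZ :
  H (jn U Y_) + H (jn (jn X_ Z_) Y_) = H (jn (jn U (jn X_ Z_)) Y_) + H Y_.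
Proof.
apply: le_anti; rewrite (ent_submod0 bsrc_ge0) andbT.
pose mB (j : 'I_n) := (j != i, true, j != i).
have s : H (masked (mask_const (true, true, true))) + H (jn U Y_) <= H (jn (jn U (jn X_ Z_)) Y_) + H (masked mB).
  apply: (ent_submod bsrc_ge0); rewrite /mB /mask_const; last first.
  - move=> w w' /maskedP h; rewrite /jn /auxU; congr (_, _, _).
    + by apply: helper_msg_det => j; have [_] := h j; auto.
    + apply/maskedP => j; have [/= h1 h2 h3] := h j; split => //= ji; [apply: h1|apply: h3].
        by rewrite neq_ltn ji orbT.
      by rewrite neq_ltn ji.
    + by have [_] := h i; auto.
  - by dsolve i.
  - move=> w w' [h1 h2 h3 h4 h5 h6]; apply/maskedP => j; move/maskedP: h6 => /(_ j)[/= k1 k2 k3].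
    by split=> //= _; have [->//|ji] := eqVneq j i; [apply: k1|apply: k3].
have e : H (masked (mask_const (true, true, true))) - H (masked mB) = H (jn (jn X_ Z_) Y_) - H Y_.
  rewrite !ent_masked -sumrB (bigD1 i)//= big1 ?addr0; last first.
    by move=> j ji; rewrite /mB /mask_const ji subrr.
  rewrite /mB /mask_const eqxx /=; congr (_ - _); apply/esym/(ent_coord_msk (i := i)) => w w'; split => [[]|[]].
  - by move=> h1 h2 h3; split.
  - by move=> /(_ erefl) h1 /(_ erefl) h2 /(_ erefl) h3; congr (_, _, _).
  - by split.
  - by move=> _ /(_ erefl).
by lra.
Qed.

(** For a set m of positions, X_m depends on the other letters of X and on Y^n, Z^n through Z_m
    only. *)
Lemma prefix_markov (m : 'I_n -> bool) :
  H (masked (mask_const (true, true, true))) - H (masked (fun j => (~~ m j, true, true))) =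
  H (masked (fun j => (m j, false, m j))) - H (masked (fun j => (false, false, m j))).
Proof.
rewrite !ent_masked -!sumrB; apply: eq_bigr => j _; rewrite /mask_const.
by case: (m j); rewrite /= ?mask_ent_markov ?subrr.
Qed.

(** Given (X_i, U_i) the value of V is a function of X^(i-1), as T is a function of (X^n, T_1) and
    U_i contains the rest. And X^(i-1) is independent of (Y_i, Z_i) given (X_i, U_i): it depends on
    all the rest through Z^(i-1), a part of U_i. *)
Lemma condindep_V_XU_YZ : let K := jn X_ U in
  H (jn V K) + H (jn (jn Y_ Z_) K) = H (jn (jn V (jn Y_ Z_)) K) + H K.
Proof.
move=> K; apply: le_anti; rewrite (ent_submod0 bsrc_ge0) andbT.
pose m (j : 'I_n) := (j < i)%N.
pose XL := masked (fun j : 'I_n => ((j < i)%N, false, false)).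
have s1 : H (jn (jn XL (jn Y_ Z_)) K) + H (jn V K) <= H (jn (jn V (jn Y_ Z_)) K) + H (jn XL K).
  apply: (ent_submod bsrc_ge0); rewrite /K /XL.
  - by dsolve i.
  - by dsolve i.
  - move=> w w' [h1 h2 h3 h4]; congr (_, _); last by rewrite /jn /auxU h2 h3 h4.
    apply: V_det; rewrite /jn/auxU; congr (_, (_, _)) => //.
    move/maskedP: h1 => h1; move/maskedP: h4 => h4; rewrite /Xc in h2.
    by repeat dstep i.
have s2 : H (masked (mask_const (true, true, true))) + H (jn (jn Y_ Z_) K) <=
    H (jn (jn XL (jn Y_ Z_)) K) + H (masked (fun j => (~~ m j, true, true))).
  by apply: (ent_submod bsrc_ge0); rewrite /XL /K /m /mask_const; dsolve i.
have s3 : H (jn XL K) + H (masked (fun j => (false, false, m j))) <= H (masked (fun j => (m j, false, m j))) + H K.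
  by apply: (ent_submod bsrc_ge0); rewrite /XL /K /m; dsolve i.
by have := prefix_markov m; lra.
Qed.

(* Given [X_(i+1)^n], the future side information of the decoder is useless: [X^i]
   depends on all the rest through [Z^i] only. *)
Lemma condindep_X_Zfuture : let L := jn (jn U encoder_msg) Z_ in
  let ZR := masked (fun j : 'I_n => (false, false, (i < j)%N)) in
  H (jn X_ L) + H (jn ZR L) = H (jn (jn X_ ZR) L) + H L.
Proof.
move=> L ZR; apply: le_anti; rewrite (ent_submod0 bsrc_ge0 X_ ZR L) andbT.
(* Position i is included, as [L] contains Z_i. *)
pose m (j : 'I_n) := (j <= i)%N.
pose XL := masked (fun j : 'I_n => ((j <= i)%N, false, false)).
have t1 : H (jn (jn XL ZR) C) + H (jn X_ L) <= H (jn (jn X_ ZR) L) + H (jn XL C).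
  by apply: (ent_submod bsrc_ge0); rewrite /XL /ZR /L; dsolve i.
have t2 : H (jn ZR L) + H C <= H (jn ZR C) + H L.
  by apply: (ent_submod bsrc_ge0); rewrite /ZR /L; dsolve i.
have t3 : H (masked (mask_const (true, true, true))) + H (jn ZR C) <=
    H (jn (jn XL ZR) C) + H (masked (fun j => (~~ m j, true, true))).
  by apply: (ent_submod bsrc_ge0); rewrite /XL /ZR /m /mask_const; dsolve i.
have t4 : H (jn XL C) + H (masked (fun j => (false, false, m j))) <= H (masked (fun j => (m j, false, m j))) + H C.
  by apply: (ent_submod bsrc_ge0); rewrite /XL /m; dsolve i.
by have := prefix_markov m; lra.
Qed.

End Enc.
End Step.
End Block.
End Source.

(** * The region in terms of homogeneous functionals of the conditional laws of U *)

Section Functionals.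
Variables (R : realType) (X Y Z Xh : finType).
Variables (pZY : Z * Y -> R) (W : Z -> X -> R) (d : X -> Xh -> R).
Local Notation p := (pXYZ pZY W).
Local Notation Vt := {ffun Z -> Xh}.

Definition phi (t : R) := t * - ln t.

Lemma phi0 : phi 0 = 0. Proof. by rewrite /phi mul0r. Qed.

Lemma phiM c t : 0 <= c -> 0 <= t -> phi (c * t) = c * phi t + t * phi c.
Proof.
rewrite le_eqVlt => /predU1P[<- _|c0]; first by rewrite mul0r phi0; ring.
rewrite le_eqVlt => /predU1P[<-|t0]; first by rewrite mulr0 phi0; ring.
by rewrite /phi lnM ?posrE//; ring.
Qed.

Definition joint_xz (q : Y -> R) x z := \sum_y p x y z * q y.
Definition joint_xzv (q : Y -> R) (r : X -> Vt -> R) x z v := joint_xz q x z * r x v.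

(* Contributions of a single value [u] of [U], with [q y = p(u|y)] and
   [r x v = p(v|x,u)], to [I(U;Y|X) - H(Y|X)], [I(X;V|U,Z)] and the distortion.  As
   [q] is not normalised, they are homogeneous of degree one in [q].  The values of
   [V] are the functions [Z -> Xh] themselves, which bounds the alphabet of [V]. *)
Definition F1 (q : Y -> R) :=
  \sum_x phi (\sum_y (\sum_z p x y z) * q y) - \sum_x \sum_y phi ((\sum_z p x y z) * q y).
Definition F2 (q : Y -> R) (r : X -> Vt -> R) :=
  \sum_x \sum_z phi (\sum_v joint_xzv q r x z v) + \sum_v \sum_z phi (\sum_x joint_xzv q r x z v)
  - \sum_x \sum_v \sum_z phi (joint_xzv q r x z v) - \sum_z phi (\sum_x \sum_v joint_xzv q r x z v).
Definition F3 (q : Y -> R) (r : X -> Vt -> R) :=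
  \sum_x \sum_z \sum_v joint_xzv q r x z v * d x (v z).
Definition cond_ent_YX :=
  \sum_x \sum_y phi (\sum_z p x y z) - \sum_x phi (\sum_y \sum_z p x y z).

Hypothesis p_ge0 : forall x y z, 0 <= p x y z.

Lemma joint_xz_ge0 q x z : (forall y, 0 <= q y) -> 0 <= joint_xz q x z.
Proof. by move=> q0; apply: sumr_ge0 => y _; rewrite mulr_ge0. Qed.

Lemma joint_xzv_ge0 q r x z v : (forall y, 0 <= q y) -> (forall x v, 0 <= r x v) -> 0 <= joint_xzv q r x z v.
Proof. by move=> q0 r0; rewrite /joint_xzv mulr_ge0 ?joint_xz_ge0. Qed.

Lemma sum_phiM (I : finType) (F : I -> R) c : 0 <= c -> (forall i, 0 <= F i) ->
  \sum_i phi (c * F i) = c * (\sum_i phi (F i)) + (\sum_i F i) * phi c.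
Proof.
move=> c0 F0; rewrite mulr_sumr mulr_suml -big_split/=; apply: eq_bigr => i _.
by rewrite phiM.
Qed.

Lemma F1_hom c q : 0 <= c -> (forall y, 0 <= q y) -> F1 (fun y => c * q y) = c * F1 q.
Proof.
move=> c0 q0; rewrite /F1.
have s0 x y : 0 <= (\sum_z p x y z) * q y by rewrite mulr_ge0// sumr_ge0.
have e1 : \sum_x phi (\sum_y (\sum_z p x y z) * (c * q y)) =
   \sum_x phi (c * \sum_y (\sum_z p x y z) * q y).
  by apply: eq_bigr => x _; rewrite mulr_sumr; congr phi; apply: eq_bigr => y _; ring.
have e2 : \sum_x \sum_y phi ((\sum_z p x y z) * (c * q y)) =
   \sum_x (c * (\sum_y phi ((\sum_z p x y z) * q y)) + (\sum_y (\sum_z p x y z) * q y) * phi c).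
  apply: eq_bigr => x _; rewrite -sum_phiM//; apply: eq_bigr => y _; congr phi; ring.
rewrite e1 e2 sum_phiM// => [|x]; last exact: sumr_ge0.
by rewrite big_split/= -mulr_sumr -mulr_suml; ring.
Qed.

Lemma joint_xzvZ c q r x z v : joint_xzv (fun y => c * q y) r x z v = c * joint_xzv q r x z v.
Proof.
rewrite /joint_xzv mulrA; congr (_ * _); rewrite /joint_xz mulr_sumr; apply: eq_bigr => y _; ring.
Qed.

(** Scaling adds to each of the four sums the same total mass [S] times [phi c]; two sums enter with
    a plus and two with a minus sign, so these terms cancel. *)
Lemma F2_hom c q r : 0 <= c -> (forall y, 0 <= q y) -> (forall x v, 0 <= r x v) ->
  F2 (fun y => c * q y) r = c * F2 q r.
Proof.
move=> c0 q0 r0; rewrite /F2.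
have j0 x z v := @joint_xzv_ge0 q r x z v q0 r0.
set S := \sum_x \sum_z \sum_v joint_xzv q r x z v.
have -> : \sum_x \sum_z phi (\sum_v joint_xzv (fun y => c * q y) r x z v) =
   c * (\sum_x \sum_z phi (\sum_v joint_xzv q r x z v)) + S * phi c.
  rewrite mulr_sumr mulr_suml -big_split; apply: eq_bigr => x _ /=.
  rewrite -sum_phiM// => [|z]; last exact: sumr_ge0.
  apply: eq_bigr => z _; congr phi; rewrite mulr_sumr; apply: eq_bigr => v _; exact: joint_xzvZ.
have -> : \sum_v \sum_z phi (\sum_x joint_xzv (fun y => c * q y) r x z v) =
   c * (\sum_v \sum_z phi (\sum_x joint_xzv q r x z v)) + S * phi c.
  have -> : S = \sum_v \sum_z \sum_x joint_xzv q r x z v.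
    rewrite /S [RHS]exchange_big/= exchange_big/=; apply: eq_bigr => z _; exact: exchange_big.
  rewrite mulr_sumr mulr_suml -big_split; apply: eq_bigr => v _ /=.
  rewrite -sum_phiM// => [|z]; last exact: sumr_ge0.
  apply: eq_bigr => z _; congr phi; rewrite mulr_sumr; apply: eq_bigr => x _; exact: joint_xzvZ.
have -> : \sum_x \sum_v \sum_z phi (joint_xzv (fun y => c * q y) r x z v) =
   c * (\sum_x \sum_v \sum_z phi (joint_xzv q r x z v)) + S * phi c.
  rewrite mulr_sumr mulr_suml -big_split; apply: eq_bigr => x _ /=.
  rewrite [X in _ = _ + X * _]exchange_big/= mulr_sumr mulr_suml -big_split.
  apply: eq_bigr => v _ /=; rewrite -sum_phiM//.
  by apply: eq_bigr => z _; congr phi; exact: joint_xzvZ.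
have -> : \sum_z phi (\sum_x \sum_v joint_xzv (fun y => c * q y) r x z v) =
   c * (\sum_z phi (\sum_x \sum_v joint_xzv q r x z v)) + S * phi c.
  rewrite /S [X in _ = _ + X * _]exchange_big/= -sum_phiM// => [|z]; last first.
    by apply: sumr_ge0 => x _; apply: sumr_ge0.
  apply: eq_bigr => z _; congr phi; rewrite mulr_sumr; apply: eq_bigr => x _.
  by rewrite mulr_sumr; apply: eq_bigr => v _; exact: joint_xzvZ.
by ring.
Qed.

Lemma F3_hom c q r : F3 (fun y => c * q y) r = c * F3 q r.
Proof.
rewrite /F3 mulr_sumr; apply: eq_bigr => x _; rewrite mulr_sumr; apply: eq_bigr => z _.
by rewrite mulr_sumr; apply: eq_bigr => v _; rewrite joint_xzvZ mulrA.
Qed.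

Section Ent.
Variables (T : finType) (P : T -> R) (U : finType).
Variables (aU : T -> U) (aX : T -> X) (aY : T -> Y) (aZ : T -> Z) (aV : T -> Vt).

Lemma F1_ent (q : Y -> U -> R) :
  (forall u y x, pr P (jn (jn aU aY) aX) (u, y, x) = (\sum_z p x y z) * q y u) ->
  ent P (jn aU aX) - ent P (jn (jn aU aY) aX) = \sum_u F1 (q^~ u).
Proof.
move=> h; rewrite !entE.
rewrite -(pair_bigA _ (fun u x => pr P (jn aU aX) (u, x) * - ln (pr P (jn aU aX) (u, x))))/=.
rewrite -(pair_bigA _ (fun uy x => pr P (jn (jn aU aY) aX) (uy, x) * - ln (pr P (jn (jn aU aY) aX) (uy, x))))/=.
rewrite -(pair_bigA _ (fun u y => \sum_x pr P (jn (jn aU aY) aX) (u, y, x) * - ln (pr P (jn (jn aU aY) aX) (u, y, x))))/=.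
rewrite -sumrB; apply: eq_bigr => u _; rewrite /F1; congr (_ - _).
  by apply: eq_bigr => x _; rewrite -(pr3_sum2 P aU aY aX); under eq_bigr do rewrite h.
by rewrite exchange_big/=; apply: eq_bigr => x _; apply: eq_bigr => y _; rewrite h.
Qed.

Lemma cond_ent_YX_ent :
  (forall y x, pr P (jn aY aX) (y, x) = \sum_z p x y z) ->
  ent P (jn aY aX) - ent P aX = cond_ent_YX.
Proof.
move=> h; rewrite !entE.
rewrite -(pair_bigA _ (fun y x => pr P (jn aY aX) (y, x) * - ln (pr P (jn aY aX) (y, x))))/=.
rewrite exchange_big/= /cond_ent_YX; congr (_ - _).
  by apply: eq_bigr => x _; apply: eq_bigr => y _; rewrite h.
apply: eq_bigr => x _; rewrite -(pr_jnl P aY aX).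
by under eq_bigr do rewrite h.
Qed.

Lemma F2_ent (q : Y -> U -> R) (r : U -> X -> Vt -> R) : let C := jn aU aZ in
  (forall x v u z, pr P (jn (jn aX aV) C) (x, v, (u, z)) = joint_xzv (q^~ u) (r u) x z v) ->
  ent P (jn aX C) + ent P (jn aV C) - ent P (jn (jn aX aV) C) - ent P C =
  \sum_u F2 (q^~ u) (r u).
Proof.
move=> C h.
have hXC x u z : pr P (jn aX C) (x, (u, z)) = \sum_v joint_xzv (q^~ u) (r u) x z v.
  by rewrite -(pr3_sum2 P aX aV C); apply: eq_bigr => v _; rewrite h.
have hVC v u z : pr P (jn aV C) (v, (u, z)) = \sum_x joint_xzv (q^~ u) (r u) x z v.
  by rewrite -(pr3_sum1 P aX aV C); apply: eq_bigr => x _; rewrite h.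
have hC u z : pr P C (u, z) = \sum_x \sum_v joint_xzv (q^~ u) (r u) x z v.
  by rewrite -(pr_jnl P aX C); apply: eq_bigr => x _; rewrite hXC.
have -> : ent P (jn aX C) = \sum_u \sum_x \sum_z phi (\sum_v joint_xzv (q^~ u) (r u) x z v).
  rewrite entE -(pair_bigA _ (fun x c => pr P (jn aX C) (x, c) * - ln (pr P (jn aX C) (x, c))))/=.
  rewrite [RHS]exchange_big/=; apply: eq_bigr => x _.
  by rewrite pair_bigA/=; apply: eq_bigr => -[u z] _; rewrite hXC.
have -> : ent P (jn aV C) = \sum_u \sum_v \sum_z phi (\sum_x joint_xzv (q^~ u) (r u) x z v).
  rewrite entE -(pair_bigA _ (fun x c => pr P (jn aV C) (x, c) * - ln (pr P (jn aV C) (x, c))))/=.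
  rewrite [RHS]exchange_big/=; apply: eq_bigr => x _.
  by rewrite pair_bigA/=; apply: eq_bigr => -[u z] _; rewrite hVC.
have -> : ent P C = \sum_u \sum_z phi (\sum_x \sum_v joint_xzv (q^~ u) (r u) x z v).
  by rewrite entE pair_bigA/=; apply: eq_bigr => -[u z] _; rewrite hC.
have -> : ent P (jn (jn aX aV) C) = \sum_u \sum_x \sum_v \sum_z phi (joint_xzv (q^~ u) (r u) x z v).
  rewrite entE -(pair_bigA _ (fun x c => pr P (jn (jn aX aV) C) (x, c) * - ln (pr P (jn (jn aX aV) C) (x, c))))/=.
  rewrite [RHS]exchange_big/=; under [RHS]eq_bigr do rewrite exchange_big/=.
  rewrite [RHS]pair_bigA/=; apply: eq_bigr => -[x v] _.
  by rewrite pair_bigA/=; apply: eq_bigr => -[u z] _; rewrite h.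
by rewrite -big_split -!sumrB; apply: eq_bigr => u _.
Qed.

Lemma F3_exp (q : Y -> U -> R) (r : U -> X -> Vt -> R) :
  (forall x v u z, pr P (jn (jn aX aV) (jn aU aZ)) (x, v, (u, z)) = joint_xzv (q^~ u) (r u) x z v) ->
  \sum_t P t * d (aX t) (aV t (aZ t)) = \sum_u F3 (q^~ u) (r u).
Proof.
move=> h; rewrite (sum_pr P (jn (jn aX aV) (jn aU aZ)) (fun w => d w.1.1 (w.1.2 w.2.2))).
rewrite -(pair_bigA _ (fun xv c => pr P (jn (jn aX aV) (jn aU aZ)) (xv, c) * d xv.1 (xv.2 c.2)))/=.
rewrite -(pair_bigA _ (fun x v => \sum_c pr P (jn (jn aX aV) (jn aU aZ)) (x, v, c) * d x (v c.2)))/=.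
rewrite [RHS]exchange_big/=; apply: eq_bigr => x _.
under eq_bigr => v _ do rewrite -(pair_bigA _ (fun u z => pr P (jn (jn aX aV) (jn aU aZ)) (x, v, (u, z)) * d x (v z)))/=.
rewrite exchange_big/=; apply: eq_bigr => u _; rewrite exchange_big/=.
by apply: eq_bigr => z _; apply: eq_bigr => v _; rewrite h.
Qed.

End Ent.

(** The single-letter region in nats, [a1] bounding the helper's rate and [a2] the encoder's. Only
    sums over u occur, so the values of U can be reweighted one by one. *)
Definition sl_functional (D a1 a2 : R) (U : finType) (q : Y -> U -> R) (r : U -> X -> Vt -> R) :=
  [/\ is_channel q, (forall u, is_channel (r u)),
      \sum_u F3 (q^~ u) (r u) <= D, cond_ent_YX + \sum_u F1 (q^~ u) <= a1
    & \sum_u F2 (q^~ u) (r u) <= a2].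

Lemma sl_functional_region (D Rt R1 : R) (U : finType) q r :
  sl_functional D (R1 * ln 2) (Rt * ln 2) (U := U) q r -> sl_region pZY W d D Rt R1.
Proof.
case=> hq hr hD h1 h2.
exists U, Vt, q, (fun xu v => r xu.2 xu.1 v), (fun u (v : Vt) z => v z).
split; [exact: hq|split; first by move=> [x u]; apply: hr].
set P := (fun t : X * Y * Z * U * Vt => _) => /=.
have l2 : 0 < ln 2 :> R by rewrite ln_gt0// ltr1n.
have P0 t : 0 <= P t.
  case: t => -[[[x y] z] u] v; rewrite /P; apply: mulr_ge0; last exact: (hr u x).1.
  by apply: mulr_ge0 => //; exact: (hq y).1.
pose aX (t : X * Y * Z * U * Vt) := t.1.1.1.1; pose aY (t : X * Y * Z * U * Vt) := t.1.1.1.2.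
pose aZ (t : X * Y * Z * U * Vt) := t.1.1.2; pose aU (t : X * Y * Z * U * Vt) := t.1.2.
pose aV (t : X * Y * Z * U * Vt) := t.2.
have e1 u y x : pr P (jn (jn aU aY) aX) (u, y, x) = (\sum_z p x y z) * q y u.
  rewrite (@pr_bij _ _ _ _ _ _ (fun t => (aZ t, aV t)) (fun a b => (a.2, a.1.2, b.1, a.1.1, b.2)))//=;
    try by [move=> [[]]|move=> ? []|move=> [[[[]]]]].
  rewrite -(pair_bigA _ (fun z v => P (x, y, z, u, v)))/= mulr_suml; apply: eq_bigr => z _.
  by rewrite /P -mulr_sumr (hr u x).2 mulr1.
have e2 y x : pr P (jn aY aX) (y, x) = \sum_z p x y z.
  by rewrite -(pr3_sum1 P aU aY aX); under eq_bigr do rewrite e1; rewrite -mulr_sumr (hq y).2 mulr1.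
have e3 x v u z : pr P (jn (jn aX aV) (jn aU aZ)) (x, v, (u, z)) = joint_xzv (q^~ u) (r u) x z v.
  rewrite (@pr_bij _ _ _ _ _ _ aY (fun a y => (a.1.1, y, a.2.2, a.2.1, a.1.2)))//=;
    try by [move=> [[? ?][]]|move=> [[[[]]]]].
  by rewrite /joint_xzv /joint_xz mulr_suml.
split.
  have := F3_exp e3; rewrite -(F3_exp e3) in hD => _; apply: le_trans hD.
  by apply: ler_sum => -[[[[x y] z] u] v] _.
split.
  rewrite -(ler_pM2r l2) cond_mutual_infoE//; apply: le_trans h1.
  by rewrite -(F1_ent e1) -(cond_ent_YX_ent e2) /aX /aY /aU; lra.
rewrite -(ler_pM2r l2) cond_mutual_infoE//; apply: le_trans h2.
by rewrite -(F2_ent e3).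
Qed.

End Functionals.

(** * Converse for a given block code *)

Section Converse.
Variables (R : realType) (X Y Z Xh : finType).
Variables (pZY : Z * Y -> R) (W : Z -> X -> R) (d : X -> Xh -> R).
Hypotheses (HpZY : is_pmf pZY) (HW : is_channel W).
Local Notation p := (pXYZ pZY W).
Local Notation Vt := {ffun Z -> Xh}.
Variables (n M1 M : nat).
Hypothesis n_gt0 : (0 < n)%N.
Variables (f1 : {ffun 'I_n -> Y} -> 'I_M1) (f : {ffun 'I_n -> X} -> 'I_M1 -> 'I_M).
Variable (g : 'I_M -> 'I_M1 -> {ffun 'I_n -> Z} -> {ffun 'I_n -> Xh}).
Local Notation Om := {ffun 'I_n -> X * Y * Z}.
Local Notation P := (@bsrc R X Y Z pZY W n).
Local Notation UT := ('I_M1 * {ffun 'I_n -> option X * option Y * option Z})%type.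
Local Notation t1 := (@helper_msg X Y Z n M1 f1).
Local Notation t2 := (@encoder_msg X Y Z n M1 M f1 f).
Local Notation ui := (@auxU X Y Z n M1 f1).

Let P_ge0 := @bsrc_ge0 R X Y Z pZY W HpZY HW n.
Let P_sum1 := @bsrc_sum1 R X Y Z pZY W HpZY HW n.
Let p_ge0 x y z : 0 <= p x y z.
Proof. exact: (src_ge0 HpZY HW (x, y, z)). Qed.

Lemma code_distortionE : code_distortion pZY W d f1 f g =
  n%:R^-1 * \sum_i \sum_w P w * d (Xc i w) (g (t2 w) (t1 w) [ffun j => Zc j w] i).
Proof.
rewrite /code_distortion.
under eq_bigr => xs _ do rewrite (sum_ffun_pair (fun ys zs => (\prod_(i < n) p (xs i) (ys i) (zs i)) *
    ((n%:R)^-1 * \sum_(i < n) d (xs i) (g (f xs (f1 ys)) (f1 ys) zs i)))).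
rewrite (sum_ffun_pair (fun xs (w : {ffun 'I_n -> Y * Z}) => (\prod_(i < n) p (xs i) ([ffun i => (w i).1] i) ([ffun i => (w i).2] i)) *
    ((n%:R)^-1 * \sum_(i < n) d (xs i) (g (f xs (f1 [ffun i => (w i).1])) (f1 [ffun i => (w i).1]) [ffun i => (w i).2] i)))).
rewrite exchange_big/= mulr_sumr.
rewrite (reindex (fun w : Om => [ffun i => ((w i).1.1, ((w i).1.2, (w i).2))]))/=; last first.
  exists (fun w : {ffun 'I_n -> X * (Y * Z)} => [ffun i => ((w i).1, (w i).2.1, (w i).2.2)]) => w _;
    by apply/ffunP => i; rewrite !ffunE/= -!surjective_pairing.
apply: eq_bigr => w _.
rewrite mulrCA; congr (_ * _); rewrite -[X in _ = X]mulr_sumr.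
have -> : [ffun i => ([ffun i0 => ([ffun i1 => ((w i1).1.1, ((w i1).1.2, (w i1).2))] i0).2] i).1] = [ffun i => Yc i w].
  by apply/ffunP => i; rewrite !ffunE.
have -> : [ffun i => ([ffun i0 => ([ffun i1 => ((w i1).1.1, ((w i1).1.2, (w i1).2))] i0).2] i).2] = [ffun i => Zc i w].
  by apply/ffunP => i; rewrite !ffunE.
have -> : [ffun i => ([ffun i1 => ((w i1).1.1, ((w i1).1.2, (w i1).2))] i).1] = [ffun i => Xc i w].
  by apply/ffunP => i; rewrite !ffunE.
congr (_ * _); first by rewrite /bsrc /prodp; apply: eq_bigr => i _; rewrite !ffunE.
by apply: eq_bigr => i _; rewrite !ffunE.
Qed.

Section Letter.
Variable i : 'I_n.

Lemma exists_strategy : exists V : Om -> Vt, determined V (jn t2 (ui i)) /\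
  \sum_w P w * d (Xc i w) (V w (Zc i w)) <=
  \sum_w P w * d (Xc i w) (g (t2 w) (t1 w) [ffun j => Zc j w] i).
Proof.
have [w0 _|W0] := pickP Om; last first.
  exists (fun w => False_rect _ (notF (etrans (esym (W0 w)) isT))).
  by split=> [w|]; [exfalso; have := W0 w | rewrite !big_pred0].
pose s0 : Xh := g (t2 w0) (t1 w0) [ffun j => Zc j w0] i.
pose ZR := masked (X := X) (Y := Y) (Z := Z) (fun j : 'I_n => (false, false, (i < j)%N)).
(* Rebuilds Z^n from Z_i, the past letters kept in U_i and a value [b] of the future letters; the
   defaults of [odflt] are never reached at values that come from a block. *)
pose zrec (b : {ffun 'I_n -> option X * option Y * option Z}) (c : UT * 'I_M * Z) : {ffun 'I_n -> Z} :=
  [ffun j => if j == i then c.2 else if (j < i)%N then odflt c.2 (c.1.1.2 j).2 else odflt c.2 (b j).2].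
pose g' b (c : UT * 'I_M * Z) := g c.1.2 c.1.1.1 (zrec b c) i.
have ci := ent_condindep P_ge0 (condindep_X_Zfuture HpZY HW f1 f i).
have [h hh] := condindep_best_estimate d P_ge0 s0 g' ci.
exists (fun w => [ffun z => h (ui i w, t2 w, z)]); split.
  by move=> w w' [h1 h2 h3]; rewrite /auxU h1 h2 h3.
under eq_bigr do rewrite ffunE.
apply: le_trans hh _; apply: ler_sum => w _; rewrite /g'/=.
suff -> : zrec (ZR w) (ui i w, t2 w, Zc i w) = [ffun j => Zc j w] by [].
apply/ffunP => j; rewrite !ffunE/= ?ffunE /mask_aux /msk/=.
case: eqP => [->//|/eqP ji]; case: ltnP => //= ij.
by rewrite ltn_neqAle ij andbT eq_sym (negbTE ji : (j == i :> nat) = false).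
Qed.

Variable V : Om -> Vt.
Hypothesis V_det : determined V (jn t2 (ui i)).

Let pY y := pr P (Yc i) y.

(* Conditioning on a null event returns an unconditional law, so that [letter_q] and
   [letter_r] are channels everywhere. *)
Definition letter_q (y : Y) (u : UT) : R :=
  if pY y == 0 then pr P (ui i) u else pr P (jn (ui i) (Yc i)) (u, y) / pY y.
Definition letter_r (u : UT) (x : X) (v : Vt) : R :=
  if pr P (jn (Xc i) (ui i)) (x, u) == 0 then pr P V v
  else pr P (jn V (jn (Xc i) (ui i))) (v, (x, u)) / pr P (jn (Xc i) (ui i)) (x, u).

Lemma letter_q_channel : is_channel letter_q.
Proof.
move=> y; rewrite /letter_q; case: eqP => [_|/eqP y0]; split.
- by move=> u; apply: pr_ge0.
- by rewrite sum_pr1.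
- by move=> u; rewrite divr_ge0 ?pr_ge0.
- by rewrite -mulr_suml pr_jnl divff.
Qed.

Lemma letter_r_channel u : is_channel (letter_r u).
Proof.
move=> x; rewrite /letter_r; case: eqP => [_|/eqP y0]; split.
- by move=> v; apply: pr_ge0.
- by rewrite sum_pr1.
- by move=> v; rewrite divr_ge0 ?pr_ge0.
- by rewrite -mulr_suml pr_jnl divff.
Qed.

Lemma pr_letter_UXZY u x z y :
  pr P (jn (jn (ui i) (jn (Xc i) (Zc i))) (Yc i)) (u, (x, z), y) = p x y z * letter_q y u.
Proof.
rewrite (ent_condindep P_ge0 (condindep_U_Y_XZ HpZY HW f1 i)).
have -> : pr P (jn (jn (Xc i) (Zc i)) (Yc i)) (x, z, y) = p x y z.
  rewrite (@pr_coord _ _ _ _ _ _ HpZY HW _ _ (fun t : X * Y * Z => (t.1.1, t.2, t.1.2))).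
  rewrite /pr (big_pred1 (x, y, z)) ?/src// => -[[x' y'] z'] /=.
  by rewrite !xpair_eqE/= -!andbA; congr (_ && _); rewrite andbC.
rewrite -/(pY y) /letter_q; case: eqP => [y0|/eqP y0]; last by rewrite mulrC mulrA; ring.
suff -> : p x y z = 0 by rewrite mul0r mulr0 mul0r.
apply: le_anti; rewrite p_ge0 andbT -y0 /pY (@pr_coord _ _ _ _ _ _ HpZY HW _ _ (fun t : X * Y * Z => t.1.2)).
rewrite /pr (bigD1 (x, y, z))//= {1}/src/=; rewrite lerDl; apply: sumr_ge0 => t _.
exact: src_ge0.
Qed.

Lemma pr_letter_UYX u y x :
  pr P (jn (jn (ui i) (Yc i)) (Xc i)) (u, y, x) = (\sum_z p x y z) * letter_q y u.
Proof.
rewrite mulr_suml; under eq_bigr do rewrite -pr_letter_UXZY.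
rewrite /pr (partition_big (Zc i) xpredT)//=; apply: eq_bigr => z _; apply: eq_bigl => w.
rewrite !xpair_eqE/=.
by case: (Zc i w == z); case: (Xc i w == x); rewrite ?andbF ?andbT.
Qed.

Lemma pr_letter_YZXU y z x u :
  pr P (jn (jn (Yc i) (Zc i)) (jn (Xc i) (ui i))) (y, z, (x, u)) = p x y z * letter_q y u.
Proof.
rewrite -pr_letter_UXZY; apply: eq_bigl => w; rewrite !xpair_eqE/=.
by case: (Zc i w == z); case: (Xc i w == x); case: (Yc i w == y); rewrite ?andbF ?andbT.
Qed.

Lemma pr_letter_XVUZ x v u z :
  pr P (jn (jn (Xc i) V) (jn (ui i) (Zc i))) (x, v, (u, z)) = joint_xzv pZY W (letter_q^~ u) (letter_r u) x z v.
Proof.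
rewrite /joint_xzv /joint_xz mulr_suml.
have h y : p x y z * letter_q y u * letter_r u x v =
    pr P (jn (jn V (jn (Yc i) (Zc i))) (jn (Xc i) (ui i))) (v, (y, z), (x, u)).
  rewrite (ent_condindep P_ge0 (condindep_V_XU_YZ HpZY HW V_det)) -pr_letter_YZXU.
  rewrite /letter_r; case: eqP => [x0|/eqP x0]; last by ring.
  suff -> : pr P (jn (jn (Yc i) (Zc i)) (jn (Xc i) (ui i))) (y, z, (x, u)) = 0.
    by rewrite mul0r mulr0 mul0r.
  apply: le_anti; rewrite pr_ge0// andbT -x0; apply: pr_det_le => // w.
  by rewrite /jn; case=> _ _ -> ->.
under [RHS]eq_bigr do rewrite h.
rewrite /pr (partition_big (Yc i) xpredT)//=; apply: eq_bigr => y _; apply: eq_bigl => w.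
rewrite !xpair_eqE/=.
by case: (Zc i w == z); case: (Xc i w == x); case: (Yc i w == y); case: (V w == v); rewrite ?andbF ?andbT.
Qed.

Lemma pr_letter_YX y x : pr P (jn (Yc i) (Xc i)) (y, x) = \sum_z p x y z.
Proof.
by rewrite -(pr3_sum1 P (ui i)); under eq_bigr do rewrite pr_letter_UYX; rewrite -mulr_sumr (letter_q_channel y).2 mulr1.
Qed.

End Letter.

Lemma helper_rate : \sum_(i < n)
  (ent P (jn (ui i) (Xc i)) + ent P (jn (Yc i) (Xc i)) -
   ent P (jn (jn (ui i) (Yc i)) (Xc i)) - ent P (Xc i)) <= ln M1%:R.
Proof.
(* [G k] is -H(T_1|X^n,Y^k,Z^k). It vanishes for k = n, as T_1 is a function of Y^n; so the sum
   telescopes to H(T_1|X^n), at most the entropy of T_1. *)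
pose G k := ent P (masked (mask_past k)) - ent P (jn t1 (masked (mask_past k))).
apply: (@le_trans _ _ (\sum_(i < n) (G i.+1 - G i))).
  by apply: ler_sum => i _; have := helper_step HpZY HW f1 i; rewrite /G; lra.
rewrite -(big_mkord xpredT (fun i => G i.+1 - G i)) telescope_sumr// /G.
have a : ent P (jn t1 (masked (mask_past n))) = ent P (masked (mask_past n)).
  apply: ent_eq => //; last by move=> w w' [].
  move=> w w' h; congr (_, _) => //; apply: helper_msg_det => j; move/maskedP: h => /(_ j)[_ + _]; apply.
  exact: ltn_ord.
have b := ent_subadd P_ge0 P_sum1 t1 (masked (mask_past 0)).
by have := ent_le_card P_ge0 P_sum1 t1; rewrite card_ord a; lra.
Qed.

Lemma encoder_rate (V : 'I_n -> Om -> Vt) : (forall i, determined (V i) (jn t2 (ui i))) ->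
  \sum_(i < n) (let C := jn (ui i) (Zc i) in
    ent P (jn (Xc i) C) + ent P (jn (V i) C) - ent P (jn (jn (Xc i) (V i)) C) - ent P C) <= ln M%:R.
Proof.
(* [G k] is the entropy of T given T_1, Z^n and the letters of X from k on; it vanishes for k = 0,
   where X^n and T_1 determine T. *)
move=> V_det; pose G k := ent P (jn t2 (jn t1 (masked (mask_future k)))) - ent P (jn t1 (masked (mask_future k))).
apply: (@le_trans _ _ (\sum_(i < n) (G i.+1 - G i))).
  by apply: ler_sum => i _; have := encoder_step HpZY HW (V_det i); rewrite /G/=; lra.
rewrite -(big_mkord xpredT (fun i => G i.+1 - G i)) telescope_sumr// /G.
have a : ent P (jn t2 (jn t1 (masked (mask_future 0)))) = ent P (jn t1 (masked (mask_future 0))).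
  apply: ent_eq => //; last by move=> w w' [_ h1 h2]; rewrite /jn h1 h2.
  move=> w w' [h1 /maskedP h2]; rewrite /jn h1; congr (_, (_, _)); last by apply/maskedP.
  by apply: encoder_msg_det => // j; have [+ _ _] := h2 j; apply.
have b := ent_subadd P_ge0 P_sum1 t2 (jn t1 (masked (mask_future n))).
by have := ent_le_card P_ge0 P_sum1 t2; rewrite card_ord a; lra.
Qed.

Lemma converse : exists (U : finType) (q : Y -> U -> R) (r : U -> X -> Vt -> R),
  sl_functional pZY W d (code_distortion pZY W d f1 f g) (n%:R^-1 * ln M1%:R) (n%:R^-1 * ln M%:R) q r.
Proof.
have n0 : 0 < n%:R :> R by rewrite ltr0n.
have n1 : 0 <= n%:R^-1 :> R by rewrite invr_ge0 ltW.
have [V hV] : exists V : 'I_n -> Om -> Vt, forall i, determined (V i) (jn t2 (ui i)) /\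
  \sum_w P w * d (Xc i w) (V i w (Zc i w)) <=
  \sum_w P w * d (Xc i w) (g (t2 w) (t1 w) [ffun j => Zc j w] i).
  have [s hs] := fin_all_exists exists_strategy.
  by exists s.
have Vd i := (hV i).1.
(* Time sharing: a uniform position i becomes a component of U. By homogeneity the factor 1/n comes
   out of the three functionals. *)
exists ('I_n * UT)%type, (fun y iu => n%:R^-1 * letter_q iu.1 y iu.2), (fun iu => letter_r iu.1 (V iu.1) iu.2).
have q0 i u y : 0 <= letter_q i y u by exact: (letter_q_channel i y).1.
have r0 i u x v : 0 <= letter_r i (V i) u x v by exact: (letter_r_channel i (V i) u x).1.
split.
- move=> y; split=> [iu|]; first by rewrite mulr_ge0.
  rewrite -(pair_bigA _ (fun i u => n%:R^-1 * letter_q i y u))/=.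
  under eq_bigr => i _ do rewrite -mulr_sumr (letter_q_channel i y).2 mulr1.
  by rewrite sumr_const card_ord -[_ *+ n]mulr_natr mulVf// gt_eqF.
- by move=> iu; apply: letter_r_channel.
- rewrite code_distortionE -(pair_bigA _ (fun i u => F3 pZY W d (fun y => n%:R^-1 * letter_q i y u) (letter_r i (V i) u)))/=.
  rewrite mulr_sumr; apply: ler_sum => i _.
  under eq_bigr do rewrite F3_hom.
  rewrite -mulr_sumr ler_wpM2l// -(F3_exp _ (pr_letter_XVUZ (Vd i))).
  exact: (hV i).2.
- rewrite -(pair_bigA _ (fun i u => F1 pZY W (fun y => n%:R^-1 * letter_q i y u)))/=.
  have -> : \sum_i \sum_u F1 pZY W (fun y => n%:R^-1 * letter_q i y u) =
     n%:R^-1 * \sum_i (ent P (jn (ui i) (Xc i)) - ent P (jn (jn (ui i) (Yc i)) (Xc i))).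
    rewrite mulr_sumr; apply: eq_bigr => i _; rewrite (F1_ent (@pr_letter_UYX i)) mulr_sumr.
    by apply: eq_bigr => u _; rewrite F1_hom.
  have -> : cond_ent_YX pZY W = n%:R^-1 * \sum_(i < n) (ent P (jn (Yc i) (Xc i)) - ent P (Xc i)).
    under eq_bigr => i _ do rewrite (cond_ent_YX_ent (@pr_letter_YX i)).
    by rewrite sumr_const card_ord -[cond_ent_YX _ _ *+ n]mulr_natl mulKf// gt_eqF.
  rewrite -mulrDr ler_wpM2l// -big_split/=; apply: le_trans helper_rate.
  by apply: ler_sum => i _; lra.
- rewrite -(pair_bigA _ (fun i u => F2 pZY W (fun y => n%:R^-1 * letter_q i y u) (letter_r i (V i) u)))/=.
  have -> : \sum_i \sum_u F2 pZY W (fun y => n%:R^-1 * letter_q i y u) (letter_r i (V i) u) =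
     n%:R^-1 * \sum_i \sum_u F2 pZY W (letter_q i ^~ u) (letter_r i (V i) u).
    rewrite mulr_sumr; apply: eq_bigr => i _; rewrite mulr_sumr.
    by apply: eq_bigr => u _; rewrite F2_hom.
  rewrite ler_wpM2l//; apply: le_trans (encoder_rate Vd).
  by apply: ler_sum => i _; rewrite -(F2_ent (pr_letter_XVUZ (Vd i))).
Qed.

End Converse.

(** * The single-letter region is closed *)

Section Caratheodory.
Variable R : realType.

Lemma kernel_vector (U : finType) (m : nat) (c : U -> 'I_m -> R) (S : {set U}) :
  (m < #|S|)%N -> exists mu : U -> R,
    [/\ forall u, u \notin S -> mu u = 0, exists u, mu u != 0
      & forall j, \sum_u mu u * c u j = 0].
Proof.
move=> hS; pose A : 'M[R]_(#|S|, m) := \matrix_(k, j) c (enum_val k) j.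
have : kermx A != 0.
  rewrite kermx_eq0 /row_free; apply/eqP => e.
  by have := rank_leq_col A; rewrite e leqNgt hS.
move=> /rowV0Pn[v vK v0].
have vA : v *m A = 0 by apply/sub_kermxP.
have [s0 Ss0] : exists s0, s0 \in S by apply/set0Pn; rewrite -card_gt0; apply: leq_trans hS.
pose mu u := if u \in S then v 0 (enum_rank_in Ss0 u) else 0.
exists mu; split.
- by move=> u /negbTE uS; rewrite /mu uS.
- move/eqP/rowP: v0 => v0; apply/existsP; apply: contra_notT v0.
  rewrite negb_exists => /forallP h k; rewrite mxE.
  have := h (enum_val k); rewrite negbK /mu enum_valP => /eqP.
  by rewrite enum_valK_in.
- move=> j; move/rowP: vA => /(_ j); rewrite !mxE => e.
  transitivity (\sum_(u in S) v 0 (enum_rank_in Ss0 u) * c u j).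
    by rewrite [RHS]big_mkcond; apply: eq_bigr => u _; rewrite /mu; case: ifP; rewrite ?mul0r.
  rewrite big_enum_val -[RHS]e; apply: eq_bigr => k _.
  by rewrite enum_valK_in mxE.
Qed.

(** Conic form of Caratheodory's theorem: while more than m weights are nonzero, the vectors in the
    support are linearly dependent, and moving along a dependency cancels a weight without changing
    the m sums. *)
Lemma caratheodory (U : finType) (m : nat) (c : U -> 'I_m -> R) (l : U -> R) :
  (forall u, 0 <= l u) -> exists l' : U -> R,
    [/\ forall u, 0 <= l' u, forall j, \sum_u l' u * c u j = \sum_u l u * c u j
      & (#|[set u | l' u != 0%R]| <= m)%N].
Proof.
have [N leN] := ubnP #|[set u | l u != 0%R]|; elim: N => // N IH in l leN *.
move=> l0; have [|hm] := leqP #|[set u | l u != 0%R]| m; first by exists l.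
have [mu0 [muS [u0 mu0n] muc]] := kernel_vector c hm.
(* Up to sign the dependency has a positive entry, so that some weight decreases. *)
have [mu [{}muS [u1 u1p] {}muc]] : exists mu : U -> R,
    [/\ forall u, u \notin [set u | l u != 0] -> mu u = 0, exists u, 0 < mu u
      & forall j, \sum_u mu u * c u j = 0].
  have [h|h|h] := ltgtP 0 (mu0 u0).
  - by exists mu0; split=> //; exists u0.
  - exists (fun u => - mu0 u); split=> [u /muS ->||j]; first by rewrite oppr0.
      by exists u0; rewrite oppr_gt0.
    by under eq_bigr do rewrite mulNr; rewrite sumrN muc oppr0.
  - by rewrite -h eqxx in mu0n.
(* The least ratio is the largest step that keeps all weights nonnegative, and the weight of [a]
   drops to 0. *)
pose a := [arg min_(u < u1 | 0 < mu u) (l u / mu u)]%O.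
have [ap amin] : 0 < mu a /\ forall u, 0 < mu u -> l a / mu a <= l u / mu u.
  by rewrite /a; case: arg_minP => // i ip h; split.
pose t := l a / mu a; have t0 : 0 <= t by rewrite divr_ge0// ltW.
pose l1 u := l u - t * mu u.
have l1_ge0 u : 0 <= l1 u.
  rewrite /l1 subr_ge0; have [up|up] := ltP 0 (mu u); first by rewrite -ler_pdivlMr// amin.
  by apply: le_trans (l0 u); rewrite mulr_ge0_le0.
have l1c j : \sum_u l1 u * c u j = \sum_u l u * c u j.
  rewrite /l1; under eq_bigr do rewrite mulrBl -mulrA.
  by rewrite sumrB -mulr_sumr muc mulr0 subr0.
have la : l a != 0 by apply: contraTneq ap => la; rewrite muS ?ltxx// inE la eqxx.
have l1a : l1 a = 0 by rewrite /l1 /t divfK ?subrr// gt_eqF.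
have lt : [set u | l1 u != 0] \proper [set u | l u != 0].
  apply/properP; split; last by exists a; rewrite inE ?la// l1a eqxx.
  apply/fintype.subsetP => u; rewrite !inE; apply: contra => /eqP lu.
  by rewrite /l1 muS ?inE ?lu ?eqxx// mulr0 subr0.
have [|l' [? h ?]] := IH l1 _ l1_ge0; first by apply: leq_trans (proper_card lt) _.
by exists l'; split=> // j; rewrite h.
Qed.

Lemma sum_nth_widen (U : eqType) (u0 : U) (s : seq U) (m : nat) (G : U -> R) : (size s <= m)%N ->
  \sum_(k < m) (if (k < size s)%N then G (nth u0 s k) else 0) = \sum_(u <- s) G u.
Proof.
move=> hm; rewrite (big_nth u0) big_mkord (big_ord_widen _ (fun k => G (nth u0 s k)) hm).
by rewrite [RHS]big_mkcond.
Qed.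

End Caratheodory.

Section Reduction.
Variables (R : realType) (X Y Z Xh : finType).
Variables (pZY : Z * Y -> R) (W : Z -> X -> R) (d : X -> Xh -> R).
Hypothesis p_ge0 : forall x y z, 0 <= pXYZ pZY W x y z.
Local Notation Vt := {ffun Z -> Xh}.

(* One linear constraint for each [y] (the rows of [q] sum to one) and one for each
   of [F1], [F2], [F3]. *)
Lemma sl_functional_card (D a1 a2 : R) (U : finType) (q : Y -> U -> R) (r : U -> X -> Vt -> R) (y0 : Y) :
  sl_functional pZY W d D a1 a2 q r ->
  exists (q' : Y -> 'I_(#|Y| + 3) -> R) r', sl_functional pZY W d D a1 a2 q' r'.
Proof.
case=> hq hr h3 h1 h2.
have [u0 _|U0] := pickP U; last first.
  by exfalso; have := (hq y0).2; rewrite big_pred0// => /eqP; rewrite eq_sym oner_eq0.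
pose c u (j : 'I_(#|Y| + 3)) : R := match split j with
  | inl k => q (enum_val k) u
  | inr k => [:: F1 pZY W (q^~ u); F2 pZY W (q^~ u) (r u); F3 pZY W d (q^~ u) (r u)]`_k end.
(* Reweighting starts from the weights 1. It scales p(u|y) for each u and leaves the channels [r u]
   as they are. *)
have [l [l0 lc lm]] := caratheodory c (l := fun=> 1) (fun=> ler01).
(* The surviving values of U are listed and padded by letters of weight 0, so that the new alphabet
   is the same for all codes. *)
pose s := enum [set u | l u != 0].
have ss : (size s <= #|Y| + 3)%N by rewrite -cardE.
pose b (k : 'I_(#|Y| + 3)) : R := if (k < size s)%N then l (nth u0 s k) else 0.
have b0 k : 0 <= b k by rewrite /b; case: ifP.
have key (G : U -> R) : \sum_k b k * G (nth u0 s k) = \sum_u l u * G u.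
  transitivity (\sum_(u <- s) l u * G u).
    rewrite -(sum_nth_widen u0 (fun u => l u * G u) ss); apply: eq_bigr => k _.
    by rewrite /b; case: ifP; rewrite ?mul0r.
  rewrite /s big_enum/= big_mkcond/=; apply: eq_bigr => u _.
  by rewrite inE; case: eqP => //= ->; rewrite mul0r.
have q0 u y : 0 <= q y u by exact: (hq y).1.
have r0 u x v : 0 <= r u x v by exact: (hr u x).1.
have lcl (k : 'I_#|Y|) : \sum_u l u * q (enum_val k) u = \sum_u q (enum_val k) u.
  have := lc (lshift 3 k); rewrite /c.
  by rewrite (unsplitK (inl k)) => ->; apply: eq_bigr => u _; rewrite mul1r.
have lcr (k : 'I_3) (G : U -> R) : (forall u, G u = [:: F1 pZY W (q^~ u); F2 pZY W (q^~ u) (r u); F3 pZY W d (q^~ u) (r u)]`_k) ->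
    \sum_u l u * G u = \sum_u G u.
  move=> hG; have := lc (rshift #|Y| k); rewrite /c (unsplitK (inr k)).
  by under eq_bigr do rewrite -hG; move=> ->; apply: eq_bigr => u _; rewrite mul1r -hG.
exists (fun y (k : 'I_(#|Y| + 3)) => b k * q y (nth u0 s k)), (fun k : 'I_(#|Y| + 3) => r (nth u0 s k)); split.
- move=> y; split=> [k|]; first by rewrite mulr_ge0.
  by rewrite (key (fun u => q y u)) -(enum_rankK y) lcl (hq _).2.
- by move=> k; apply: hr.
- under eq_bigr do rewrite F3_hom.
  by rewrite (key (fun u => F3 pZY W d (q^~ u) (r u))) (lcr (@Ordinal 3 2 isT)).
- under eq_bigr do rewrite F1_hom//.
  by rewrite (key (fun u => F1 pZY W (q^~ u))) (lcr (@Ordinal 3 0 isT)).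
- under eq_bigr do rewrite F2_hom//.
  by rewrite (key (fun u => F2 pZY W (q^~ u) (r u))) (lcr (@Ordinal 3 1 isT)).
Qed.

End Reduction.

(** * Limits of channels and continuity of the functionals *)

Section Limit.
Variable R : realType.
Local Open Scope classical_set_scope.

(* Limits along a nonprincipal ultrafilter replace the extraction of convergent
   subsequences of channels. *)
Lemma ultra_cvg_bounded (G : set_system nat) (f : nat -> R) : UltraFilter G ->
  (forall k, 0 <= f k <= 1) -> exists l : R, f @ G --> l.
Proof.
move=> UG f01; have FG : ProperFilter G by exact: ultra_proper.
have [l [_ hl]] : `[(0:R), 1] `&` cluster (f @ G) !=set0.
  apply: (@segment_compact R 0 1).
  suff : G (f @^-1` `[0, 1]) by [].
  by apply: filterE => k; rewrite /= in_itv; exact: f01.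
exists l => B /= Bl; have [//|h] := in_ultra_setVsetC (f @^-1` B) UG.
have : (~` B `&` B) !=set0 by apply: hl => //.
by rewrite setICl => -[].
Qed.

(** With s the square root of t, phi t = 2 s (s (- ln s)), and s (- ln s) <= 1 - s by ln x <= x - 1
    at x = 1/s. This gives continuity at 0, where the logarithm is unbounded. *)
Lemma phi_le_sqrt (t : R) : 0 <= t <= 1 -> 0 <= phi t <= 2 * Num.sqrt t.
Proof.
move=> /andP[]; rewrite le_eqVlt => /predU1P[<- _|t0 t1]; first by rewrite phi0 sqrtr0 mulr0 lexx.
rewrite /phi; have l0 := ln_le0 t1; apply/andP; split; first by rewrite mulr_ge0 ?oppr_ge0// ltW.
have s0 : 0 < Num.sqrt t by rewrite sqrtr_gt0.
have e : t = Num.sqrt t * Num.sqrt t by rewrite -expr2 sqr_sqrtr// ltW.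
have si : 0 < (Num.sqrt t)^-1 by rewrite invr_gt0.
move: s0 e si; set s := Num.sqrt t => s0 e si.
have := ln_lexp si; rewrite lnV ?posrE// => h.
rewrite e lnM ?posrE//.
have h' : s * - ln s <= 1 - s.
  by have := ler_wpM2l (ltW s0) h; rewrite [s * (_ - 1)]mulrBr divff ?gt_eqF// mulr1.
by have := ler_wpM2l (ltW s0) h'; nra.
Qed.

Lemma phi_continuous (x : R) : 0 <= x -> {for x, continuous (@phi R)}.
Proof.
rewrite le_eqVlt => /predU1P[<-|x0]; last first.
  apply: (@continuousM _ _ id (fun t => - ln t)); first exact: cvg_id.
  by apply: cvgN; apply: continuous_ln.
suff : @phi R t @[t --> (0 : R)] --> (0 : R) by rewrite -[X in _ --> X]phi0.
apply/cvgr0Pnorm_le => e e0.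
near=> t.
(* For t <= 0 the value of [ln t] is 0 by convention. *)
have [t0|t0] := leP t 0; first by rewrite /phi ln0// oppr0 mulr0 normr0 ltW.
have te : t < (e / 2) ^+ 2.
  near: t; by apply: lt_nbhsl; rewrite exprn_gt0// divr_gt0.
have t1 : t < 1 by near: t; apply: lt_nbhsl.
have /andP[h1 h2] : 0 <= phi t <= 2 * Num.sqrt t by apply: phi_le_sqrt; rewrite !ltW.
rewrite ger0_norm//; apply: (le_trans h2).
have : Num.sqrt t <= e / 2.
  have e2 : 0 <= e / 2 by rewrite divr_ge0// ltW.
  by rewrite -ler_sqr ?nnegrE ?sqrtr_ge0// sqr_sqrtr ltW.
by lra.
Unshelve. all: by end_near. Qed.

Section Filter.
Variables (G : set_system nat).
Hypothesis FG : ProperFilter G.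

Lemma cvg_finsum (I : finType) (f : nat -> I -> R) (l : I -> R) :
  (forall i, f k i @[k --> G] --> l i) -> \sum_i f k i @[k --> G] --> \sum_i l i.
Proof.
move=> h; elim: (index_enum I) => [|i s IH].
  by rewrite big_nil; under eq_fun do rewrite big_nil; apply: cvg_cst.
rewrite big_cons; under eq_fun do rewrite big_cons.
by apply: cvgD => //; apply: h.
Qed.


Lemma cvg_phi (f : nat -> R) (l : R) : 0 <= l -> f k @[k --> G] --> l -> phi (f k) @[k --> G] --> phi l.
Proof. by move=> l0 h; apply: (continuous_cvg _ (phi_continuous l0) h). Qed.

Lemma cvg_ge0 (f : nat -> R) (l : R) : (forall k, 0 <= f k) -> f k @[k --> G] --> l -> 0 <= l.
Proof. by move=> f0 h; apply: (cvgr_to_ge h); apply: nearW. Qed.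

Section Functional.
Variables (X Y Z Xh : finType).
Variables (pZY : Z * Y -> R) (W : Z -> X -> R) (d : X -> Xh -> R).
Hypothesis p_ge0 : forall x y z, 0 <= pXYZ pZY W x y z.
Local Notation Vt := {ffun Z -> Xh}.
Variables (qk : nat -> Y -> R) (rk : nat -> X -> Vt -> R) (q : Y -> R) (r : X -> Vt -> R).
Hypotheses (qk_ge0 : forall k y, 0 <= qk k y) (rk_ge0 : forall k x v, 0 <= rk k x v).
Hypotheses (qk_cvg : forall y, qk k y @[k --> G] --> q y)
  (rk_cvg : forall x v, rk k x v @[k --> G] --> r x v).

Let q_ge0 y : 0 <= q y. Proof. exact: (cvg_ge0 (qk_ge0^~ y) (@qk_cvg y)). Qed.
Let r_ge0 x v : 0 <= r x v. Proof. exact: (cvg_ge0 (fun k => rk_ge0 k x v) (@rk_cvg x v)). Qed.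

Lemma cvg_F1 : F1 pZY W (qk k) @[k --> G] --> F1 pZY W q.
Proof.
have m x y : (\sum_z pXYZ pZY W x y z) * qk k y @[k --> G] --> (\sum_z pXYZ pZY W x y z) * q y.
  by apply: cvgM; [exact: cvg_cst|exact: qk_cvg].
have m0 x y : 0 <= (\sum_z pXYZ pZY W x y z) * q y by rewrite mulr_ge0// sumr_ge0.
apply: cvgB; apply: cvg_finsum => x.
  by apply: cvg_phi; [exact: sumr_ge0|apply: cvg_finsum => y; exact: m].
by apply: cvg_finsum => y; apply: cvg_phi.
Qed.

Let jv_cvg x z v : joint_xzv pZY W (qk k) (rk k) x z v @[k --> G] --> joint_xzv pZY W q r x z v.
Proof.
apply: cvgM; last exact: rk_cvg.
by apply: cvg_finsum => y; apply: cvgM; [exact: cvg_cst|exact: qk_cvg].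
Qed.

Let j0 x z v : 0 <= joint_xzv pZY W q r x z v. Proof. exact: joint_xzv_ge0. Qed.

Lemma cvg_F2 : F2 pZY W (qk k) (rk k) @[k --> G] --> F2 pZY W q r.
Proof.
apply: cvgB; [apply: cvgB; [apply: cvgD|]|].
- apply: cvg_finsum => x; apply: cvg_finsum => z; apply: cvg_phi; first exact: sumr_ge0.
  by apply: cvg_finsum => v; exact: jv_cvg.
- apply: cvg_finsum => v; apply: cvg_finsum => z; apply: cvg_phi; first exact: sumr_ge0.
  by apply: cvg_finsum => x; exact: jv_cvg.
- apply: cvg_finsum => x; apply: cvg_finsum => v; apply: cvg_finsum => z.
  by apply: cvg_phi; [exact: j0|exact: jv_cvg].
- apply: cvg_finsum => z; apply: cvg_phi; first by apply: sumr_ge0 => x _; exact: sumr_ge0.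
  by apply: cvg_finsum => x; apply: cvg_finsum => v; exact: jv_cvg.
Qed.

Lemma cvg_F3 : F3 pZY W d (qk k) (rk k) @[k --> G] --> F3 pZY W d q r.
Proof.
apply: cvg_finsum => x; apply: cvg_finsum => z; apply: cvg_finsum => v.
by apply: cvgM; [exact: jv_cvg|exact: cvg_cst].
Qed.

End Functional.
End Filter.

Lemma channel_le1 (A B : finType) (K : A -> B -> R) a b : is_channel K -> 0 <= K a b <= 1.
Proof.
move=> hK; rewrite (hK a).1 /= -(hK a).2 (bigD1 b)//= lerDl; apply: sumr_ge0 => b' _.
exact: (hK a).1.
Qed.

Lemma channel_cvg (G : set_system nat) (A B : finType) (K : nat -> A -> B -> R) :
  UltraFilter G -> (forall k, is_channel (K k)) ->
  exists2 L : A -> B -> R, is_channel L & forall a b, K k a b @[k --> G] --> L a b.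
Proof.
move=> UG hK; have FG : ProperFilter G by exact: ultra_proper.
have h (ab : A * B) : exists l : R, K k ab.1 ab.2 @[k --> G] --> l.
  by apply: ultra_cvg_bounded => // k; apply: channel_le1.
have [L hL] := choice h; exists (fun a b => L (a, b)) => [a|a b]; last exact: (hL (a, b)).
split=> [b|]; first by apply: (cvg_ge0 FG _ (hL (a, b))) => k; exact: (hK k a).1.
have s : \sum_b K k a b @[k --> G] --> \sum_b L (a, b).
  by apply: (cvg_finsum FG) => b; exact: (hL (a, b)).
have e : (fun k => \sum_b K k a b) = (fun=> 1) by apply/funext => k; exact: (hK k a).2.
rewrite e in s; exact: (cvg_unique (@norm_hausdorff _ _) s (cvg_cst _)).
Qed.

Section Closed.
Variables (X Y Z Xh : finType).
Variables (pZY : Z * Y -> R) (W : Z -> X -> R) (d : X -> Xh -> R).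
Hypothesis p_ge0 : forall x y z, 0 <= pXYZ pZY W x y z.
Local Notation Vt := {ffun Z -> Xh}.

Lemma sl_functional_closed (U : finType) D a1 a2 :
  (forall e, 0 < e -> exists (q : Y -> U -> R) (r : U -> X -> Vt -> R),
     sl_functional pZY W d (D + e) (a1 + e) (a2 + e) q r) ->
  exists (q : Y -> U -> R) (r : U -> X -> Vt -> R), sl_functional pZY W d D a1 a2 q r.
Proof.
move=> h.
have {}h k : exists qr : (Y -> U -> R) * (U -> X -> Vt -> R),
    sl_functional pZY W d (D + k.+1%:R^-1) (a1 + k.+1%:R^-1) (a2 + k.+1%:R^-1) qr.1 qr.2.
  by have [|q [r hqr]] := h k.+1%:R^-1; [rewrite invr_gt0|exists (q, r)].
have {h}[qr hqr] := choice h.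
have [G [UG sG]] := ultraFilterLemma (F := \oo) _.
have FG : ProperFilter G by exact: ultra_proper.
have eG : (k.+1%:R^-1 : R) @[k --> G] --> (0 : R).
  by apply: cvg_trans (@cvg_harmonic R) => A /=; exact: sG.
have lim (f : nat -> R) l c : f k @[k --> G] --> l -> (forall k, f k <= c + k.+1%:R^-1) -> l <= c.
  move=> fl fc; rewrite -[c]addr0; apply: (ler_cvg_to fl (cvgD (cvg_cst c) eG)).
  exact: nearW.
have qc k : is_channel (qr k).1 by have [] := hqr k.
have rc k u : is_channel ((qr k).2 u) by have [] := hqr k.
have [q hq qcvg] := channel_cvg UG qc.
have hr u : exists r : X -> Vt -> R, is_channel r /\ forall x v, (qr k).2 u x v @[k --> G] --> r x v.
  have [r ? ?] := channel_cvg UG (rc^~ u).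
  by exists r.
have {hr}[r hr] := choice hr.
have q0 k y u : 0 <= (qr k).1 y u by have [a _ _ _ _] := hqr k; exact: (a y).1.
have r0 k u x v : 0 <= (qr k).2 u x v by have [_ b _ _ _] := hqr k; exact: (b u x).1.
exists q, r; split=> //.
- by move=> u; exact: (hr u).1.
- apply: (lim (fun k => \sum_u F3 pZY W d ((qr k).1^~ u) ((qr k).2 u))); last by move=> k; have [] := hqr k.
  by apply: (cvg_finsum FG) => u; apply: cvg_F3 => //; exact: (hr u).2.
- apply: (lim (fun k => cond_ent_YX pZY W + \sum_u F1 pZY W ((qr k).1^~ u))); last by move=> k; have [] := hqr k.
  apply: cvgD; first exact: cvg_cst.
  by apply: (cvg_finsum FG) => u; apply: cvg_F1.
- apply: (lim (fun k => \sum_u F2 pZY W ((qr k).1^~ u) ((qr k).2 u))); last by move=> k; have [] := hqr k.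
  by apply: (cvg_finsum FG) => u; apply: cvg_F2 => //; exact: (hr u).2.
Qed.

End Closed.
End Limit.

(** * The operational region is contained in the single-letter region *)

Section Necessity.
Variables (R : realType) (X Y Z Xh : finType).
Variables (pZY : Z * Y -> R) (W : Z -> X -> R) (d : X -> Xh -> R).
Hypotheses (HpZY : is_pmf pZY) (HW : is_channel W).

Lemma ln_le_powR (n M : nat) (a : R) : (0 < n)%N -> (0 < M)%N -> M%:R <= powR 2 (n%:R * a) ->
  n%:R^-1 * ln M%:R <= a * ln 2.
Proof.
move=> n0 M0 h; rewrite mulrC ler_pdivrMr ?ltr0n//.
have : ln M%:R <= ln (powR 2 (n%:R * a)) by rewrite ler_ln// posrE ?powR_gt0// ltr0n.
by rewrite ln_powR => /le_trans; apply; lra.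
Qed.

Lemma op_region_sl_region D Rt R1 : op_region pZY W d D Rt R1 -> sl_region pZY W d D Rt R1.
Proof.
move=> h; have p0 x y z : 0 <= pXYZ pZY W x y z := src_ge0 HpZY HW (x, y, z).
have l2 : 0 < ln 2 :> R by rewrite ln_gt0// ltr1n.
have [[z0 y0] _|zy0] := pickP (fun _ : Z * Y => true); last first.
  by have := HpZY.2; rewrite big_pred0// => /eqP; rewrite eq_sym oner_eq0.
have [x0 _|X0] := pickP (fun _ : X => true); last first.
  by have := (HW z0).2; rewrite big_pred0// => /eqP; rewrite eq_sym oner_eq0.
suff [q [r hqr]] : exists (q : Y -> 'I_(#|Y| + 3) -> R) r, sl_functional pZY W d D (R1 * ln 2) (Rt * ln 2) q r.
  exact: (sl_functional_region p0 hqr).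
apply: sl_functional_closed => // e e0.
(* A deviation of e / ln 2 bits is one of e nats. *)
have [|Rt' [R1' [ach [hRt hR1]]]] := h (e / ln 2); first exact: divr_gt0.
(* N.+1 and not N, as the block length has to be positive. *)
have [N hN] := ach e e0; have [M1 [M [hM1 [hM [f1 [f [g hd]]]]]]] := hN N.+1 (leqnSn N).
have M10 : (0 < M1)%N := leq_ltn_trans (leq0n _) (ltn_ord (f1 [ffun=> y0])).
have M0 : (0 < M)%N := leq_ltn_trans (leq0n _) (ltn_ord (f [ffun=> x0] (f1 [ffun=> y0]))).
have [U [q [r hqr]]] := converse d HpZY HW (ltn0Sn N) f1 f g.
have [q' [r' [c1 c2 c3 c4 c5]]] := sl_functional_card p0 y0 hqr.
exists q', r'; split=> //.
- exact: le_trans c3 hd.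
- apply: (le_trans c4); apply: (le_trans (ln_le_powR (ltn0Sn N) M10 hM1)).
  rewrite -lerBlDl -mulrBl -ler_pdivlMr//; apply/ltW/(le_lt_trans _ hR1).
  by rewrite distrC ler_norm.
- apply: (le_trans c5); apply: (le_trans (ln_le_powR (ltn0Sn N) M0 hM)).
  rewrite -lerBlDl -mulrBl -ler_pdivlMr//; apply/ltW/(le_lt_trans _ hRt).
  by rewrite distrC ler_norm.
Qed.

End Necessity.

(** * One-shot coding *)

Section Average.
Variable R : realType.

Lemma exists_le_average (I : finType) (w F : I -> R) b :
  (forall i, 0 <= w i) -> \sum_i w i = 1 -> \sum_i w i * F i <= b -> exists i, F i <= b.
Proof.
move=> w0 w1 h; apply/existsP; apply: contraLR h; rewrite negb_exists => /forallP h.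
rewrite -ltNge -subr_gt0 -[b]mul1r -w1 mulr_suml -sumrB.
under eq_bigr do rewrite -mulrBr.
have hi i : 0 < F i - b by rewrite subr_gt0 ltNge h.
rewrite lt_neqAle sumr_ge0 ?andbT => [|i _]; last by rewrite mulr_ge0// ltW.
rewrite eq_sym; apply/eqP => /eqP; rewrite psumr_eq0 => [/allP e|i _]; last by rewrite mulr_ge0// ltW.
move: w1; rewrite big1 => [/eqP|i _]; first by rewrite eq_sym oner_eq0.
by have := e i; rewrite mem_index_enum mulf_eq0 (gt_eqF (hi i)) orbF => /(_ isT)/eqP.
Qed.

(** The codewords are pairwise independent and [b] has mean zero, so the cross terms vanish. *)
Lemma indep_sum_square (I V : finType) (p b : V -> R) : \sum_v p v = 1 -> \sum_v p v * b v = 0 ->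
  \sum_(c : {ffun I -> V}) prodp p c * (\sum_i b (c i)) ^+ 2 = #|I|%:R * \sum_v p v * b v ^+ 2.
Proof.
move=> p1 pb.
transitivity (\sum_i \sum_j \sum_(c : {ffun I -> V}) prodp p c * (b (c i) * b (c j))).
  under [RHS]eq_bigr do rewrite exchange_big/=.
  rewrite exchange_big/=; apply: eq_bigr => c _; rewrite expr2 mulr_suml mulr_sumr.
  apply: eq_bigr => i _; rewrite !mulr_sumr; apply: eq_bigr => j _; ring.
rewrite -sumr_const mulr_suml /=; under [RHS]eq_bigr do rewrite mul1r.
apply: eq_bigr => i _; rewrite (bigD1 i)//= [X in _ + X]big1 ?addr0 => [|j ji].
  by rewrite (prodp_marginal (fun v => b v * b v) i p1); apply: eq_bigr => v _; rewrite expr2.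
rewrite (prodp_marginal2 (fun v v' => b v * b v') p1) 1?eq_sym// big1// => v _.
transitivity (p v * b v * \sum_v' p v' * b v'); last by rewrite pb mulr0.
by rewrite mulr_sumr; apply: eq_bigr => v' _; ring.
Qed.

(** Bounds a first moment by a second moment without square roots, at the price of the parameter
    [a], later a multiple of an output probability. *)
Lemma abs_le_square (x a : R) : 0 < a -> `|x| <= a + x ^+ 2 / a.
Proof.
move=> a0; rewrite -(ler_pM2r a0) mulrDl divfK ?gt_eqF//.
by have := real_normK (num_real x); have := normr_ge0 x; nra.
Qed.

End Average.

Section SoftCovering.
Variables (R : realType) (I V S : finType) (PV : V -> R) (A : V -> S -> R).
Hypotheses (PV_ge0 : forall v, 0 <= PV v) (PV_sum : \sum_v PV v = 1).
Hypotheses (A_ge0 : forall v s, 0 <= A v s) (A_sum : forall v, \sum_s A v s <= 1).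
Hypothesis I_gt0 : (0 < #|I|)%N.

Definition outp s := \sum_v PV v * A v s.

Lemma outp_ge0 s : 0 <= outp s.
Proof. by apply: sumr_ge0 => v _; rewrite mulr_ge0. Qed.

Lemma outp_sum : \sum_s outp s <= 1.
Proof.
rewrite exchange_big/= -PV_sum; apply: ler_sum => v _; rewrite -mulr_sumr.
by rewrite -[leRHS]mulr1 ler_wpM2l.
Qed.

(* Truncating [A] at [tau * outp] makes the second moment method applicable; the
   truncated mass is the first term of the bound. *)
Lemma soft_covering (tau eta : R) : 0 <= tau -> 0 < eta ->
  \sum_(c : {ffun I -> V}) prodp PV c *
    \sum_s Num.max 0 (outp s - #|I|%:R^-1 * \sum_i A (c i) s) <=
  \sum_v \sum_(s | tau * outp s < A v s) PV v * A v s + (eta + tau / (#|I|%:R * eta)).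
Proof.
move=> tau0 eta0; set L : R := #|I|%:R.
have L0 : 0 < L by rewrite ltr0n.
have w0 (c : {ffun I -> V}) : 0 <= prodp PV c by apply: prodp_ge0.
have w1 : \sum_(c : {ffun I -> V}) prodp PV c = 1 by rewrite sum_prodp PV_sum expr1n.
have key s : \sum_(c : {ffun I -> V}) prodp PV c * Num.max 0 (outp s - L^-1 * \sum_i A (c i) s) <=
    \sum_(v | tau * outp s < A v s) PV v * A v s + outp s * (eta + tau / (L * eta)).
  have bad0 : 0 <= \sum_(v | tau * outp s < A v s) PV v * A v s.
    by apply: sumr_ge0 => v _; rewrite mulr_ge0.
  have [s0|s0] := eqVneq (outp s) 0.
    apply: (@le_trans _ _ 0); last by rewrite [X in _ + X * _]s0 mul0r addr0.
    rewrite big1// => c _; rewrite s0 sub0r; suff -> : Num.max 0 (- (L^-1 * \sum_i A (c i) s)) = 0 by rewrite mulr0.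
    by apply: max_l; rewrite oppr_le0 mulr_ge0 ?invr_ge0 ?(ltW L0)// sumr_ge0.
  have sp : 0 < outp s by rewrite lt_neqAle eq_sym s0 outp_ge0.
  (* Only the shortfall of the codebook average below [outp s] has to be bounded, and replacing [A]
     by the smaller [a] can only enlarge it. *)
  pose a v := if tau * outp s < A v s then 0 else A v s.
  have a0 v : 0 <= a v by rewrite /a; case: ifP.
  have aA v : a v <= A v s by rewrite /a; case: ifP.
  have at_ v : a v <= tau * outp s.
    by rewrite /a; case: ltP => // _; rewrite mulr_ge0// ltW.
  pose ab := \sum_v PV v * a v.
  have eab : outp s = ab + \sum_(v | tau * outp s < A v s) PV v * A v s.
    rewrite /ab /outp [X in _ = _ + X]big_mkcond/= -big_split/=; apply: eq_bigr => v _.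
    by rewrite /a; case: ifP; rewrite ?mulr0 ?add0r ?addr0.
  pose b v := a v - ab.
  have b0 : \sum_v PV v * b v = 0.
    rewrite /b; under eq_bigr do rewrite mulrBr.
    by rewrite sumrB -mulr_suml PV_sum mul1r subrr.
  (* The variance of [a] is at most its second moment, in which one factor [a] is at most tau * outp
     and the other averages to at most outp. *)
  have bsq : \sum_v PV v * b v ^+ 2 <= tau * outp s ^+ 2.
    have -> : \sum_v PV v * b v ^+ 2 = \sum_v PV v * a v ^+ 2 - ab ^+ 2.
      transitivity (\sum_v (PV v * a v ^+ 2 - 2 * ab * (PV v * a v) + PV v * ab ^+ 2)).
        by apply: eq_bigr => v _; rewrite /b; ring.
      by rewrite big_split/= sumrB -mulr_sumr -mulr_suml PV_sum -/ab; ring.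
    apply: (@le_trans _ _ (\sum_v PV v * a v ^+ 2)).
      by rewrite lerBlDr lerDl sqr_ge0.
    rewrite expr2 mulrA {2}/outp mulr_sumr; apply: ler_sum => v _.
    by rewrite [leRHS]mulrCA ler_wpM2l// expr2 ler_pM.
  pose dv (c : {ffun I -> V}) := L^-1 * \sum_i b (c i).
  have dvE (c : {ffun I -> V}) : L^-1 * (\sum_i a (c i)) = ab + dv c.
    rewrite /dv /b sumrB sumr_const -mulr_natr -/L; field; by rewrite gt_eqF.
  have step (c : {ffun I -> V}) : Num.max 0 (outp s - L^-1 * \sum_i A (c i) s) <=
     \sum_(v | tau * outp s < A v s) PV v * A v s + (eta * outp s + dv c ^+ 2 / (eta * outp s)).
    have e0 : 0 < eta * outp s by rewrite mulr_gt0.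
    have h := abs_le_square (dv c) e0.
    rewrite ge_max; apply/andP; split; first by rewrite addr_ge0// (le_trans _ h).
    have h2 : L^-1 * (\sum_i a (c i)) <= L^-1 * \sum_i A (c i) s.
      by rewrite ler_wpM2l ?invr_ge0 ?(ltW L0)//; apply: ler_sum => i _.
    rewrite dvE in h2; rewrite {1}eab; have := ler_norm (- dv c); rewrite normrN => h3.
    by lra.
  apply: (@le_trans _ _ (\sum_(c : {ffun I -> V}) prodp PV c *
     (\sum_(v | tau * outp s < A v s) PV v * A v s + (eta * outp s + dv c ^+ 2 / (eta * outp s))))).
    by apply: ler_sum => c _; rewrite ler_wpM2l.
  under eq_bigr do rewrite mulrDr.
  rewrite big_split/= -mulr_suml w1 mul1r lerD2l.
  under eq_bigr do rewrite mulrDr.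
  rewrite big_split/= -mulr_suml w1 mul1r.
  have -> : \sum_(c : {ffun I -> V}) prodp PV c * (dv c ^+ 2 / (eta * outp s)) =
     (L^-1 / (eta * outp s)) * \sum_v PV v * b v ^+ 2.
    transitivity (L^-1 ^+ 2 / (eta * outp s) * \sum_(c : {ffun I -> V}) prodp PV c * (\sum_i b (c i)) ^+ 2).
      by rewrite [RHS]mulr_sumr; apply: eq_bigr => c _; rewrite /dv exprMn; ring.
    rewrite indep_sum_square// -/L; set X := \sum_v _; field; by rewrite !gt_eqF.
  have -> : outp s * (eta + tau / (L * eta)) = eta * outp s + L^-1 / (eta * outp s) * (tau * outp s ^+ 2).
    by field; rewrite !gt_eqF.
  by rewrite lerD2l ler_wpM2l// divr_ge0 ?invr_ge0 ?mulr_ge0// ltW.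
under eq_bigr do rewrite mulr_sumr.
rewrite exchange_big/=; apply: (le_trans (ler_sum _ (fun s _ => key s))).
rewrite big_split/= -mulr_suml; apply: lerD.
  under [leRHS]eq_bigr do rewrite big_mkcond/=.
  by rewrite [leRHS]exchange_big/=; apply: ler_sum => s _; rewrite big_mkcond.
rewrite -[leRHS]mul1r ler_wpM2r ?outp_sum//.
by rewrite addr_ge0 ?divr_ge0 ?mulr_ge0// ltW.
Qed.

End SoftCovering.

Section Decoding.
Variables (R : realType) (V O : finType) (M K : nat) (PV : V -> R) (C : V -> O -> R).
Hypotheses (PV_ge0 : forall v, 0 <= PV v) (PV_sum : \sum_v PV v = 1).
Hypotheses (C_ge0 : forall v s, 0 <= C v s) (C_sum : forall v, \sum_s C v s <= 1).
Hypothesis K_gt0 : (0 < K)%N.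

Definition mldec (c : {ffun 'I_M * 'I_K -> V}) (m : 'I_M) (o : O) : 'I_K :=
  [arg max_(k > Ordinal K_gt0) C (c (m, k)) o]%O.

(** In case of an error the decoded word is at least as likely as the sent one, so the likelihood of
    the sent word is at most the sum of those of its K - 1 competitors. A competitor is independent
    of the sent word, so its likelihood averages to [outp], which off the bad event is below
    [C v o / tau]; summing over o gives 1 / tau for each competitor. *)
Lemma mldec_error (tau : R) m k : 0 < tau ->
  \sum_(c : {ffun 'I_M * 'I_K -> V}) prodp PV c *
     (\sum_o C (c (m, k)) o * (mldec c m o != k)%:R) <=
  \sum_v \sum_(o | C v o <= tau * outp PV C o) PV v * C v o + K.-1%:R / tau.
Proof.
move=> tau0.
have w0 (c : {ffun 'I_M * 'I_K -> V}) : 0 <= prodp PV c by apply: prodp_ge0.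
pose bad v o := C v o <= tau * outp PV C o.
have step (c : {ffun 'I_M * 'I_K -> V}) o : C (c (m, k)) o * (mldec c m o != k)%:R <=
    C (c (m, k)) o * (bad (c (m, k)) o)%:R +
    \sum_(k' | k' != k) (~~ bad (c (m, k)) o)%:R * C (c (m, k')) o.
  case: (boolP (bad _ _)) => _ /=.
    rewrite mulr1; case: (_ != _); rewrite ?mulr1 ?mulr0 ?lerDl ?addr_ge0//;
    by apply: sumr_ge0 => k' _; rewrite mul0r.
  rewrite mulr0 add0r; under eq_bigr do rewrite mul1r.
  have s0 : 0 <= \sum_(k' | k' != k) C (c (m, k')) o by apply: sumr_ge0.
  case: eqP => [_|/eqP kk]; rewrite ?mulr0 ?mulr1//=.
  apply: (@le_trans _ _ (C (c (m, mldec c m o)) o)).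
    by rewrite /mldec; case: arg_maxP => // i _ /(_ k isT).
  by rewrite (bigD1 (mldec c m o))//= lerDl sumr_ge0.
apply: (@le_trans _ _ (\sum_(c : {ffun 'I_M * 'I_K -> V}) (prodp PV c *
    (\sum_o C (c (m, k)) o * (bad (c (m, k)) o)%:R) +
    \sum_(k' | k' != k) prodp PV c * \sum_o (~~ bad (c (m, k)) o)%:R * C (c (m, k')) o))).
  apply: ler_sum => c _; rewrite -mulr_sumr -mulrDr ler_wpM2l// exchange_big -big_split/=.
  by apply: ler_sum => o _; exact: step.
rewrite big_split/=; apply: lerD.
  rewrite (prodp_marginal (fun v => \sum_o C v o * (bad v o)%:R) (m, k) PV_sum).
  apply: ler_sum => v _; rewrite mulr_sumr [leRHS]big_mkcond/=; apply: ler_sum => o _.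
  by rewrite /bad; case: ifP => _; rewrite ?mulr1 ?mulr0.
rewrite exchange_big/=.
have one k' : k' != k -> \sum_(c : {ffun 'I_M * 'I_K -> V})
    prodp PV c * (\sum_o (~~ bad (c (m, k)) o)%:R * C (c (m, k')) o) <= tau^-1.
  move=> kk; rewrite (prodp_marginal2 (fun v v' => \sum_o (~~ bad v o)%:R * C v' o) PV_sum); last first.
    by rewrite xpair_eqE eqxx/= eq_sym.
  have -> : \sum_v \sum_v' PV v * PV v' * (\sum_o (~~ bad v o)%:R * C v' o) =
     \sum_v PV v * \sum_o (~~ bad v o)%:R * outp PV C o.
    apply: eq_bigr => v _; rewrite mulr_sumr.
    under eq_bigr do rewrite mulr_sumr.
    rewrite exchange_big/=; apply: eq_bigr => o _; rewrite /outp !mulr_sumr; apply: eq_bigr => v' _; ring.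
  apply: (@le_trans _ _ (\sum_v PV v * \sum_o tau^-1 * C v o)).
    apply: ler_sum => v _; rewrite ler_wpM2l//; apply: ler_sum => o _; rewrite /bad.
    case: (leP (C v o)) => h /=; first by rewrite mul0r mulr_ge0// invr_ge0 ltW.
    by rewrite mul1r mulrC ler_pdivlMr// mulrC ltW.
  under eq_bigr do rewrite -mulr_sumr mulrCA.
  rewrite -mulr_sumr -[leRHS]mulr1 ler_wpM2l ?invr_ge0 ?(ltW tau0)// -PV_sum.
  by apply: ler_sum => v _; rewrite -[leRHS]mulr1 ler_wpM2l.
apply: (le_trans (ler_sum _ one)); rewrite sumr_const -[leLHS]mulr_natl.
suff -> : #|(fun k' : 'I_K => k' != k)| = K.-1 by [].
by have := cardC1 k; rewrite card_ord => <-; apply: eq_card => k'; rewrite !inE.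
Qed.

End Decoding.

Section OneShot.
Variables (R : realType) (S V T O1 O2 : finType) (M K : nat).
Variables (PV : V -> R) (A : V -> S -> R) (B : S -> T -> R) (o1 : T -> O1) (o2 : T -> O2).
Variables (gam : V -> V -> S -> T -> R) (dmax : R).
Hypotheses (PV_ge0 : forall v, 0 <= PV v) (PV_sum : \sum_v PV v = 1).
Hypotheses (A_ge0 : forall v s, 0 <= A v s) (A_sum : forall v, \sum_s A v s <= 1).
Hypotheses (B_ge0 : forall s t, 0 <= B s t) (B_sum : forall s, \sum_t B s t <= 1).
Hypotheses (gam_ge0 : forall v v' s t, 0 <= gam v v' s t) (gam_le : forall v v' s t, gam v v' s t <= dmax).
Hypotheses (M_gt0 : (0 < M)%N) (K_gt0 : (0 < K)%N).

Definition obs (O : finType) (o : T -> O) (v : V) (x : O) : R :=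
  \sum_s \sum_(t | o t == x) A v s * B s t.

Lemma obs_ge0 (O : finType) (o : T -> O) v x : 0 <= obs o v x.
Proof. by apply: sumr_ge0 => s _; apply: sumr_ge0 => t _; rewrite mulr_ge0. Qed.

Lemma sum_obs (O : finType) (o : T -> O) v (F : O -> R) :
  \sum_x obs o v x * F x = \sum_s A v s * \sum_t B s t * F (o t).
Proof.
under eq_bigr do rewrite mulr_suml.
rewrite exchange_big/=; apply: eq_bigr => s _; rewrite mulr_sumr [RHS](partition_big o xpredT)//=.
apply: eq_bigr => x _; rewrite mulr_suml; apply: eq_bigr => t /eqP ->; ring.
Qed.

Lemma obs_sum (O : finType) (o : T -> O) v : \sum_x obs o v x <= 1.
Proof.
have := sum_obs o v (fun=> 1); under eq_bigr do rewrite mulr1.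
move=> ->; apply: le_trans (A_sum v); apply: ler_sum => s _.
by rewrite -[leRHS]mulr1 ler_wpM2l//; under eq_bigr do rewrite mulr1.
Qed.

(** The first line is the covering error with all M K codewords, the others are the errors of the
    two decoders among the K words of a bin. *)
Definition one_shot_error (tau eta tau1 tau2 : R) : R :=
  (\sum_v \sum_(s | tau * outp PV A s < A v s) PV v * A v s + (eta + tau / ((M * K)%:R * eta)))
  + (\sum_v \sum_(o | obs o1 v o <= tau1 * outp PV (obs o1) o) PV v * obs o1 v o + K.-1%:R / tau1)
  + (\sum_v \sum_(o | obs o2 v o <= tau2 * outp PV (obs o2) o) PV v * obs o2 v o + K.-1%:R / tau2).

(* Random codebook [c] with [M] bins of [K] codewords.  The encoder sends the bin of
   least expected cost; this is at most the average cost over the posterior of the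
   codeword index given [s], when [s] is the output of [A] on a uniform codeword,
   and by soft covering that law of [s] is close to [outp PV A]. *)
Lemma one_shot (tau eta tau1 tau2 : R) : 0 <= dmax -> 0 <= tau -> 0 < eta -> 0 < tau1 -> 0 < tau2 ->
  exists (f : S -> 'I_M) (G1 : 'I_M -> O1 -> V) (G2 : 'I_M -> O2 -> V),
  \sum_s outp PV A s * (\sum_t B s t * gam (G1 (f s) (o1 t)) (G2 (f s) (o2 t)) s t) <=
  \sum_v PV v * (\sum_s A v s * \sum_t B s t * gam v v s t) + dmax * one_shot_error tau eta tau1 tau2.
Proof.
move=> dm0 tau0 eta0 tau10 tau20.
pose I := ('I_M * 'I_K)%type; set L : R := (M * K)%:R.
have cI : #|{: I}| = (M * K)%N by rewrite card_prod !card_ord.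
have L0 : 0 < L by rewrite ltr0n muln_gt0 M_gt0.
pose ph1 (c : {ffun I -> V}) := mldec (obs o1) K_gt0 c.
pose ph2 (c : {ffun I -> V}) := mldec (obs o2) K_gt0 c.
pose J (c : {ffun I -> V}) s m := \sum_t B s t * gam (c (m, ph1 c m (o1 t))) (c (m, ph2 c m (o2 t))) s t.
pose f c s := [arg min_(m < Ordinal M_gt0) J c s m]%O.
have fJ c s m : J c s (f c s) <= J c s m.
  by rewrite /f; case: arg_minP => // i _ /(_ m isT).
have J0 c s m : 0 <= J c s m by apply: sumr_ge0 => t _; rewrite mulr_ge0.
have Jd c s m : J c s m <= dmax.
  apply: (@le_trans _ _ (\sum_t B s t * dmax)); first by apply: ler_sum => t _; rewrite ler_wpM2l.
  by rewrite -mulr_suml -[leRHS]mul1r ler_wpM2r.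
pose G v := \sum_s A v s * \sum_t B s t * gam v v s t.
pose er1 (c : {ffun I -> V}) (i : I) := \sum_o obs o1 (c i) o * (ph1 c i.1 o != i.2)%:R.
pose er2 (c : {ffun I -> V}) (i : I) := \sum_o obs o2 (c i) o * (ph2 c i.1 o != i.2)%:R.
(* If both decoders succeed, the cost is that of the codeword itself; otherwise [dmax] pays for
   it. *)
have AJ (c : {ffun I -> V}) (i : I) : \sum_s A (c i) s * J c s i.1 <= G (c i) + dmax * (er1 c i + er2 c i).
  rewrite /er1 /er2 !sum_obs -big_split/= mulr_sumr -big_split/=; apply: ler_sum => s _.
  rewrite -mulrDr -big_split/= mulrCA -mulrDr ler_wpM2l// /J mulr_sumr -big_split/=.
  apply: ler_sum => t _; rewrite -mulrDr mulrCA -mulrDr ler_wpM2l//.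
  have [e1|n1] := eqVneq (ph1 c i.1 (o1 t)) i.2; have [e2|n2] := eqVneq (ph2 c i.1 (o2 t)) i.2 => /=.
  - by rewrite e1 e2 -surjective_pairing !addr0 mulr0 addr0.
  - by rewrite add0r mulr1 (le_trans (gam_le _ _ _ _))// lerDr.
  - by rewrite addr0 mulr1 (le_trans (gam_le _ _ _ _))// lerDr.
  - rewrite (le_trans (gam_le _ _ _ _))//; have := gam_ge0 (c i) (c i) s t; lra.
have percode (c : {ffun I -> V}) : \sum_s outp PV A s * J c s (f c s) <=
    dmax * (\sum_s Num.max 0 (outp PV A s - #|{: I}|%:R^-1 * \sum_i A (c i) s)) +
    L^-1 * \sum_i (G (c i) + dmax * (er1 c i + er2 c i)).
  apply: (@le_trans _ _ (\sum_s (dmax * Num.max 0 (outp PV A s - #|{: I}|%:R^-1 * \sum_i A (c i) s) +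
      L^-1 * \sum_i A (c i) s * J c s i.1))); last first.
    rewrite big_split/= -!mulr_sumr lerD2l ler_wpM2l ?invr_ge0 ?(ltW L0)// exchange_big/=.
    by apply: ler_sum => i _; exact: AJ.
  apply: ler_sum => s _; rewrite cI -/L.
  set Q := L^-1 * \sum_i A (c i) s; set Qm := Num.max _ _.
  have h1 : outp PV A s - Q <= Qm by rewrite /Qm le_max lexx orbT.
  have h0 : 0 <= Qm by rewrite /Qm le_max lexx.
  (* The minimum over the bins is at most the average, with weights [A (c i) s], of the cost of the
     bin of i. *)
  have hQ : Q * J c s (f c s) <= L^-1 * \sum_i A (c i) s * J c s i.1.
    rewrite /Q -mulrA ler_wpM2l ?invr_ge0 ?(ltW L0)// mulr_suml; apply: ler_sum => i _.
    by rewrite ler_wpM2l.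
  have h2 : (outp PV A s - Q) * J c s (f c s) <= Qm * J c s (f c s) by rewrite ler_wpM2r.
  have h3 : Qm * J c s (f c s) <= Qm * dmax by rewrite ler_wpM2l.
  by lra.
have w0 (c : {ffun I -> V}) : 0 <= prodp PV c by apply: prodp_ge0.
have w1 : \sum_(c : {ffun I -> V}) prodp PV c = 1 by rewrite sum_prodp PV_sum expr1n.
have [c hc] : exists c : {ffun I -> V}, \sum_s outp PV A s * J c s (f c s) <=
    \sum_v PV v * G v + dmax * one_shot_error tau eta tau1 tau2.
  apply: (exists_le_average w0 w1).
  apply: (@le_trans _ _ (\sum_(c : {ffun I -> V}) prodp PV c *
     (dmax * (\sum_s Num.max 0 (outp PV A s - #|{: I}|%:R^-1 * \sum_i A (c i) s)) +
    L^-1 * \sum_i (G (c i) + dmax * (er1 c i + er2 c i))))).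
    by apply: ler_sum => c _; rewrite ler_wpM2l.
  under eq_bigr do rewrite mulrDr mulrCA [prodp _ _ * (L^-1 * _)]mulrCA.
  rewrite big_split/= -!mulr_sumr.
  have cI0 : (0 < #|{: I}|)%N by rewrite cI muln_gt0 M_gt0.
  have sc := soft_covering PV_ge0 PV_sum A_ge0 A_sum cI0 tau0 eta0.
  rewrite {2}cI -/L in sc.
  set e1 := \sum_v \sum_(o | obs o1 v o <= tau1 * outp PV (obs o1) o) PV v * obs o1 v o + K.-1%:R / tau1.
  set e2 := \sum_v \sum_(o | obs o2 v o <= tau2 * outp PV (obs o2) o) PV v * obs o2 v o + K.-1%:R / tau2.
  have hi : \sum_(c : {ffun I -> V}) prodp PV c * (\sum_i (G (c i) + dmax * (er1 c i + er2 c i))) <=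
     L * (\sum_v PV v * G v + dmax * (e1 + e2)).
    under eq_bigr do rewrite mulr_sumr.
    rewrite exchange_big/=.
    apply: (@le_trans _ _ (\sum_(i : I) (\sum_v PV v * G v + dmax * (e1 + e2)))); last first.
      by rewrite sumr_const cI -mulr_natl.
    apply: ler_sum => -[m k] _; under eq_bigr do rewrite mulrDr.
    rewrite big_split/= (prodp_marginal G (m, k) PV_sum) lerD2l.
    under eq_bigr do rewrite mulrCA.
    rewrite -mulr_sumr ler_wpM2l//; under eq_bigr do rewrite mulrDr.
    rewrite big_split/=; apply: lerD.
      exact: (mldec_error PV_ge0 PV_sum (@obs_ge0 _ o1) (obs_sum o1) K_gt0 m k tau10).
    exact: (mldec_error PV_ge0 PV_sum (@obs_ge0 _ o2) (obs_sum o2) K_gt0 m k tau20).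
  have hL : L^-1 * (\sum_(c : {ffun I -> V}) prodp PV c * (\sum_i (G (c i) + dmax * (er1 c i + er2 c i)))) <=
     \sum_v PV v * G v + dmax * (e1 + e2).
    by rewrite mulrC ler_pdivrMr// mulrC.
  have := ler_wpM2l dm0 sc; rewrite /one_shot_error -/e1 -/e2 -/L; lra.
by exists (f c), (fun m o => c (m, ph1 c m o)), (fun m o => c (m, ph2 c m o)).
Qed.

End OneShot.

(** * Block coding *)

Section Tail.
Variable R : realType.

Definition vanishing (F : nat -> R) := forall eps, 0 < eps -> exists N, forall n, (N <= n)%N -> F n <= eps.

Lemma vanishing_le (F G : nat -> R) : (forall n, F n <= G n) -> vanishing G -> vanishing F.
Proof. by move=> FG h eps /h[N hN]; exists N => n /hN; apply: le_trans. Qed.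

Lemma vanishingD (F G : nat -> R) : vanishing F -> vanishing G -> vanishing (fun n => F n + G n).
Proof.
move=> hF hG eps e0; have e2 : 0 < eps / 2 by rewrite divr_gt0.
have [N1 h1] := hF _ e2; have [N2 h2] := hG _ e2; exists (maxn N1 N2) => n; rewrite geq_max => /andP[/h1 a /h2 b].
by lra.
Qed.

Lemma vanishing_expr (r : R) : 0 <= r < 1 -> vanishing (fun n => r ^+ n).
Proof.
move=> /andP[r0 r1] eps e0; have : `|r| < 1 by rewrite ger0_norm.
move/cvg_expr/cvgr0Pnorm_le => /(_ eps e0)[N _ hN]; exists N => n /hN /=.
by rewrite ger0_norm// exprn_ge0.
Qed.

Lemma vanishing_expR (c : R) : 0 < c -> vanishing (fun n => expR (- (n%:R * c))).
Proof.
move=> c0; apply: (@vanishing_le _ (fun n => expR (- c) ^+ n)).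
  by move=> n; rewrite -expRM_natl mulrN.
by apply: vanishing_expr; rewrite expR_ge0 expR_lt1 oppr_lt0.
Qed.

Lemma expR_le_quad (x : R) : x <= 2^-1 -> expR x <= 1 + x + 2 * x ^+ 2.
Proof.
move=> x2; have h := expR_ge1Dx (- x); rewrite expRN in h.
have x1 : 0 < 1 - x by lra.
have : expR x <= (1 - x)^-1 by rewrite -[expR x]invrK lef_pV2 ?posrE ?invr_gt0 ?expR_gt0.
move=> /le_trans; apply; rewrite -[leLHS]mul1r ler_pdivrMr//.
by rewrite expr2; have : 0 <= x * x * (1 - 2 * x) by [rewrite mulr_ge0 -?expr2 ?sqr_ge0//; lra]; nra.
Qed.

Lemma chernoff (T : finType) (p f : T -> R) (a : R) :
  (forall t, 0 <= p t) -> \sum_t p t = 1 -> a < \sum_t p t * f t ->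
  vanishing (fun n => \sum_(w : {ffun 'I_n -> T} | \sum_i f (w i) <= n%:R * a) prodp p w).
Proof.
move=> p0 p1 hm; pose g t := a - f t; pose B := 1 + \sum_t `|g t|.
have gB t : `|g t| <= B.
  rewrite /B (bigD1 t)//= addrCA lerDl addr_ge0// sumr_ge0//.
have B1 : 1 <= B by rewrite lerDl sumr_ge0.
have B0 : 0 < B by lra.
pose del := \sum_t p t * f t - a; have d0 : 0 < del by rewrite subr_gt0.
have Eg : \sum_t p t * g t = - del.
  rewrite /g /del; under eq_bigr do rewrite mulrBr.
  by rewrite sumrB -mulr_suml p1 mul1r opprB.
have dB : del <= B.
  rewrite -[del]opprK -Eg -sumrN -[B]mul1r -p1 mulr_suml; apply: ler_sum => t _.
  by rewrite -mulrN ler_wpM2l// (le_trans _ (gB t))// -normrN ler_norm.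
(* With this value 2 s^2 B^2 is half of s del, so that r <= 1 - s del / 2, and s B <= 1/4 is in the
   range of [expR_le_quad]. *)
pose s := del / (4 * B ^+ 2).
have B20 : 0 < 4 * B ^+ 2 by rewrite mulr_gt0// exprn_gt0.
have s0 : 0 < s by rewrite divr_gt0.
have sB : s * B <= 4^-1.
  rewrite /s mulrAC ler_pdivrMr//; have := ler_wpM2r (ltW B0) dB; rewrite expr2; lra.
pose r := \sum_t p t * expR (s * g t).
have r0 : 0 <= r by apply: sumr_ge0 => t _; rewrite mulr_ge0// expR_ge0.
have sg t : s * g t <= s * B.
  by rewrite ler_wpM2l ?(ltW s0)// (le_trans (ler_norm _) (gB t)).
have g2 t : g t ^+ 2 <= B ^+ 2.
  by rewrite -[g t ^+ 2]real_normK ?num_real// lerXn2r ?nnegrE// ltW.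
have r1 : r < 1.
  apply: (@le_lt_trans _ _ (\sum_t p t * (1 + s * g t + 2 * (s ^+ 2 * B ^+ 2)))).
    apply: ler_sum => t _; rewrite ler_wpM2l//; apply: (le_trans (expR_le_quad _)).
      by apply: (le_trans (sg t)); apply: (le_trans sB); lra.
    by rewrite lerD2l exprMn ler_wpM2l// ler_wpM2l// sqr_ge0.
  have -> : \sum_t p t * (1 + s * g t + 2 * (s ^+ 2 * B ^+ 2)) = 1 - s * del + 2 * (s ^+ 2 * B ^+ 2).
    rewrite (eq_bigr (fun t => p t + s * (p t * g t) + p t * (2 * (s ^+ 2 * B ^+ 2)))) => [|t _]; last by ring.
    by rewrite !big_split/= -mulr_sumr Eg -mulr_suml p1; ring.
  have -> : 2 * (s ^+ 2 * B ^+ 2) = s * del / 2.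
    by rewrite /s; field; rewrite gt_eqF.
  have : 0 < s * del by rewrite mulr_gt0.
  by lra.
apply: (@vanishing_le _ (fun n => r ^+ n)); last by apply: vanishing_expr; rewrite r0.
move=> n; rewrite -[r ^+ n](_ : \sum_(w : {ffun 'I_n -> T}) prodp (fun t => p t * expR (s * g t)) w = _); last first.
  by rewrite sum_prodp card_ord.
rewrite big_mkcond/=; apply: ler_sum => w _; case: ifP => [hw|_]; last first.
  by apply: prodp_ge0 => t; rewrite mulr_ge0// expR_ge0.
rewrite {2}/prodp big_split/= -/(prodp p w); apply: ler_peMr; first exact: prodp_ge0.
rewrite -expR_sum -[leLHS]expR0 ler_expR -mulr_sumr mulr_ge0 ?(ltW s0)//.
by rewrite /g sumrB sumr_const card_ord -mulr_natl subr_ge0.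
Qed.

Section Density.
Variables (Q V S : finType) (pQ : Q -> R) (pV : Q -> V -> R) (A : Q -> V -> S -> R).
Hypotheses (pQ_ge0 : forall q, 0 <= pQ q) (pV_ge0 : forall q v, 0 <= pV q v).
Hypotheses (A_ge0 : forall q v s, 0 <= A q v s).
Hypothesis J_sum : \sum_q \sum_v \sum_s pQ q * (pV q v * A q v s) = 1.

(** Information density of v and s in state q. When the kernels come from a joint law its mean is
    I(V;S|Q) in nats, see [mean_dens_ent]. *)
Definition dens q v s := ln (A q v s / outp (pV q) (A q) s).
Definition mean_dens := \sum_q \sum_v \sum_s pQ q * (pV q v * A q v s) * dens q v s.

Let J (t : Q * (V * S)) := pQ t.1 * (pV t.1 t.2.1 * A t.1 t.2.1 t.2.2).
Let df (t : Q * (V * S)) := dens t.1 t.2.1 t.2.2.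
Let J_ge0 t : 0 <= J t. Proof. by rewrite /J !mulr_ge0. Qed.
Let sumJ (F : Q -> V -> S -> R) : \sum_t F t.1 t.2.1 t.2.2 = \sum_q \sum_v \sum_s F q v s.
Proof.
rewrite -(pair_bigA _ (fun q vs => F q vs.1 vs.2))/=; apply: eq_bigr => q _.
by rewrite pair_bigA.
Qed.

Definition bout n (u : {ffun 'I_n -> Q}) (s : {ffun 'I_n -> S}) :=
  \prod_i outp (pV (u i)) (A (u i)) (s i).

(** Blocks of probability zero contribute nothing, so [E] is required only where all letter
    likelihoods are positive; there the logarithm of the block likelihood ratio is the sum of the
    densities. *)
Lemma block_dens_sum n (ev : {ffun 'I_n -> Q} -> {ffun 'I_n -> V} -> {ffun 'I_n -> S} -> bool)
    (E : pred R) :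
  (forall u v s, ev u v s -> (forall i, 0 < A (u i) (v i) (s i) /\ 0 < outp (pV (u i)) (A (u i)) (s i)) ->
     E (\sum_i dens (u i) (v i) (s i))) ->
  \sum_(u : {ffun 'I_n -> Q}) prodp pQ u * (\sum_v \sum_(s | ev u v s) (\prod_i pV (u i) (v i)) * \prod_i A (u i) (v i) (s i)) <=
  \sum_(w : {ffun 'I_n -> Q * (V * S)} | E (\sum_i df (w i))) prodp J w.
Proof.
move=> h.
pose F (u : {ffun 'I_n -> Q}) (v : {ffun 'I_n -> V}) (s : {ffun 'I_n -> S}) : R :=
  if ev u v s then prodp pQ u * ((\prod_i pV (u i) (v i)) * \prod_i A (u i) (v i) (s i)) else 0.
have -> : \sum_(u : {ffun 'I_n -> Q}) prodp pQ u * (\sum_v \sum_(s | ev u v s) (\prod_i pV (u i) (v i)) * \prod_i A (u i) (v i) (s i)) =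
   \sum_u \sum_v \sum_s F u v s.
  apply: eq_bigr => u _; rewrite mulr_sumr; apply: eq_bigr => v _; rewrite mulr_sumr big_mkcond/=.
  by apply: eq_bigr.
under eq_bigr => u _ do rewrite (sum_ffun_pair (F u)).
rewrite (sum_ffun_pair (fun u (vs : {ffun 'I_n -> V * S}) => F u [ffun i => (vs i).1] [ffun i => (vs i).2])).
rewrite [leRHS]big_mkcond/=; apply: ler_sum => w _; rewrite /F.
set u := [ffun i => (w i).1]; set v := [ffun i => _]; set s := [ffun i => _].
have JE : prodp J w = prodp pQ u * ((\prod_i pV (u i) (v i)) * \prod_i A (u i) (v i) (s i)).
  rewrite /prodp /J -!big_split/=; apply: eq_bigr => i _.
  by rewrite /u /v /s !ffunE.
case: ifP => [he|_]; last by case: ifP => // _; apply: prodp_ge0.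
rewrite -JE; have := prodp_ge0 w J_ge0; rewrite le_eqVlt => /predU1P[<-|w0]; first by case: ifP.
have Jp := prodp_gt0 J_ge0 w0.
have -> : \sum_i df (w i) = \sum_i dens (u i) (v i) (s i).
  by apply: eq_bigr => i _; rewrite /u /v /s !ffunE.
rewrite h// => i; have := Jp i; rewrite /u /v /s !ffunE /J => hp.
have [hQ hVA] : pQ (w i).1 != 0 /\ pV (w i).1 (w i).2.1 * A (w i).1 (w i).2.1 (w i).2.2 != 0.
  by apply/andP; rewrite -negb_or -mulf_eq0 gt_eqF.
have hVAp : 0 < pV (w i).1 (w i).2.1 * A (w i).1 (w i).2.1 (w i).2.2.
  by rewrite lt_neqAle eq_sym hVA mulr_ge0.
split.
  by rewrite lt_neqAle A_ge0 andbT eq_sym; apply: contraNneq hVA => ->; rewrite mulr0.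
apply: (lt_le_trans hVAp); rewrite /outp (bigD1 (w i).2.1)//= lerDl.
by apply: sumr_ge0 => v' _; rewrite mulr_ge0.
Qed.

Lemma dens_upper_tail (a : R) : mean_dens < a ->
  vanishing (fun n => \sum_(u : {ffun 'I_n -> Q}) prodp pQ u *
    (\sum_(v : {ffun 'I_n -> V}) \sum_(s : {ffun 'I_n -> S} | expR (n%:R * a) * bout u s < \prod_i A (u i) (v i) (s i))
       (\prod_i pV (u i) (v i)) * \prod_i A (u i) (v i) (s i))).
Proof.
move=> ha; have J1 : \sum_t J t = 1 by rewrite (sumJ (fun q v s => pQ q * (pV q v * A q v s))).
have hm : - a < \sum_t J t * - df t.
  under eq_bigr do rewrite mulrN.
  by rewrite sumrN ltrN2 (sumJ (fun q v s => pQ q * (pV q v * A q v s) * dens q v s)).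
apply: vanishing_le (chernoff J_ge0 J1 hm) => n.
under [leRHS]eq_bigl do rewrite sumrN mulrN lerN2.
apply: (block_dens_sum (E := fun x => n%:R * a <= x)) => // u v s he hp.
rewrite /dens; under eq_bigr => i _ do rewrite ln_div ?posrE ?(hp i).1 ?(hp i).2//.
rewrite sumrB -!ln_prod => [||i]; [|by move=> i; exact: (hp i).2|exact: (hp i).1].
have b0 : 0 < bout u s by apply: prodr_gt0 => i _; exact: (hp i).2.
rewrite -[leLHS]expRK lerBrDr -lnM ?posrE ?expR_gt0// ler_ln ?posrE ?mulr_gt0 ?expR_gt0//.
  exact: ltW.
by apply: prodr_gt0 => i _; exact: (hp i).1.
Qed.

Lemma dens_lower_tail (a : R) : a < mean_dens ->
  vanishing (fun n => \sum_(u : {ffun 'I_n -> Q}) prodp pQ u *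
    (\sum_(v : {ffun 'I_n -> V}) \sum_(s : {ffun 'I_n -> S} | \prod_i A (u i) (v i) (s i) <= expR (n%:R * a) * bout u s)
       (\prod_i pV (u i) (v i)) * \prod_i A (u i) (v i) (s i))).
Proof.
move=> ha; have J1 : \sum_t J t = 1 by rewrite (sumJ (fun q v s => pQ q * (pV q v * A q v s))).
have hm : a < \sum_t J t * df t.
  by rewrite (sumJ (fun q v s => pQ q * (pV q v * A q v s) * dens q v s)).
apply: vanishing_le (chernoff J_ge0 J1 hm) => n.
apply: (block_dens_sum (E := fun x => x <= n%:R * a)) => // u v s he hp.
rewrite /dens; under eq_bigr => i _ do rewrite ln_div ?posrE ?(hp i).1 ?(hp i).2//.
rewrite sumrB -!ln_prod => [||i]; [|by move=> i; exact: (hp i).2|exact: (hp i).1].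
have b0 : 0 < bout u s by apply: prodr_gt0 => i _; exact: (hp i).2.
rewrite -[leRHS]expRK lerBlDr -lnM ?posrE ?expR_gt0// ler_ln ?posrE ?mulr_gt0 ?expR_gt0//.
by apply: prodr_gt0 => i _; exact: (hp i).1.
Qed.

End Density.

Section Block.
Variables (Q V S T O1 O2 : finType) (pQ : Q -> R) (pV : Q -> V -> R) (A : Q -> V -> S -> R)
  (B : Q -> S -> T -> R) (o1 : T -> O1) (o2 : T -> O2).
Hypotheses (pQ_ge0 : forall q, 0 <= pQ q) (pQ_sum : \sum_q pQ q = 1) (pV_ch : is_channel pV).
Hypotheses (A_ge0 : forall q v s, 0 <= A q v s) (A_sum : forall q v, \sum_s A q v s <= 1).
Hypotheses (B_ge0 : forall q s t, 0 <= B q s t) (B_sum : forall q s, \sum_t B q s t <= 1).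
Let C1 q := obs (A q) (B q) o1.
Let C2 q := obs (A q) (B q) o2.
Hypothesis JS : \sum_q \sum_v \sum_s pQ q * (pV q v * A q v s) = 1.
Hypothesis J1 : \sum_q \sum_v \sum_o pQ q * (pV q v * C1 q v o) = 1.
Hypothesis J2 : \sum_q \sum_v \sum_o pQ q * (pV q v * C2 q v o) = 1.

Let pV_ge0 q v : 0 <= pV q v. Proof. exact: (pV_ch q).1. Qed.
Let C1_ge0 q v o : 0 <= C1 q v o. Proof. exact: obs_ge0. Qed.
Let C2_ge0 q v o : 0 <= C2 q v o. Proof. exact: obs_ge0. Qed.

Definition bV n (u : {ffun 'I_n -> Q}) (v : {ffun 'I_n -> V}) := \prod_i pV (u i) (v i).
Definition bA n (u : {ffun 'I_n -> Q}) (v : {ffun 'I_n -> V}) (s : {ffun 'I_n -> S}) :=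
  \prod_i A (u i) (v i) (s i).
Definition bB n (u : {ffun 'I_n -> Q}) (s : {ffun 'I_n -> S}) (t : {ffun 'I_n -> T}) :=
  \prod_i B (u i) (s i) (t i).
Definition bo (O : finType) (o : T -> O) n (t : {ffun 'I_n -> T}) : {ffun 'I_n -> O} :=
  [ffun i => o (t i)].

Lemma outp_block (S' : finType) (A' : Q -> V -> S' -> R) n (u : {ffun 'I_n -> Q}) (s : {ffun 'I_n -> S'}) :
  outp (bV u) (fun (v : {ffun 'I_n -> V}) (s : {ffun 'I_n -> S'}) => \prod_i A' (u i) (v i) (s i)) s = bout pV A' u s.
Proof.
rewrite /outp /bout (bigA_distr_bigA (fun i v => pV (u i) v * A' (u i) v (s i))).
by apply: eq_bigr => v _; rewrite /bV -big_split.
Qed.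

Lemma obs_block (O : finType) (o : T -> O) n (u : {ffun 'I_n -> Q}) (v : {ffun 'I_n -> V}) (x : {ffun 'I_n -> O}) :
  obs (bA u) (bB u) (@bo O o n) v x = \prod_i obs (A (u i)) (B (u i)) o (v i) (x i).
Proof.
rewrite /obs (bigA_distr_bigA (fun i s => \sum_(t | o t == x i) A (u i) (v i) s * B (u i) s t)).
apply: eq_bigr => s _.
rewrite (bigA_distr_big_dep (fun i t => o t == x i)); apply: eq_big => [t|t _]; last first.
  by rewrite /bA /bB -big_split.
apply/eqP/familyP => [<- j|H]; first by rewrite unfold_in ffunE.
by apply/ffunP => j; rewrite ffunE; have := H j; rewrite unfold_in => /eqP.
Qed.

Lemma prod_sum_le1 (I S' : finType) (F : I -> S' -> R) : (forall i s, 0 <= F i s) ->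
  (forall i, \sum_s F i s <= 1) -> \sum_(s : {ffun I -> S'}) \prod_i F i (s i) <= 1.
Proof.
move=> F0 F1; rewrite -bigA_distr_bigA; apply: (@le_trans _ _ (\prod_(i : I) 1)); last by rewrite big1_eq.
by apply: ler_prod => i _; rewrite F1 sumr_ge0.
Qed.

(* The state sequence [u] is known to everybody. *)
Lemma block_coding (a : R) :
  mean_dens pQ pV A - mean_dens pQ pV C1 < a -> mean_dens pQ pV A - mean_dens pQ pV C2 < a ->
  forall eps, 0 < eps -> exists N, forall n, (N <= n)%N -> forall M, (0 < M)%N -> expR (n%:R * a) <= M%:R ->
  exists err : {ffun 'I_n -> Q} -> R, \sum_(u : {ffun 'I_n -> Q}) prodp pQ u * err u <= eps /\
  forall (u : {ffun 'I_n -> Q}) (gam : {ffun 'I_n -> V} -> {ffun 'I_n -> V} -> {ffun 'I_n -> S} -> {ffun 'I_n -> T} -> R) dmax,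
  0 <= dmax -> (forall v v' s t, 0 <= gam v v' s t) -> (forall v v' s t, gam v v' s t <= dmax) ->
  exists (f : {ffun 'I_n -> S} -> 'I_M) (G1 : 'I_M -> {ffun 'I_n -> O1} -> {ffun 'I_n -> V})
    (G2 : 'I_M -> {ffun 'I_n -> O2} -> {ffun 'I_n -> V}),
  \sum_s bout pV A u s * (\sum_t bB u s t * gam (G1 (f s) (bo o1 t)) (G2 (f s) (bo o2 t)) s t) <=
  \sum_v bV u v * (\sum_s bA u v s * \sum_t bB u s t * gam v v s t) + dmax * err u.
Proof.
move=> h1 h2 eps e0.
set mS := mean_dens pQ pV A in h1 h2; set m1 := mean_dens pQ pV C1 in h1; set m2 := mean_dens pQ pV C2 in h2.
pose m := Num.min m1 m2.
have hm1 : m <= m1 by rewrite /m ge_min lexx.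
have hm2 : m <= m2 by rewrite /m ge_min lexx orbT.
have hma : mS - m < a by rewrite /m; case: (leP m1 m2).
(* A quarter of the slack in the rate. A bin holds about exp(n (m - 2 del)) words, below the
   decoding threshold exp(n (m - del)); all bins together hold at least exp(n (mS + 2 del)), above
   the covering threshold exp(n (mS + del)). *)
pose del := (a - mS + m) / 4; have d0 : 0 < del by rewrite /del divr_gt0//; lra.
have d4 : a = mS - m + 4 * del by rewrite /del; field.
pose b := m - 2 * del.
pose tau n := expR (n%:R * (mS + del)); pose tau' n := expR (n%:R * (m - del)).
(* Half of the exponent gained in covering goes to [eta], the other half to tau / (M K eta). *)
pose eta n := expR (- (n%:R * (del / 2))).
have vS := dens_upper_tail pQ_ge0 pV_ge0 A_ge0 JS (a := mS + del) _.
have v1 := dens_lower_tail pQ_ge0 pV_ge0 C1_ge0 J1 (a := m - del) _.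
have v2 := dens_lower_tail pQ_ge0 pV_ge0 C2_ge0 J2 (a := m - del) _.
have {}vS := vS ltac:(rewrite -/mS; lra).
have {}v1 := v1 ltac:(rewrite -/m1; lra).
have {}v2 := v2 ltac:(rewrite -/m2; lra).
have ve := vanishing_expR (divr_gt0 d0 (ltr0Sn R 1)).
have := vanishingD (vanishingD (vanishingD vS (vanishingD v1 v2)) (vanishingD ve ve)) (vanishingD ve ve).
move=> /(_ eps e0)[N hN]; exists N => n nN M M0 hM; have {}hN := hN n nN.
(* The successor keeps K positive, as b may be negative; K.-1 is still at most exp(n b). *)
pose K := (Num.truncn (expR (n%:R * b))).+1.
have /andP[K1 K2] := truncn_itv (expR_ge0 (n%:R * b)).
have MK : expR (n%:R * (a + b)) <= (M * K)%:R.
  by rewrite natrM mulrDr expRD ler_pM ?expR_ge0// ltW.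
(* The error does not depend on the cost, which for the helper is known only once the second stage
   is built. *)
exists (fun u => one_shot_error M K (bV u) (bA u) (bB u) (@bo _ o1 n) (@bo _ o2 n) (tau n) (eta n) (tau' n) (tau' n)).
have PVs u : \sum_v bV (n := n) u v = 1.
  rewrite /bV -(bigA_distr_bigA (fun i v => pV (u i) v)) big1// => i _; exact: (pV_ch (u i)).2.
have PV0 u v : 0 <= bV (n := n) u v by apply: prodr_ge0.
have A0 u v s : 0 <= bA (n := n) u v s by apply: prodr_ge0.
have A1 u v : \sum_s bA (n := n) u v s <= 1 by apply: (prod_sum_le1 (F := fun i => A (u i) (v i))).
have B0 u s t : 0 <= bB (n := n) u s t by apply: prodr_ge0.
have B1 u s : \sum_t bB (n := n) u s t <= 1 by apply: (prod_sum_le1 (F := fun i => B (u i) (s i))).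
split; last first.
  move=> u gam dmax dm0 g0 g1.
  have [f [G1 [G2 hG]]] := one_shot (@bo _ o1 n) (@bo _ o2 n) (PV0 u) (PVs u) (A0 u) (A1 u) (B0 u) (B1 u)
    g0 g1 M0 (ltn0Sn _ : (0 < K)%N) dm0 (expR_ge0 _ : 0 <= tau n) (expR_gt0 _ : 0 < eta n) (expR_gt0 _ : 0 < tau' n) (expR_gt0 _ : 0 < tau' n).
  exists f, G1, G2; apply: le_trans hG; apply: ler_sum => s _.
  by rewrite outp_block.
have Pu : \sum_(u : {ffun 'I_n -> Q}) prodp pQ u = 1 by rewrite sum_prodp pQ_sum expr1n.
rewrite /one_shot_error; under eq_bigr do rewrite !mulrDr.
rewrite !big_split/= -!mulr_suml !Pu !mul1r.
have c1 : tau n / ((M * K)%:R * eta n) <= expR (- (n%:R * (del / 2))).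
  have MKp : 0 < (M * K)%:R :> R by rewrite ltr0n muln_gt0 M0.
  rewrite ler_pdivrMr ?mulr_gt0 ?expR_gt0// /eta mulrCA -expRD.
  apply: (@le_trans _ _ (expR (n%:R * (a + b)) * expR (- (n%:R * (del / 2)) + - (n%:R * (del / 2))))).
    by rewrite -expRD ler_expR /b d4; lra.
  by rewrite ler_wpM2r// expR_ge0.
have c2 : K.-1%:R / tau' n <= expR (- (n%:R * (del / 2))).
  rewrite ler_pdivrMr ?expR_gt0// -expRD; apply: (le_trans K1); rewrite ler_expR /b.
  have : 0 <= n%:R * del by rewrite mulr_ge0// ltW.
  lra.
have e1 : \sum_(u : {ffun 'I_n -> Q}) prodp pQ u * (\sum_v \sum_(s | tau n * outp (bV u) (bA u) s < bA u v s) bV u v * bA u v s) =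
  \sum_(u : {ffun 'I_n -> Q}) prodp pQ u *
    (\sum_(v : {ffun 'I_n -> V}) \sum_(s : {ffun 'I_n -> S} | expR (n%:R * (mS + del)) * bout pV A u s < \prod_i A (u i) (v i) (s i))
       (\prod_i pV (u i) (v i)) * \prod_i A (u i) (v i) (s i)).
  apply: eq_bigr => u _; congr (_ * _); apply: eq_bigr => v _; apply: eq_bigl => s.
  by rewrite outp_block.
have e2 (O : finType) (o : T -> O) : \sum_(u : {ffun 'I_n -> Q}) prodp pQ u * (\sum_v \sum_(x | obs (bA u) (bB u) (@bo _ o n) v x <= tau' n * outp (bV u) (obs (bA u) (bB u) (@bo _ o n)) x)
     bV u v * obs (bA u) (bB u) (@bo _ o n) v x) =
  \sum_(u : {ffun 'I_n -> Q}) prodp pQ u *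
    (\sum_(v : {ffun 'I_n -> V}) \sum_(s : {ffun 'I_n -> O} | \prod_i obs (A (u i)) (B (u i)) o (v i) (s i) <= expR (n%:R * (m - del)) * bout pV (fun q => obs (A q) (B q) o) u s)
       (\prod_i pV (u i) (v i)) * \prod_i obs (A (u i)) (B (u i)) o (v i) (s i)).
  apply: eq_bigr => u _; congr (_ * _); apply: eq_bigr => v _; apply: eq_big => [x|x _]; last by rewrite obs_block.
  rewrite obs_block -outp_block; congr (_ <= _ * _); apply: eq_bigr => v' _; by rewrite obs_block.
have arith (x1 x2 x3 c k e : R) : c <= e -> k <= e -> x1 + (x2 + x3) + (e + e) + (e + e) <= eps ->
    x1 + (e + c) + (x2 + k) + (x3 + k) <= eps by lra.
by rewrite e1 !e2; exact: arith c1 c2 hN.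
Qed.

End Block.
End Tail.

(** * Achievability *)

Section MeanDensity.
Variables (R : realType) (T Q V S : finType) (P : T -> R) (aQ : T -> Q) (aV : T -> V) (aS : T -> S).
Variables (pQ : Q -> R) (pV : Q -> V -> R) (A : Q -> V -> S -> R).
Hypothesis P_ge0 : forall t, 0 <= P t.
Hypothesis hQ : forall q, pQ q = pr P aQ q.
Hypothesis hQV : forall q v, pQ q * pV q v = pr P (jn aQ aV) (q, v).
Hypothesis hQVS : forall q v s, pQ q * (pV q v * A q v s) = pr P (jn (jn aQ aV) aS) (q, v, s).

Lemma joint_sum : \sum_t P t = 1 -> \sum_q \sum_v \sum_s pQ q * (pV q v * A q v s) = 1.
Proof.
move=> <-; rewrite -(sum_pr1 P (jn (jn aQ aV) aS)).
rewrite -(pair_bigA _ (fun qv s => pr P (jn (jn aQ aV) aS) (qv, s)))/=.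
rewrite -(pair_bigA _ (fun q v => \sum_s pr P (jn (jn aQ aV) aS) (q, v, s)))/=.
by apply: eq_bigr => q _; apply: eq_bigr => v _; apply: eq_bigr => s _.
Qed.

(** The hypotheses determine the kernels through products with the probability of the condition, so
    they are free on null events, and null [t] contribute nothing to either side. *)
Lemma mean_dens_ent : mean_dens pQ pV A =
  ent P (jn aQ aV) - ent P (jn (jn aQ aV) aS) + ent P (jn aQ aS) - ent P aQ.
Proof.
transitivity (\sum_t P t * dens pV A (aQ t) (aV t) (aS t)).
  rewrite (sum_pr P (jn (jn aQ aV) aS) (fun w => dens pV A w.1.1 w.1.2 w.2)).
  rewrite -(pair_bigA _ (fun qv s => pr P (jn (jn aQ aV) aS) (qv, s) * dens pV A qv.1 qv.2 s))/=.
  rewrite -(pair_bigA _ (fun q v => \sum_s pr P (jn (jn aQ aV) aS) (q, v, s) * dens pV A q v s))/=.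
  by apply: eq_bigr => q _; apply: eq_bigr => v _; apply: eq_bigr => s _; rewrite hQVS.
rewrite /ent -sumrB -big_split -sumrB/=; apply: eq_bigr => t _.
have := P_ge0 t; rewrite le_eqVlt => /predU1P[<-|t0]; first by rewrite !mul0r; ring.
have q0 := pr_gt0 P_ge0 aQ t0; have qv0 := pr_gt0 P_ge0 (jn aQ aV) t0.
have qs0 := pr_gt0 P_ge0 (jn aQ aS) t0; have qvs0 := pr_gt0 P_ge0 (jn (jn aQ aV) aS) t0.
have eA : A (aQ t) (aV t) (aS t) = pr P (jn (jn aQ aV) aS) (aQ t, aV t, aS t) / pr P (jn aQ aV) (aQ t, aV t).
  by rewrite -hQVS -hQV mulrA mulrAC divff ?mul1r// hQV gt_eqF.
have eO : outp (pV (aQ t)) (A (aQ t)) (aS t) = pr P (jn aQ aS) (aQ t, aS t) / pr P aQ (aQ t).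
  rewrite -(pr3_sum2 P aQ aV aS); under eq_bigr do rewrite -hQVS.
  by rewrite -mulr_sumr -hQ mulrC mulKf// hQ gt_eqF.
rewrite /dens eA eO !ln_div ?posrE ?divr_gt0//.
by rewrite /jn; ring.
Qed.

End MeanDensity.

(** The case of no state, for the first stage: the mean density is I(V;S). *)
Lemma mean_dens_ent_unit (R : realType) (T V S : finType) (P : T -> R) (aV : T -> V) (aS : T -> S)
    (pV : unit -> V -> R) (A : unit -> V -> S -> R) :
  (forall t, 0 <= P t) -> \sum_t P t = 1 -> (forall v, pV tt v = pr P aV v) ->
  (forall v s, pV tt v * A tt v s = pr P (jn aV aS) (v, s)) ->
  mean_dens (fun=> 1) pV A = ent P aV - ent P (jn aV aS) + ent P aS /\
  \sum_q \sum_v \sum_s 1 * (pV q v * A q v s) = 1.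
Proof.
move=> P0 P1 hV hVS; pose aQ (_ : T) := tt.
have hQ (w : unit) : 1 = pr P aQ w by rewrite -P1; apply: eq_bigl => t; case: w.
have hQV (w : unit) v : 1 * pV w v = pr P (jn aQ aV) (w, v).
  by rewrite mul1r; case: w; rewrite hV; apply: eq_bigl => t; rewrite xpair_eqE.
have hQVS (w : unit) v s : 1 * (pV w v * A w v s) = pr P (jn (jn aQ aV) aS) (w, v, s).
  by rewrite mul1r; case: w; rewrite hVS; apply: eq_bigl => t; rewrite !xpair_eqE.
split; last exact: joint_sum hQVS P1.
rewrite (mean_dens_ent P0 hQ hQV hQVS) (ent_unit P1 (A := aQ))// subr0.
congr (_ - _ + _); apply: (ent_eq P0) => t t'; rewrite /jn; first [by move=> -> | by move=> [-> ->] | by move=> [->]].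
Qed.

Section Rates.
Variable R : realType.

Lemma trunc_rate (a b : R) : 0 <= a -> a < b ->
  exists N, forall n, (N <= n)%N -> expR (n%:R * a) <= (Num.truncn (expR (n%:R * b)))%:R.
Proof.
move=> a0 ab; pose c := b - a; have c0 : 0 < c by rewrite subr_gt0.
(* From here on n (b - a) >= 1, so exp(n b) >= 2 exp(n a); as exp(n a) >= 1, the surplus covers the
   rounding. *)
exists (Num.truncn c^-1).+1 => n hn.
have ci : 0 <= c^-1 by rewrite invr_ge0 ltW.
have /andP[_ h1] := truncn_itv ci.
have nc : 1 <= n%:R * c.
  rewrite -ler_pdivrMr// div1r; apply: (le_trans (ltW h1)); by rewrite ler_nat.
have e2 : 2 <= expR (n%:R * c) by have := expR_ge1Dx (n%:R * c); lra.
have ea : 1 <= expR (n%:R * a) by rewrite -[leLHS]expR0 ler_expR mulr_ge0.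
have /andP[_ h2] := truncn_itv (expR_ge0 (n%:R * b)).
have eb : expR (n%:R * b) = expR (n%:R * a) * expR (n%:R * c) by rewrite -expRD /c; congr expR; ring.
rewrite -natr1 in h2; have := ler_wpM2l (expR_ge0 (n%:R * a)) e2; rewrite -eb; lra.
Qed.

Lemma powR2E (a : R) : powR 2 a = expR (a * ln 2).
Proof. by rewrite /powR pnatr_eq0. Qed.

End Rates.

(** * The two-stage code for given U and V *)

Section Sufficiency.
Variables (R : realType) (X Y Z Xh U V : finType).
Variables (pZY : Z * Y -> R) (W : Z -> X -> R) (d : X -> Xh -> R).
Hypotheses (HpZY : is_pmf pZY) (HW : is_channel W) (Hd : forall x xh, 0 <= d x xh).
Variables (q : Y -> U -> R) (r : X * U -> V -> R) (xhat : U -> V -> Z -> Xh).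
Hypotheses (hq : is_channel q) (hr : is_channel r).
Local Notation p := (pXYZ pZY W).
Local Notation T5 := (X * Y * Z * U * V)%type.

Let p_ge0 x y z : 0 <= p x y z. Proof. exact: (src_ge0 HpZY HW (x, y, z)). Qed.
Let q_ge0 y u : 0 <= q y u. Proof. exact: (hq y).1. Qed.
Let r_ge0 xu v : 0 <= r xu v. Proof. exact: (hr xu).1. Qed.

Definition jnt (t : T5) : R := let: (x, y, z, u, v) := t in p x y z * q y u * r (x, u) v.
Definition aX (t : T5) := t.1.1.1.1.
Definition aY (t : T5) := t.1.1.1.2.
Definition aZ (t : T5) := t.1.1.2.
Definition aU (t : T5) := t.1.2.
Definition aV (t : T5) := t.2.

Lemma jnt_ge0 t : 0 <= jnt t.
Proof.
case: t => -[[[x y] z] u] v; rewrite /jnt.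
by apply: mulr_ge0; [apply: mulr_ge0; [exact: p_ge0|exact: q_ge0]|exact: r_ge0].
Qed.

Lemma pr_full x y z u v : pr jnt (jn (jn aX aV) (jn aY (jn aU aZ))) (x, v, (y, (u, z))) = p x y z * q y u * r (x, u) v.
Proof.
rewrite /pr (big_pred1 (x, y, z, u, v))// => -[[[[x' y'] z'] u'] v'].
rewrite !xpair_eqE/= /aX /aY /aZ /aU /aV/= !xpair_eqE.
by case: (x' == x); case: (y' == y); case: (z' == z); case: (u' == u); case: (v' == v).
Qed.

Lemma pr_UXZY u x z y : pr jnt (jn (jn aU (jn aX aZ)) aY) (u, (x, z), y) = p x y z * q y u.
Proof.
rewrite -[RHS]mulr1 -(hr (x, u)).2 mulr_sumr; under eq_bigr do rewrite -pr_full.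
rewrite /pr (partition_big aV xpredT)//=; apply: eq_bigr => v _; apply: eq_bigl => t.
rewrite !xpair_eqE/=.
by case: (aX t == x); case: (aY t == y); case: (aZ t == z); case: (aU t == u); rewrite ?andbF ?andbT.
Qed.

Definition pXZU x z u := \sum_y p x y z * q y u.
Definition pXU x u := \sum_z pXZU x z u.
Definition pY y := \sum_x \sum_z p x y z.
Definition pU u := \sum_y pY y * q y u.

Lemma pXZU_ge0 x z u : 0 <= pXZU x z u.
Proof. by apply: sumr_ge0 => y _; rewrite mulr_ge0. Qed.
Lemma pXU_ge0 x u : 0 <= pXU x u.
Proof. by apply: sumr_ge0 => z _; exact: pXZU_ge0. Qed.
Lemma pY_ge0 y : 0 <= pY y.
Proof. by apply: sumr_ge0 => x _; apply: sumr_ge0. Qed.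
Lemma pU_ge0 u : 0 <= pU u.
Proof. by apply: sumr_ge0 => y _; rewrite mulr_ge0// pY_ge0. Qed.

Lemma pr_UXY u x y : pr jnt (jn (jn aU aX) aY) (u, x, y) = q y u * \sum_z p x y z.
Proof.
rewrite mulrC mulr_suml; under eq_bigr do rewrite -pr_UXZY.
rewrite /pr (partition_big aZ xpredT)//=; apply: eq_bigr => z _; apply: eq_bigl => t.
rewrite !xpair_eqE/=.
by case: (aX t == x); case: (aY t == y); case: (aZ t == z); case: (aU t == u); rewrite ?andbF ?andbT.
Qed.

Lemma pr_UXZ u x z : pr jnt (jn (jn aU aX) aZ) (u, x, z) = pXZU x z u.
Proof.
rewrite /pXZU; under eq_bigr do rewrite -pr_UXZY.
rewrite /pr (partition_big aY xpredT)//=; apply: eq_bigr => y _; apply: eq_bigl => t.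
rewrite !xpair_eqE/=.
by case: (aX t == x); case: (aY t == y); case: (aZ t == z); case: (aU t == u); rewrite ?andbF ?andbT.
Qed.

Lemma pr_UX u x : pr jnt (jn aU aX) (u, x) = pXU x u.
Proof. by rewrite -(pr_jnr jnt (jn aU aX) aZ); apply: eq_bigr => z _; rewrite pr_UXZ. Qed.

Lemma pr_UY u y : pr jnt (jn aU aY) (u, y) = pY y * q y u.
Proof.
rewrite -(pr3_sum2 jnt aU aX aY) /pY mulr_suml; apply: eq_bigr => x _.
by rewrite pr_UXY mulrC.
Qed.

Lemma pr_Y y : pr jnt aY y = pY y.
Proof.
by rewrite -(pr_jnl jnt aU aY); under eq_bigr do rewrite pr_UY; rewrite -mulr_sumr (hq y).2 mulr1.
Qed.

Lemma pr_U u : pr jnt aU u = pU u.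
Proof. by rewrite -(pr_jnr jnt aU aY); apply: eq_bigr => y _; rewrite pr_UY. Qed.

Lemma pr_UZ u z : pr jnt (jn aU aZ) (u, z) = \sum_x pXZU x z u.
Proof. by rewrite -(pr3_sum2 jnt aU aX aZ); apply: eq_bigr => x _; rewrite pr_UXZ. Qed.

Lemma pr_VZXU v z x u : pr jnt (jn (jn aV aZ) (jn aX aU)) (v, z, (x, u)) = r (x, u) v * pXZU x z u.
Proof.
rewrite mulrC mulr_suml; under eq_bigr do rewrite -pr_full.
rewrite /pr (partition_big aY xpredT)//=; apply: eq_bigr => y _; apply: eq_bigl => t.
rewrite !xpair_eqE/=.
by case: (aX t == x); case: (aY t == y); case: (aZ t == z); case: (aU t == u); rewrite ?andbF ?andbT.
Qed.

Lemma pr_UVX u v x : pr jnt (jn (jn aU aV) aX) (u, v, x) = pXU x u * r (x, u) v.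
Proof.
rewrite mulr_suml /=; under eq_bigr do rewrite mulrC -pr_VZXU.
rewrite /pr (partition_big aZ xpredT)//=; apply: eq_bigr => z _; apply: eq_bigl => t.
rewrite !xpair_eqE/=.
by case: (aX t == x); case: (aV t == v); case: (aZ t == z); case: (aU t == u); rewrite ?andbF ?andbT.
Qed.

Lemma pr_UVZ u v z : pr jnt (jn (jn aU aV) aZ) (u, v, z) = \sum_x pXZU x z u * r (x, u) v.
Proof.
under eq_bigr do rewrite mulrC -pr_VZXU.
rewrite /pr (partition_big aX xpredT)//=; apply: eq_bigr => x _; apply: eq_bigl => t.
rewrite !xpair_eqE/=.
by case: (aX t == x); case: (aV t == v); case: (aZ t == z); case: (aU t == u); rewrite ?andbF ?andbT.
Qed.

Lemma pr_UV u v : pr jnt (jn aU aV) (u, v) = \sum_x pXU x u * r (x, u) v.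
Proof. by rewrite -(pr_jnr jnt (jn aU aV) aX); apply: eq_bigr => x _; rewrite pr_UVX. Qed.

Lemma pY_sum1 : \sum_y pY y = 1.
Proof.
rewrite -(src_sum1 HpZY HW) /pY exchange_big/= -(pair_bigA _ (fun xy z => src pZY W (xy, z)))/=.
by rewrite -(pair_bigA _ (fun x y => \sum_z src pZY W (x, y, z)))/=.
Qed.

Lemma jnt_sum1 : \sum_t jnt t = 1.
Proof. by rewrite -(sum_pr1 jnt aY) -pY_sum1; apply: eq_bigr => y _; rewrite pr_Y. Qed.

Lemma pU_sum1 : \sum_u pU u = 1.
Proof. by rewrite -jnt_sum1 -(sum_pr1 jnt aU); apply: eq_bigr => u _; rewrite pr_U. Qed.

Local Notation H A := (ent jnt A).

(** On the left is I(U;Y) - I(U;X); U is independent of X given Y. *)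
Lemma helper_gap : H aY - H (jn aU aY) + H (jn aU aX) - H aX =
  cond_mutual_info jnt aU aY aX * ln 2.
Proof.
rewrite (cond_mutual_infoE jnt_ge0).
have := condindep_ent jnt_ge0 (F := fun u y => q y u) (G := fun x y => \sum_z p x y z) pr_UXY.
have -> : H (jn (jn aU aX) aY) = H (jn (jn aU aY) aX).
  by apply: (ent_eq jnt_ge0) => t t' []; rewrite /jn => -> -> ->.
have -> : H (jn aX aY) = H (jn aY aX).
  by apply: (ent_eq jnt_ge0) => t t' []; rewrite /jn => -> ->.
by lra.
Qed.

(* [I(U;X) <= I(U;Z)]: whatever bin the encoder can resolve, so can the decoder. *)
Lemma decoder_gap : H aX - H (jn aU aX) <= H aZ - H (jn aU aZ).
Proof.
(* The factor p(x|z) makes U - Z - X a Markov chain; the claim is then data processing. *)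
have e u x z : pr jnt (jn (jn aU aX) aZ) (u, x, z) = (\sum_y pZY (z, y) * q y u) * W z x.
  by rewrite pr_UXZ /pXZU mulr_suml; apply: eq_bigr => y _; rewrite /pXYZ; ring.
have := condindep_ent jnt_ge0 (F := fun u z => \sum_y pZY (z, y) * q y u) (G := fun x z => W z x) e.
have : H (jn (jn aU aX) aZ) + H aX <= H (jn aU aX) + H (jn aX aZ).
  by apply: (ent_submod jnt_ge0) => t t' []; rewrite /jn //; move=> -> -> _ ->.
by lra.
Qed.

(** On the left is I(X;V|U) - I(Z;V|U); V is independent of Z given (X, U). *)
Lemma encoder_gap : H (jn aU aX) - H (jn (jn aU aV) aX) + H (jn (jn aU aV) aZ) - H (jn aU aZ) =
  cond_mutual_info jnt aX aV (jn aU aZ) * ln 2.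
Proof.
rewrite (cond_mutual_infoE jnt_ge0).
have := condindep_ent jnt_ge0 (F := fun v xu => r xu v) (G := fun z (xu : X * U) => pXZU xu.1 z xu.2)
  (fun v z => (fun '(x, u) => pr_VZXU v z x u)).
have -> : H (jn aX aU) = H (jn aU aX).
  by apply: (ent_eq jnt_ge0) => t t' []; rewrite /jn => -> ->.
have -> : H (jn aV (jn aX aU)) = H (jn (jn aU aV) aX).
  by apply: (ent_eq jnt_ge0) => t t' []; rewrite /jn => -> -> ->.
have -> : H (jn aZ (jn aX aU)) = H (jn aX (jn aU aZ)).
  by apply: (ent_eq jnt_ge0) => t t' []; rewrite /jn => -> -> ->.
have -> : H (jn (jn aV aZ) (jn aX aU)) = H (jn (jn aX aV) (jn aU aZ)).
  by apply: (ent_eq jnt_ge0) => t t' []; rewrite /jn => -> -> -> ->.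
have -> : H (jn (jn aU aV) aZ) = H (jn aV (jn aU aZ)).
  by apply: (ent_eq jnt_ge0) => t t' []; rewrite /jn => -> -> ->.
by lra.
Qed.

(* [p(y|u)] and [p(x,z|y)], zero when the condition is a null event. *)
Definition helper_post (_ : unit) u y := pY y * q y u / pU u.
Definition source_kernel (_ : unit) y (t : X * Z) := p t.1 y t.2 / pY y.
Variable x0 : X.
(* [p(v|u)], [p(x|u,v)] and [p(z|x,u)]; block coding needs [p(v|u)] to be a pmf also
   when [p(u) = 0], whence the dummy [x0]. *)
Definition test_channel u v := if pU u == 0 then r (x0, u) v else (\sum_x pXU x u * r (x, u) v) / pU u.
Definition encoder_post u v x := pXU x u * r (x, u) v / (pU u * test_channel u v).
Definition side_kernel u x z := pXZU x z u / pXU x u.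

(** The joint law vanishes with the probability of the condition, so the product rules for the
    kernels below hold without side conditions. *)
Lemma pU_sub0 u y : pU u = 0 -> pY y * q y u = 0.
Proof.
move=> h; apply/eqP; have := h; rewrite /pU => /eqP; rewrite psumr_eq0 => [|y' _]; last by rewrite mulr_ge0// pY_ge0.
by move/allP/(_ y); rewrite mem_index_enum => /(_ isT).
Qed.

Lemma pY_sub0 x y z : pY y = 0 -> p x y z = 0.
Proof.
move=> h; apply: le_anti; rewrite p_ge0 andbT -h /pY (bigD1 x)//= (bigD1 z)//= -addrA lerDl addr_ge0// sumr_ge0// => *.
exact: sumr_ge0.
Qed.

Lemma pXU_sub0 x z u : pXU x u = 0 -> pXZU x z u = 0.
Proof.
move=> h; apply: le_anti; rewrite pXZU_ge0 andbT -h /pXU (bigD1 z)//= lerDl sumr_ge0// => *.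
exact: pXZU_ge0.
Qed.

Lemma pU_helper_post u y : pU u * helper_post tt u y = pY y * q y u.
Proof.
rewrite /helper_post; have [u0|u0] := eqVneq (pU u) 0; first by rewrite u0 mul0r pU_sub0.
by rewrite mulrC divfK.
Qed.

Lemma pY_source_kernel y t : pY y * source_kernel tt y t = p t.1 y t.2.
Proof.
rewrite /source_kernel; have [y0|y0] := eqVneq (pY y) 0; first by rewrite y0 mul0r pY_sub0.
by rewrite mulrC divfK.
Qed.

Lemma pXU_side_kernel x z u : pXU x u * side_kernel u x z = pXZU x z u.
Proof.
rewrite /side_kernel; have [y0|y0] := eqVneq (pXU x u) 0; first by rewrite y0 mul0r pXU_sub0.
by rewrite mulrC divfK.
Qed.

Lemma pU_test_channel u v : pU u * test_channel u v = pr jnt (jn aU aV) (u, v).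
Proof.
rewrite /test_channel; case: eqP => [u0|/eqP u0]; last by rewrite mulrC divfK// pr_UV.
rewrite u0 mul0r; apply/esym/eqP; rewrite eq_le (pr_ge0 jnt_ge0) andbT -u0 -pr_U.
by apply: (pr_det_le jnt_ge0) => t [].
Qed.

Lemma pUVX u v x : pU u * (test_channel u v * encoder_post u v x) = pXU x u * r (x, u) v.
Proof.
rewrite mulrA /encoder_post; have [u0|u0] := eqVneq (pU u * test_channel u v) 0; last by rewrite mulrC divfK.
rewrite u0 mul0r; apply/esym/eqP; rewrite -pr_UVX eq_le (pr_ge0 jnt_ge0) andbT -u0 pU_test_channel.
by apply: (pr_det_le jnt_ge0) => t; rewrite /jn => -[-> -> _].
Qed.

Lemma test_channel_channel : is_channel test_channel.
Proof.
move=> u; rewrite /test_channel; case: eqP => [_|/eqP u0]; split; try move=> v.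
- exact: r_ge0.
- exact: (hr _).2.
- by rewrite divr_ge0 ?pU_ge0// sumr_ge0// => x _; rewrite mulr_ge0// pXU_ge0.
- rewrite -mulr_suml; under eq_bigr do rewrite -pr_UV.
  by rewrite pr_jnr pr_U divff.
Qed.

Lemma helper_post_ge0 w u y : 0 <= helper_post w u y.
Proof. by rewrite /helper_post divr_ge0 ?mulr_ge0 ?pY_ge0 ?pU_ge0. Qed.
Lemma source_kernel_ge0 w y t : 0 <= source_kernel w y t.
Proof. by rewrite /source_kernel divr_ge0 ?pY_ge0. Qed.
Lemma encoder_post_ge0 u v x : 0 <= encoder_post u v x.
Proof. by rewrite /encoder_post divr_ge0 ?mulr_ge0 ?pXU_ge0 ?pU_ge0// (test_channel_channel u).1. Qed.
Lemma side_kernel_ge0 u x z : 0 <= side_kernel u x z.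
Proof. by rewrite /side_kernel divr_ge0 ?pXZU_ge0 ?pXU_ge0. Qed.

(** A kernel sums to such a quotient, which is 0 on a null condition: this is why one-shot coding
    asks for sums at most 1 only. *)
Lemma divr_self_le1 (a : R) : a / a <= 1.
Proof. by have [->|a0] := eqVneq a 0; rewrite ?mul0r ?ler01// divff. Qed.

Lemma helper_post_sum w u : \sum_y helper_post w u y <= 1.
Proof. by rewrite -mulr_suml divr_self_le1. Qed.
Lemma source_kernel_sum w y : \sum_t source_kernel w y t <= 1.
Proof. by rewrite -mulr_suml -(pair_bigA _ (fun x z => p x y z))/= divr_self_le1. Qed.
Lemma encoder_post_sum u v : \sum_x encoder_post u v x <= 1.
Proof. by rewrite -mulr_suml -pr_UV pU_test_channel divr_self_le1. Qed.
Lemma side_kernel_sum u x : \sum_z side_kernel u x z <= 1.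
Proof. by rewrite -mulr_suml divr_self_le1. Qed.

Lemma pU_obsX u x : pU u * obs (helper_post tt) (source_kernel tt) fst u x = pXU x u.
Proof.
rewrite /obs mulr_sumr /pXU /pXZU exchange_big/=; apply: eq_bigr => y _.
transitivity (\sum_(t : X * Z | t.1 == x) p t.1 y t.2 * q y u).
  by rewrite mulr_sumr; apply: eq_bigr => t _; rewrite mulrA pU_helper_post mulrAC pY_source_kernel.
rewrite (reindex (fun z => (x, z)))/=.
  by apply: eq_bigl => z; rewrite eqxx.
by exists snd => [z _|[x' z]]//=; rewrite inE/= => /eqP ->.
Qed.

Lemma pU_obsZ u z : pU u * obs (helper_post tt) (source_kernel tt) snd u z = \sum_x pXZU x z u.
Proof.
rewrite /obs mulr_sumr /pXZU exchange_big/=; apply: eq_bigr => y _.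
transitivity (\sum_(t : X * Z | t.2 == z) p t.1 y t.2 * q y u).
  by rewrite mulr_sumr; apply: eq_bigr => t _; rewrite mulrA pU_helper_post mulrAC pY_source_kernel.
rewrite (reindex (fun x => (x, z)))/=.
  by apply: eq_bigl => x; rewrite eqxx.
by exists fst => [x _|[x z']]//=; rewrite inE/= => /eqP ->.
Qed.

Lemma pUV_obs u v z : pU u * (test_channel u v * obs (encoder_post u) (side_kernel u) id v z) = \sum_x pXZU x z u * r (x, u) v.
Proof.
rewrite /obs !mulr_sumr; apply: eq_bigr => x _; rewrite big_pred1_eq.
by rewrite (mulrA (test_channel u v)) (mulrA (pU u)) pUVX mulrAC pXU_side_kernel.
Qed.


Local Notation codeword_pmf := (fun _ : unit => pU).

Lemma stage1_dens :
  [/\ mean_dens (fun=> 1) codeword_pmf helper_post = H aU - H (jn aU aY) + H aY,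
      mean_dens (fun=> 1) codeword_pmf (fun w => obs (helper_post w) (source_kernel w) fst) = H aU - H (jn aU aX) + H aX
    & mean_dens (fun=> 1) codeword_pmf (fun w => obs (helper_post w) (source_kernel w) snd) = H aU - H (jn aU aZ) + H aZ].
Proof.
have hU u : pU u = pr jnt aU u by rewrite pr_U.
split.
- by apply: (mean_dens_ent_unit jnt_ge0 jnt_sum1 (pV := codeword_pmf) hU _).1 => u y; rewrite pU_helper_post pr_UY.
- by apply: (mean_dens_ent_unit jnt_ge0 jnt_sum1 (pV := codeword_pmf) hU _).1 => u x; rewrite pU_obsX pr_UX.
- by apply: (mean_dens_ent_unit jnt_ge0 jnt_sum1 (pV := codeword_pmf) hU _).1 => u z; rewrite pU_obsZ pr_UZ.
Qed.

Lemma stage1_joint :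
  [/\ \sum_w \sum_u \sum_y 1 * (codeword_pmf w u * helper_post w u y) = 1,
      \sum_w \sum_u \sum_x 1 * (codeword_pmf w u * obs (helper_post w) (source_kernel w) fst u x) = 1
    & \sum_w \sum_u \sum_z 1 * (codeword_pmf w u * obs (helper_post w) (source_kernel w) snd u z) = 1].
Proof.
have hU u : pU u = pr jnt aU u by rewrite pr_U.
split.
- by apply: (mean_dens_ent_unit jnt_ge0 jnt_sum1 (pV := codeword_pmf) (A := helper_post) hU (aS := aY) _).2 => u y; rewrite pU_helper_post pr_UY.
- by apply: (mean_dens_ent_unit jnt_ge0 jnt_sum1 (pV := codeword_pmf) (A := fun w => obs (helper_post w) (source_kernel w) fst) hU (aS := aX) _).2 => u x; rewrite pU_obsX pr_UX.
- by apply: (mean_dens_ent_unit jnt_ge0 jnt_sum1 (pV := codeword_pmf) (A := fun w => obs (helper_post w) (source_kernel w) snd) hU (aS := aZ) _).2 => u z; rewrite pU_obsZ pr_UZ.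
Qed.

Lemma stage2_dens :
  mean_dens pU test_channel encoder_post - mean_dens pU test_channel (fun u => obs (encoder_post u) (side_kernel u) id) =
  cond_mutual_info jnt aX aV (jn aU aZ) * ln 2.
Proof.
have hU u : pU u = pr jnt aU u by rewrite pr_U.
have h1 u v x : pU u * (test_channel u v * encoder_post u v x) = pr jnt (jn (jn aU aV) aX) (u, v, x).
  by rewrite pUVX pr_UVX.
have h2 u v z : pU u * (test_channel u v * obs (encoder_post u) (side_kernel u) id v z) = pr jnt (jn (jn aU aV) aZ) (u, v, z).
  by rewrite pUV_obs pr_UVZ.
rewrite (mean_dens_ent jnt_ge0 hU pU_test_channel h1) (mean_dens_ent jnt_ge0 (A := fun u => obs (encoder_post u) (side_kernel u) id) hU pU_test_channel h2).
by rewrite -encoder_gap; lra.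
Qed.

Lemma stage2_joint :
  \sum_u \sum_v \sum_x pU u * (test_channel u v * encoder_post u v x) = 1 /\
  \sum_u \sum_v \sum_z pU u * (test_channel u v * obs (encoder_post u) (side_kernel u) id v z) = 1.
Proof.
split.
  by apply: (@joint_sum _ _ _ _ _ jnt aU aV aX _ _ _ _ jnt_sum1) => u v x; rewrite pUVX pr_UVX.
by apply: (@joint_sum _ _ _ _ _ jnt aU aV aZ pU test_channel (fun u => obs (encoder_post u) (side_kernel u) id) _ jnt_sum1) => u v z; rewrite pUV_obs pr_UVZ.
Qed.

Lemma pU_outp u x : pU u * outp (test_channel u) (encoder_post u) x = pXU x u.
Proof.
rewrite /outp mulr_sumr; under eq_bigr do rewrite pUVX.
by rewrite -mulr_sumr (hr _).2 mulr1.
Qed.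

Lemma outp_helper_post w y : outp (codeword_pmf w) (helper_post w) y = pY y.
Proof.
case: w; rewrite /outp; under eq_bigr do rewrite pU_helper_post.
by rewrite -mulr_sumr (hq y).2 mulr1.
Qed.

Definition dist n (xs : {ffun 'I_n -> X}) (u : {ffun 'I_n -> U}) (v : {ffun 'I_n -> V}) (zs : {ffun 'I_n -> Z}) : R :=
  n%:R^-1 * \sum_(i < n) d (xs i) (xhat (u i) (v i) (zs i)).

Definition dmax : R := \sum_x \sum_xh d x xh.

Lemma dmax_ge0 : 0 <= dmax.
Proof. by apply: sumr_ge0 => x _; apply: sumr_ge0. Qed.

Lemma d_le x xh : d x xh <= dmax.
Proof.
rewrite /dmax (bigD1 x)//= (bigD1 xh)//= -addrA lerDl addr_ge0 ?sumr_ge0// => x' _.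
exact: sumr_ge0.
Qed.

Lemma dist_ge0 n xs u v zs : 0 <= @dist n xs u v zs.
Proof. by rewrite /dist mulr_ge0 ?invr_ge0// sumr_ge0. Qed.

Lemma dist_le n xs u v zs : (0 < n)%N -> @dist n xs u v zs <= dmax.
Proof.
move=> n0; rewrite /dist mulrC ler_pdivrMr ?ltr0n//.
apply: (@le_trans _ _ (\sum_(i < n) dmax)); first by apply: ler_sum => i _; exact: d_le.
by rewrite sumr_const card_ord mulr_natr.
Qed.

Let aW := jn aU (jn aV (jn aX aZ)).

Lemma pr_W u v x z : pr jnt aW (u, (v, (x, z))) = pU u * (test_channel u v * (encoder_post u v x * side_kernel u x z)).
Proof.
rewrite (mulrA (test_channel u v)) (mulrA (pU u)) pUVX mulrAC pXU_side_kernel mulrC -pr_VZXU; apply: eq_bigl => t.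
rewrite !xpair_eqE/=.
by case: (aX t == x); case: (aV t == v); case: (aZ t == z); case: (aU t == u); rewrite ?andbF ?andbT.
Qed.

(** Under the ideal law the letters (U_i, V_i, X_i, Z_i) are i.i.d., so the block distortion has the
    single-letter mean. *)
Lemma ideal_distortion n : (0 < n)%N ->
  \sum_(u : {ffun 'I_n -> U}) prodp pU u * (\sum_v bV test_channel u v * (\sum_xs bA encoder_post u v xs *
     (\sum_zs bB side_kernel u xs zs * dist xs u v zs))) =
  \sum_t jnt t * d (aX t) (xhat (aU t) (aV t) (aZ t)).
Proof.
move=> n0.
transitivity (\sum_(u : {ffun 'I_n -> U}) \sum_(v : {ffun 'I_n -> V}) \sum_(xs : {ffun 'I_n -> X}) \sum_(zs : {ffun 'I_n -> Z})
   (\prod_i pr jnt aW (u i, (v i, (xs i, zs i)))) * dist xs u v zs).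
  apply: eq_bigr => u _; rewrite mulr_sumr; apply: eq_bigr => v _; rewrite !mulr_sumr; apply: eq_bigr => xs _.
  rewrite !mulr_sumr; apply: eq_bigr => zs _; move: (dist _ _ _ _) => D0; rewrite !mulrA; congr (_ * _).
  rewrite /prodp /bV /bA /bB -!big_split/=; apply: eq_bigr => i _.
  by rewrite pr_W !mulrA.
under eq_bigr do under eq_bigr do rewrite sum_ffun_pair.
under eq_bigr do rewrite sum_ffun_pair.
rewrite sum_ffun_pair.
transitivity (\sum_(w : {ffun 'I_n -> U * (V * (X * Z))}) prodp (pr jnt aW) w *
   (n%:R^-1 * \sum_(i < n) d (w i).2.2.1 (xhat (w i).1 (w i).2.1 (w i).2.2.2))).
  apply: eq_bigr => w _; rewrite /dist /prodp; congr (_ * (_ * _)).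
    by apply: eq_bigr => i _; rewrite !ffunE; case: (w i) => ? [? []].
  by apply: eq_bigr => i _; rewrite !ffunE.
under eq_bigr do rewrite mulrCA mulr_sumr.
rewrite -mulr_sumr exchange_big/=.
have W1 : \sum_w pr jnt aW w = 1 by rewrite sum_pr1 jnt_sum1.
under eq_bigr => i _ do rewrite (prodp_marginal (fun w : U * (V * (X * Z)) => d w.2.2.1 (xhat w.1 w.2.1 w.2.2.2)) i W1).
rewrite sumr_const card_ord -[X in _ * X]mulr_natl mulKf ?pnatr_eq0 -?lt0n//.
by rewrite -(sum_pr jnt aW).
Qed.

Lemma bo_id n (zs : {ffun 'I_n -> Z}) : bo id zs = zs.
Proof. by apply/ffunP => i; rewrite ffunE. Qed.

(** The i.i.d. law of (U^n, X^n, Z^n) is the interface of the stages: the ideal cost of the first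
    ([stage1_weight]) and the actual cost of the second are both taken under it. *)
Lemma stage2_weight n (u : {ffun 'I_n -> U}) xs zs :
  prodp pU u * (bout test_channel encoder_post u xs * bB side_kernel u xs zs) = \prod_i pXZU (xs i) (zs i) (u i).
Proof.
rewrite /prodp /bout /bB -!big_split/=; apply: eq_bigr => i _.
by rewrite mulrA pU_outp pXU_side_kernel.
Qed.

Lemma stage1_weight n (w : {ffun 'I_n -> unit}) (u : {ffun 'I_n -> U}) ts :
  \sum_ys bV codeword_pmf w u * (bA helper_post w u ys * bB source_kernel w ys ts) = \prod_i pXZU (ts i).1 (ts i).2 (u i).
Proof.
rewrite /pXZU (bigA_distr_bigA (fun i y => p (ts i).1 y (ts i).2 * q y (u i))).
apply: eq_bigr => ys _; rewrite /bV /bA /bB -!big_split/=; apply: eq_bigr => i _.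
by case: (w i); rewrite mulrA pU_helper_post mulrAC pY_source_kernel.
Qed.

Lemma source_weight n (w : {ffun 'I_n -> unit}) ys ts :
  bout codeword_pmf helper_post w ys * bB source_kernel w ys ts = \prod_i p (ts i).1 (ys i) (ts i).2.
Proof.
rewrite /bout /bB -!big_split/=; apply: eq_bigr => i _; rewrite outp_helper_post.
by case: (w i); rewrite pY_source_kernel.
Qed.

Lemma sl_achievable D Rt R1 :
  \sum_t jnt t * d (aX t) (xhat (aU t) (aV t) (aZ t)) <= D ->
  cond_mutual_info jnt aU aY aX < R1 -> cond_mutual_info jnt aX aV (jn aU aZ) < Rt ->
  achievable pZY W d D Rt R1.
Proof.
move=> hD h1 h2 eps0 eps0_gt0.
have l2 : 0 < ln 2 :> R by rewrite ln_gt0// ltr1n.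
have dm1 : 0 < 2 * (dmax + 1) by have := dmax_ge0; lra.
(* Each stage may lose dmax * eps; the + 1 avoids a division by zero. *)
pose eps := eps0 / (2 * (dmax + 1)); have eps_gt0 : 0 < eps by rewrite divr_gt0.
have eps_le : dmax * eps + dmax * eps <= eps0.
  have : eps * (2 * (dmax + 1)) = eps0 by rewrite divfK ?gt_eqF.
  by lra.
set c1 := cond_mutual_info jnt aU aY aX in h1; set c2 := cond_mutual_info jnt aX aV _ in h2.
have c1_ge0 : 0 <= c1 * ln 2.
  by rewrite /c1 (cond_mutual_infoE jnt_ge0); have := ent_submod0 jnt_ge0 aU aY aX; lra.
have c2_ge0 : 0 <= c2 * ln 2.
  by rewrite /c2 (cond_mutual_infoE jnt_ge0); have := ent_submod0 jnt_ge0 aX aV (jn aU aZ); lra.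
(* Midpoints, as room is needed twice: above the informations for the error exponents, and below the
   rates for rounding the sizes of the message sets. *)
pose a1 := (c1 * ln 2 + R1 * ln 2) / 2; pose a2 := (c2 * ln 2 + Rt * ln 2) / 2.
have {}h1 : c1 * ln 2 < R1 * ln 2 by rewrite ltr_pM2r.
have {}h2 : c2 * ln 2 < Rt * ln 2 by rewrite ltr_pM2r.
have [N1 hN1] : exists N, forall n, (N <= n)%N -> expR (n%:R * a1) <= (Num.truncn (expR (n%:R * (R1 * ln 2))))%:R.
  by apply: trunc_rate; rewrite /a1; lra.
have [N2 hN2] : exists N, forall n, (N <= n)%N -> expR (n%:R * a2) <= (Num.truncn (expR (n%:R * (Rt * ln 2))))%:R.
  by apply: trunc_rate; rewrite /a2; lra.
have [dA1 dX dZ] := stage1_dens; have [jA jX jZ] := stage1_joint.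
have unit1 : \sum_(w : unit) (1 : R) = 1 by rewrite sumr_const card_unit.
have g1 := helper_gap; have g2 := decoder_gap; rewrite -/c1 in g1.
have rX : mean_dens (fun=> 1) codeword_pmf helper_post - mean_dens (fun=> 1) codeword_pmf (fun w => obs (helper_post w) (source_kernel w) fst) < a1.
  by rewrite dA1 dX /a1; lra.
have rZ : mean_dens (fun=> 1) codeword_pmf helper_post - mean_dens (fun=> 1) codeword_pmf (fun w => obs (helper_post w) (source_kernel w) snd) < a1.
  by rewrite dA1 dZ /a1; lra.
have pV1_channel : is_channel codeword_pmf by move=> _; split; [exact: pU_ge0|exact: pU_sum1].
have [N3 hN3] := block_coding (fun=> ler01) unit1 pV1_channel helper_post_ge0 helper_post_sum source_kernel_ge0 source_kernel_sum jA jX jZ rX rZ eps_gt0.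
have [jA2 jZ2] := stage2_joint; have g3 := stage2_dens.
have r2 : mean_dens pU test_channel encoder_post - mean_dens pU test_channel (fun u => obs (encoder_post u) (side_kernel u) id) < a2.
  by rewrite g3 -/c2 /a2; lra.
(* The second stage has a single decoder, entered twice with the observation Z^n. *)
have [N4 hN4] := block_coding pU_ge0 pU_sum1 test_channel_channel encoder_post_ge0 encoder_post_sum side_kernel_ge0 side_kernel_sum jA2 jZ2 jZ2 r2 r2 eps_gt0.
exists (maxn 1 (maxn (maxn N1 N2) (maxn N3 N4))) => n.
rewrite !geq_max => /and3P[n_gt0 /andP[n1 n2] /andP[n3 n4]].
pose M1 := Num.truncn (expR (n%:R * (R1 * ln 2))); pose M := Num.truncn (expR (n%:R * (Rt * ln 2))).
have M1_gt0 : (0 < M1)%N by rewrite -(ltr0n R); apply: lt_le_trans (hN1 n n1); exact: expR_gt0.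
have M_gt0 : (0 < M)%N by rewrite -(ltr0n R); apply: lt_le_trans (hN2 n n2); exact: expR_gt0.
exists M1, M; split.
  by rewrite powR2E -mulrA; have /andP[] := truncn_itv (expR_ge0 (n%:R * (R1 * ln 2))).
split.
  by rewrite powR2E -mulrA; have /andP[] := truncn_itv (expR_ge0 (n%:R * (Rt * ln 2))).
have [err1 [herr1 code1]] := hN3 n n3 M1 M1_gt0 (hN1 n n1).
have [err2 [herr2 code2]] := hN4 n n4 M M_gt0 (hN2 n n2).
(* The second-stage codes come first, since they define the cost of the first stage. *)
have /choice[F hF] : forall u : {ffun 'I_n -> U}, exists fG : ({ffun 'I_n -> X} -> 'I_M) * ('I_M -> {ffun 'I_n -> Z} -> {ffun 'I_n -> V}),
    \sum_xs bout test_channel encoder_post u xs * (\sum_zs bB side_kernel u xs zs * dist xs u (fG.2 (fG.1 xs) zs) zs) <=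
    \sum_v bV test_channel u v * (\sum_xs bA encoder_post u v xs * \sum_zs bB side_kernel u xs zs * dist xs u v zs) + dmax * err2 u.
  move=> u; have [//||f [G1 [G2 hf]]] := code2 u (fun _ v xs zs => dist xs u v zs) dmax dmax_ge0.
  - by move=> *; exact: dist_ge0.
  - by move=> *; exact: dist_le.
  exists (f, G2); apply: le_trans hf; apply: ler_sum => xs _; rewrite ler_wpM2l//.
    by apply: prodr_ge0 => i _; apply: outp_ge0 => [v|v x]; [exact: (test_channel_channel _).1|exact: encoder_post_ge0].
  by apply: ler_sum => zs _; rewrite bo_id.
(* [u] is the word recovered by the encoder and [u'] that of the decoder; for equal words this is
   the distortion of the second stage. *)
pose recon u (xs : {ffun 'I_n -> X}) u' (zs : {ffun 'I_n -> Z}) := dist xs u' ((F u').2 ((F u).1 xs) zs) zs.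
pose w0 : {ffun 'I_n -> unit} := [ffun=> tt].
have [//||f1 [K1 [K2 hf1]]] := code1 w0 (fun u u' _ ts => recon u (bo fst ts) u' (bo snd ts)) dmax dmax_ge0.
- by move=> *; exact: dist_ge0.
- by move=> *; exact: dist_le.
exists f1, (fun xs m => (F (K1 m xs)).1 xs),
  (fun t m zs => [ffun i => xhat (K2 m zs i) ((F (K2 m zs)).2 t zs i) (zs i)]).
have -> : code_distortion pZY W d f1 (fun xs m => (F (K1 m xs)).1 xs)
  (fun t m zs => [ffun i => xhat (K2 m zs i) ((F (K2 m zs)).2 t zs i) (zs i)]) =
  \sum_ys bout codeword_pmf helper_post w0 ys * (\sum_ts bB source_kernel w0 ys ts * recon (K1 (f1 ys) (bo fst ts)) (bo fst ts) (K2 (f1 ys) (bo snd ts)) (bo snd ts)).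
  rewrite /code_distortion exchange_big/=; apply: eq_bigr => ys _.
  rewrite sum_ffun_pair mulr_sumr; apply: eq_bigr => ts _; rewrite mulrA source_weight; congr (_ * _).
    by apply: eq_bigr => i _; rewrite !ffunE.
  by rewrite /recon /dist; congr (_ * _); apply: eq_bigr => i _; rewrite !ffunE.
apply: (le_trans hf1).
have -> : \sum_u bV codeword_pmf w0 u * (\sum_ys bA helper_post w0 u ys * (\sum_ts bB source_kernel w0 ys ts * recon u (bo fst ts) u (bo snd ts))) =
  \sum_(u : {ffun 'I_n -> U}) prodp pU u * (\sum_xs bout test_channel encoder_post u xs * (\sum_zs bB side_kernel u xs zs * dist xs u ((F u).2 ((F u).1 xs) zs) zs)).
  apply: eq_bigr => u _.
  transitivity (\sum_(ts : {ffun 'I_n -> X * Z}) (\prod_i pXZU (ts i).1 (ts i).2 (u i)) * recon u (bo fst ts) u (bo snd ts)).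
    under [RHS]eq_bigr do rewrite -(stage1_weight w0) mulr_suml.
    rewrite [RHS]exchange_big/= mulr_sumr; apply: eq_bigr => ys _; rewrite !mulr_sumr.
    by apply: eq_bigr => ts _; rewrite !mulrA.
  transitivity (\sum_(xs : {ffun 'I_n -> X}) \sum_(zs : {ffun 'I_n -> Z}) (\prod_i pXZU (xs i) (zs i) (u i)) * recon u xs u zs).
    rewrite sum_ffun_pair; apply: eq_bigr => ts _; congr (_ * _).
    by apply: eq_bigr => i _; rewrite !ffunE.
  rewrite mulr_sumr; apply: eq_bigr => xs _; rewrite !mulr_sumr; apply: eq_bigr => zs _.
  by rewrite -stage2_weight !mulrA.
(* [w0] is the only sequence over [unit], so the average of [err1] is its value there. *)
have u1 : err1 w0 <= eps.
  apply: le_trans herr1; rewrite (bigD1 w0)//= [X in _ + X]big1 ?addr0.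
    by rewrite /prodp big1_eq mul1r.
  by move=> w /negP[]; apply/eqP/ffunP => i; case: (w i); case: (w0 i).
have u2 : \sum_(u : {ffun 'I_n -> U}) prodp pU u * (\sum_xs bout test_channel encoder_post u xs * (\sum_zs bB side_kernel u xs zs * dist xs u ((F u).2 ((F u).1 xs) zs) zs)) <=
   D + dmax * eps.
  apply: (@le_trans _ _ (\sum_(u : {ffun 'I_n -> U}) prodp pU u * (\sum_v bV test_channel u v * (\sum_xs bA encoder_post u v xs * (\sum_zs bB side_kernel u xs zs * dist xs u v zs)) + dmax * err2 u))).
    by apply: ler_sum => u _; rewrite ler_wpM2l// prodp_ge0//; exact: pU_ge0.
  under eq_bigr do rewrite mulrDr mulrCA.
  rewrite big_split/= ideal_distortion// -mulr_sumr; apply: lerD => //.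
  by rewrite ler_wpM2l// dmax_ge0.
have u3 := ler_wpM2l dmax_ge0 u1.
by clear -u2 u3 eps_le; lra.
Qed.

End Sufficiency.

Lemma sl_region_op_region (R : realType) (X Y Z Xh : finType)
  (pZY : Z * Y -> R) (W : Z -> X -> R) (d : X -> Xh -> R) (D Rt R1 : R) :
  is_pmf pZY -> is_channel W -> (forall x xh, 0 <= d x xh) ->
  sl_region pZY W d D Rt R1 -> op_region pZY W d D Rt R1.
Proof.
move=> HpZY HW Hd [U [V [q [r [xhat [hq [hr /= [hD [h1 h2]]]]]]]]] e e0.
have [[z0 y0] _|zy0] := pickP (fun _ : Z * Y => true); last first.
  by have := HpZY.2; rewrite big_pred0// => /eqP; rewrite eq_sym oner_eq0.
have [x0 _|X0] := pickP (fun _ : X => true); last first.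
  by have := (HW z0).2; rewrite big_pred0// => /eqP; rewrite eq_sym oner_eq0.
(* The closure permits rates larger by e / 2, which makes the information inequalities strict. *)
exists (Rt + e / 2), (R1 + e / 2); split; last first.
  by split; rewrite opprD addNKr normrN gtr0_norm ?divr_gt0//; lra.
apply: (sl_achievable HpZY HW Hd (xhat := xhat) hq hr x0).
- apply: le_trans hD; apply: ler_sum => t _; rewrite /jnt; by case: t => -[[[x y] z] u] v.
- apply: (le_lt_trans h1); lra.
- apply: (le_lt_trans h2); lra.
Qed.

Theorem theorem3 (R : realType) (X Y Z Xh : finType)
  (pZY : Z * Y -> R) (W : Z -> X -> R) (d : X -> Xh -> R)
  (HpZY : is_pmf pZY) (HW : is_channel W) (Hd : forall x xh, 0 <= d x xh)
  (D : R) :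
  forall Rt R1 : R,
    op_region pZY W d D Rt R1 <-> sl_region pZY W d D Rt R1.
Proof.
move=> Rt R1; split; first exact: op_region_sl_region.
exact: sl_region_op_region.
Qed.
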